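(* Let $X,Y,T$ be metric spaces, where $X$ and $Y$ are complete. For every $t\in T$ let measures $\mu_t\in\mathcal{P}_r(X)$ and $\nu_t\in\mathcal{P}_r(Y)$ be given such that the mappings $t\mapsto\mu_t$ and $t\mapsto\nu_t$ are continuous in the weak topology, and let $(t,x,y)\mapsto h_t(x,y)$ be a continuous nonnegative function on $T\times X\times Y$. Suppose that for every $t\in T$ there exist nonnegative Borel functions $a_t\in L^1(\mu_t)$ and $b_t\in L^1(\nu_t)$ such that $$h_t(x,y)\le a_t(x)+b_t(y),\qquad \lim_{R\to+\infty}\sup_{t\in T}\Bigl(\int_{\{a_t\ge R\}}a_t\,d\mu_t+\int_{\{b_t\ge R\}}b_t\,d\nu_t\Bigr)=0.$$ Then one can select $\varepsilon$-optimal measures $\sigma_t^\varepsilon\in\Pi(\mu_t,\nu_t)$ for the cost functions $h_t$ such that, for every fixed $\varepsilon>0$, the mapping $t\mapsto\sigma_t^\varepsilon$ is continuous in the weak topology. If for every $t\in T$ there is a unique optimal plan $\sigma_t\in\Pi(\mu_t,\nu_t)$ for $h_t$, then $t\mapsto\sigma_t$ is continuous (in the weak topology).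
   Context: $\mathcal{P}_r(Z)$ is the set of Radon probability measures on $Z$: Borel probability measures $\mu$ such that for every Borel set $B$ and $\varepsilon>0$ there is a compact set $K\subset B$ with $\mu(B\setminus K)<\varepsilon$. The weak topology is generated by the integrals of bounded continuous functions. $\Pi(\mu,\nu)$ is the set of Borel probability measures $\sigma$ on $X\times Y$ with $\sigma(A\times Y)=\mu(A)$ and $\sigma(X\times B)=\nu(B)$ for all Borel $A\subset X$, $B\subset Y$. For a nonnegative Borel function $h$ on $X\times Y$, $K_h(\mu,\nu)=\inf_{\sigma\in\Pi(\mu,\nu)}\int h\,d\sigma$. A measure $\sigma\in\Pi(\mu,\nu)$ is an optimal plan for $h$ if $\int h\,d\sigma=K_h(\mu,\nu)$; for $\varepsilon>0$ it is $\varepsilon$-optimal for $h$ if $\int h\,d\sigma\le K_h(\mu,\nu)+\varepsilon$. *)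

(* Defs.v *)
From HB Require Import structures.
From mathcomp Require Import all_boot all_order all_algebra.
From mathcomp Require Import all_classical all_reals all_analysis.

Set Implicit Arguments.
Unset Strict Implicit.
Unset Printing Implicit Defensive.

Import Order.TTheory GRing.Theory Num.Theory.
Import numFieldNormedType.Exports.

Local Open Scope classical_set_scope.
Local Open Scope ring_scope.

(* Measurable types are pointed in the library, and so are complete ones.  This
   only excludes the empty space, which carries no probability measure. *)
#[short(type="completeMetricType")]
HB.structure Definition CompleteMetric (R : numDomainType) :=
  {X of Metric R X & Complete X}.

(* On a product, [borel (X * Y)%type] is generated by the open sets of the product
   topology; without separability it can be strictly finer than the product of
   the two Borel sigma-algebras. *)
Definition borel (Z : ptopologicalType) : measurableType (@open Z).-sigma :=
  g_sigma_algebraType (@open Z).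

(* The library has the pointed and the topological structure of a product, but
   not their join. *)
HB.instance Definition _ (X Y : ptopologicalType) := Pointed.on (X * Y)%type.

Definition radon_probability (R : realType) (Z : ptopologicalType) :
    set (probability (borel Z) R) :=
  [set mu | forall B : set (borel Z), measurable B ->
    forall eps : R, 0 < eps ->
    exists K : set Z, [/\ compact K, K `<=` B & (mu (B `\` K) < eps%:E)%E]].

Definition bounded_continuous (R : realType) (Z : ptopologicalType) :
    set (Z -> R) :=
  [set f | continuous f /\ exists M : R, forall z, `|f z| <= M].

Definition weak_probability (R : realType) (Z : ptopologicalType) :
    topologicalType :=
  sup_topology (fun f : {f : Z -> R | bounded_continuous f} =>
    Topological.class (initial_topology (fun mu : probability (borel Z) R =>
      \int[mu]_z (sval f z)))).

Definition plans (R : realType) (X Y : ptopologicalType)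
    (mu : probability (borel X) R) (nu : probability (borel Y) R) :
    set (probability (borel (X * Y)%type) R) :=
  [set sigma |
    (forall A : set (borel X), measurable A -> sigma (A `*` [set: Y]) = mu A) /\
    (forall B : set (borel Y), measurable B -> sigma ([set: X] `*` B) = nu B)].

Definition transport_cost (R : realType) (X Y : ptopologicalType)
    (h : X -> Y -> R) (sigma : probability (borel (X * Y)%type) R) : \bar R :=
  (\int[sigma]_p (h p.1 p.2)%:E)%E.

Definition kantorovich_cost (R : realType) (X Y : ptopologicalType)
    (h : X -> Y -> R)
    (mu : probability (borel X) R) (nu : probability (borel Y) R) : \bar R :=
  ereal_inf (transport_cost h @` plans mu nu).

Definition optimal_plan (R : realType) (X Y : ptopologicalType)
    (h : X -> Y -> R)
    (mu : probability (borel X) R) (nu : probability (borel Y) R) :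
    set (probability (borel (X * Y)%type) R) :=
  [set sigma | plans mu nu sigma /\
    transport_cost h sigma = kantorovich_cost h mu nu].

Definition eps_optimal_plan (R : realType) (X Y : ptopologicalType)
    (eps : R) (h : X -> Y -> R)
    (mu : probability (borel X) R) (nu : probability (borel Y) R) :
    set (probability (borel (X * Y)%type) R) :=
  [set sigma | plans mu nu sigma /\
    (transport_cost h sigma <= kantorovich_cost h mu nu + eps%:E)%E].

(* Elements of [probability] are functions on all sets, so measures are compared
   on measurable sets only: Leibniz equality would also constrain the junk
   values on nonmeasurable sets. *)
Definition unique_optimal_plan (R : realType) (X Y : ptopologicalType)
    (h : X -> Y -> R)
    (mu : probability (borel X) R) (nu : probability (borel Y) R)
    (sigma : probability (borel (X * Y)%type) R) : Prop :=
  optimal_plan h mu nu sigma /\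
  forall sigma', optimal_plan h mu nu sigma' ->
    forall A : set (borel (X * Y)%type), measurable A -> sigma' A = sigma A.

(* Main.v *)
(* Tight families of plans converge along ultrafilters (Prokhorov, without
   separability), and the uniform integrability of [a] and [b] bounds the cost of a
   plan, up to a small error that is uniform in [t], by the mean of the truncated
   cost [min h N].  So limits of nearly optimal plans give the lower semicontinuity
   of the Kantorovich cost in [t].

   Upper semicontinuity comes from lifting: given a plan at [t0] and a bounded
   continuous [F], there is a weakly continuous selection of plans whose mean of [F]
   at [t0] is close to that of the given plan.  Cut the mass of the plan along a
   partition of unity on a large compact set, replace each piece by a tensor product
   of pieces of [mu t] and [nu t], with a weight that keeps the marginals below
   [mu t] and [nu t], and complete by the product of the missing marginals.  Hence
   there are selections that are epsilon-optimal near a given parameter; their convex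
   combinations with the weights of a partition of unity on [T] remain
   epsilon-optimal.

   When optimal plans are unique, every limit of optimal plans is optimal by the
   semicontinuity of the cost, hence it is the optimal plan. *)
Require Import Defs.
From HB Require Import structures.
From mathcomp Require Import all_boot all_order all_algebra.
From mathcomp Require Import all_classical all_reals all_analysis.
From mathcomp Require Import measurable_realfun giry ring lra wochoice.

Set Implicit Arguments.
Unset Strict Implicit.
Unset Printing Implicit Defensive.

Import Order.TTheory GRing.Theory Num.Theory.
Import numFieldNormedType.Exports.

Local Open Scope classical_set_scope.
Local Open Scope ring_scope.

(** * Means of bounded Borel functions *)

(** The Borel sets of the product may form a strictly finer sigma-algebra than the product one, so
    prescribing values on rectangles does not directly give a measure. Products, densities and
    convex combinations are therefore defined as functionals on bounded Borel functions, by iterated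
    means or finite sums, and each functional is turned into a probability.

    The completion in the lifting divides by the missing mass, which may vanish at some parameters.
    Both missing marginals have that same mass, so the numerator is of second order in it and the
    quotient stays continuous through the zeros.

    A compact set of almost full mass at [t0] may have little mass for [mu t] with [t] near [t0];
    only its open neighbourhoods keep theirs. Hence uniform estimates are made on neighbourhoods of
    compact sets.

    Each local selection belongs to a base point in [T], and base points jump. The partition of
    unity is chosen so that the base point of each of its functions is locally constant where the
    function is positive. *)

Lemma cvg_sum (R : realType) (T J : Type) (F : set_system T) (FF : Filter F)
    (r : seq J) (f : J -> T -> R) (l : J -> R) :
  (forall j, f j x @[x --> F] --> l j) ->
  \sum_(j <- r) f j x @[x --> F] --> \sum_(j <- r) l j.
Proof. by move=> fl; apply: cvg_big => // x; exact: add_continuous. Qed.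

Section bounded_borel.
Context {R : realType} {Z : ptopologicalType}.
Implicit Types (f g : Z -> R) (P : probability (borel Z) R).

Lemma open_borel (U : set Z) : open U -> measurable (U : set (borel Z)).
Proof. by move=> oU; apply: sub_sigma_algebra. Qed.

Lemma closed_borel (C : set Z) : closed C -> measurable (C : set (borel Z)).
Proof.
move=> cC; rewrite -(setCK C); apply: measurableC; apply: open_borel.
exact: closed_openC.
Qed.

Lemma continuous_borel f : continuous f ->
  measurable_fun setT (f : borel Z -> R).
Proof.
move=> cf; apply: (measurability _ (RGenOInfty.measurableE R)) => //.
move=> _ [_ [r ->] <-]; rewrite setTI; apply: open_borel.
by apply: open_comp => //; exact: open_gt.
Qed.

Definition bounded_borel f :=
  measurable_fun setT (f : borel Z -> R) /\ exists M : R, forall z, `|f z| <= M.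

Lemma bounded_continuous_borel f : bounded_continuous f -> bounded_borel f.
Proof. by move=> [cf bf]; split => //; exact: continuous_borel. Qed.

Lemma bounded_borel_integrable P f : bounded_borel f ->
  P.-integrable setT (EFin \o (f : borel Z -> R)).
Proof.
move=> [mf [M Mf]]; apply: measurable_bounded_integrable => //.
  by rewrite [X in (X < _)%E]probability_setT ltry.
exists M; split; first exact: num_real.
by move=> N MN z _; apply: le_trans (Mf z) _; exact: ltW.
Qed.

Lemma bounded_borel_cst (r : R) : bounded_borel (fun=> r).
Proof. by split; [exact: measurable_cst|exists `|r|]. Qed.

Lemma bounded_borelD f g : bounded_borel f -> bounded_borel g ->
  bounded_borel (fun z => f z + g z).
Proof.
move=> [mf [M Mf]] [mg [N Ng]]; split; first exact: measurable_funD.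
by exists (M + N) => z; rewrite (le_trans (ler_normD _ _))// lerD.
Qed.

Lemma bounded_borelM f g : bounded_borel f -> bounded_borel g ->
  bounded_borel (fun z => f z * g z).
Proof.
move=> [mf [M Mf]] [mg [N Ng]]; split; first exact: measurable_funM.
by exists (M * N) => z; rewrite normrM ler_pM.
Qed.

Lemma bounded_borelN f : bounded_borel f -> bounded_borel (fun z => - f z).
Proof.
move=> [mf [M Mf]]; split; first exact: measurableT_comp.
by exists M => z; rewrite normrN.
Qed.

Lemma bounded_borelB f g : bounded_borel f -> bounded_borel g ->
  bounded_borel (fun z => f z - g z).
Proof. by move=> bf bg; apply: bounded_borelD => //; exact: bounded_borelN. Qed.

Lemma bounded_borel_norm f : bounded_borel f -> bounded_borel (fun z => `|f z|).
Proof.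
move=> [mf [M Mf]]; split; first exact: measurableT_comp.
by exists M => z; rewrite normr_id.
Qed.

Lemma bounded_borel_indic (A : set Z) : measurable (A : set (borel Z)) ->
  bounded_borel (\1_A).
Proof.
move=> mA; split; first exact: measurable_indic.
by exists 1 => z; rewrite indicE; case: (_ \in _); rewrite /= ?normr1 ?normr0.
Qed.

Lemma bounded_borel_sum (I : Type) (s : seq I) (F : I -> Z -> R) :
  (forall i, bounded_borel (F i)) -> bounded_borel (fun z => \sum_(i <- s) F i z).
Proof.
move=> bF; elim: s => [|i s IH].
  by under eq_fun do rewrite big_nil; exact: bounded_borel_cst.
by under eq_fun do rewrite big_cons; exact: bounded_borelD.
Qed.

Lemma mean_cst P (r : R) : \int[P]_z r = r.
Proof. by rewrite Rintegral_cst// [X in fine X](probability_setT P) mulr1. Qed.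

Lemma meanD P f g : bounded_borel f -> bounded_borel g ->
  \int[P]_z (f z + g z) = \int[P]_z f z + \int[P]_z g z.
Proof. by move=> bf bg; apply: RintegralD => //; exact: bounded_borel_integrable. Qed.

Lemma meanB P f g : bounded_borel f -> bounded_borel g ->
  \int[P]_z (f z - g z) = \int[P]_z f z - \int[P]_z g z.
Proof. by move=> bf bg; apply: RintegralB => //; exact: bounded_borel_integrable. Qed.

Lemma meanZ P f (r : R) : bounded_borel f ->
  \int[P]_z (r * f z) = r * \int[P]_z f z.
Proof. by move=> bf; apply: RintegralZl => //; exact: bounded_borel_integrable. Qed.

Lemma le_mean P f g : bounded_borel f -> bounded_borel g ->
  (forall z, f z <= g z) -> \int[P]_z f z <= \int[P]_z g z.
Proof.
by move=> bf bg fg; apply: le_Rintegral => //; exact: bounded_borel_integrable.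
Qed.

Lemma norm_mean_le P f : bounded_borel f ->
  `|\int[P]_z f z| <= \int[P]_z `|f z|.
Proof. by move=> bf; apply: le_normr_Rintegral => //; exact: bounded_borel_integrable. Qed.

Lemma norm_mean_bound P f (M : R) : bounded_borel f -> (forall z, `|f z| <= M) ->
  `|\int[P]_z f z| <= M.
Proof.
move=> bf fM; rewrite (le_trans (norm_mean_le P bf))// -(mean_cst P M).
by apply: le_mean => //; [exact: bounded_borel_norm|exact: bounded_borel_cst].
Qed.

Lemma mean_sum P (I : Type) (s : seq I) (F : I -> Z -> R) :
  (forall i, bounded_borel (F i)) ->
  \int[P]_z (\sum_(i <- s) F i z) = \sum_(i <- s) \int[P]_z F i z.
Proof.
move=> bF; elim: s => [|i s IH].
  by rewrite big_nil -[RHS](mean_cst P); apply: eq_Rintegral => z _; rewrite big_nil.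
rewrite big_cons -IH -meanD//; last exact: bounded_borel_sum.
by apply: eq_Rintegral => z _; rewrite big_cons.
Qed.

Lemma EFin_mean P f : bounded_borel f ->
  (\int[P]_z f z)%:E = (\int[P]_z (f z)%:E)%E.
Proof.
move=> bf; rewrite fineK//.
exact/integrable_fin_num/bounded_borel_integrable.
Qed.

Definition pr P (A : set Z) : R := fine (P A).

Lemma EFin_pr P A : measurable (A : set (borel Z)) -> (pr P A)%:E = P A.
Proof. by move=> mA; rewrite fineK// fin_num_measure. Qed.

Lemma pr_ge0 P A : 0 <= pr P A.
Proof. by rewrite fine_ge0. Qed.

Lemma pr_le1 P A : measurable (A : set (borel Z)) -> pr P A <= 1.
Proof. by move=> mA; rewrite -lee_fin EFin_pr// probability_le1. Qed.

Lemma le_pr P A B : measurable (A : set (borel Z)) ->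
  measurable (B : set (borel Z)) -> A `<=` B -> pr P A <= pr P B.
Proof. by move=> mA mB AB; rewrite -lee_fin !EFin_pr// le_measure// inE. Qed.

Lemma prC P A : measurable (A : set (borel Z)) -> pr P (~` A) = 1 - pr P A.
Proof.
move=> mA; apply: EFin_inj; rewrite EFin_pr ?probability_setC//; last exact: measurableC.
by rewrite EFinB EFin_pr.
Qed.

Lemma prU P A B : measurable (A : set (borel Z)) ->
  measurable (B : set (borel Z)) -> [disjoint A & B] -> pr P (A `|` B) = pr P A + pr P B.
Proof.
move=> mA mB AB; apply: EFin_inj; rewrite EFin_pr; last exact: measurableU.
by rewrite measureU ?EFinD ?EFin_pr//; exact/eqP.
Qed.

Lemma prU_le P A B : measurable (A : set (borel Z)) ->
  measurable (B : set (borel Z)) -> pr P (A `|` B) <= pr P A + pr P B.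
Proof.
move=> mA mB; rewrite -lee_fin EFinD !EFin_pr//; last exact: measurableU.
by rewrite measureU2.
Qed.

Lemma pr_mean P A : measurable (A : set (borel Z)) -> \int[P]_z (\1_A z) = pr P A.
Proof. by move=> mA; rewrite /pr -[in RHS](setIT A) -integral_indic. Qed.

End bounded_borel.

(** Convergence for a supremum of initial topologies is convergence for each of them. This is the
    passage between [weak_probability] and means; the arguments themselves are about means. *)
Lemma continuous_weakP (R : realType) (Z : ptopologicalType) (I : topologicalType)
    (m : I -> probability (borel Z) R) (i : I) :
  ((m : I -> weak_probability R Z) @ i --> (m i : weak_probability R Z)) <->
  forall f, bounded_continuous f -> (\int[m j]_z f z) @[j --> i] --> \int[m i]_z f z.
Proof.
split=> [mc f bcf|mc].
  have /cvg_sup/(_ (exist _ f bcf)) := mc.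
  set W := initial_topology _.
  move=> h.
  have /= := @initial_continuous _ _ (fun mu : probability (borel Z) R => \int[mu]_z f z) (m i).
  by move=> /(cvg_comp _ _ h); exact.
apply/cvg_sup => -[f bcf].
move=> A /= [B [[C oC <-] Ci] BA].
by apply: filterS BA _; apply: (mc f bcf); exact: open_nbhs_nbhs.
Qed.
(** * Tightness *)

(** A Lebesgue number: the radius is the parameter of a near-covering, along the filter of small
    positive reals. *)
Lemma compact_ball_subset (R : realType) (Z : pseudoMetricType R) (K U : set Z) :
  compact K -> open U -> K `<=` U ->
  exists2 e : R, 0 < e & forall z, K z -> ball z e `<=` U.
Proof.
move=> cK oU KU.
have /compact_near_coveringP/(_ _ _ (fun e z => ball z e `<=` U)) := cK.
move=> /(_ (0^'+) _)[z Kz|e /= e0 He].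
  have /nbhs_ballP[r /= r0 rU] : nbhs z U by apply: open_nbhs_nbhs; split => //; exact: KU.
  exists (ball z (r / 2), [set e | e <= r / 2]) => /=.
    split; first by apply: nbhsx_ballx; rewrite divr_gt0.
    by apply: nbhs_right_le; rewrite divr_gt0.
  move=> [z' e] /= [zz' er] w z'w; apply: rU.
  rewrite [r]splitr; apply: ball_triangle zz' _.
  exact: le_ball z'w.
exists (e / 2); first by rewrite divr_gt0.
move=> z Kz; apply: (He (e / 2)) => //=.
- by rewrite sub0r normrN gtr0_norm ?divr_gt0// ltr_pdivrMr// ltr_pMr// ltr1n.
- by rewrite divr_gt0.
Qed.

(** The compact set keeps a uniform distance from the complement of [U], so the Urysohn function of
    the uniform structure separates them. *)
Lemma compact_cutoff (R : realType) (Z : pseudoMetricType R) (K U : set Z) :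
  compact K -> open U -> K `<=` U ->
  exists f : Z -> R, [/\ continuous f, forall z, 0 <= f z <= 1,
    forall z, K z -> f z = 1 & forall z, ~ U z -> f z = 0].
Proof.
move=> cK oU KU; have [e e0 KeU] := compact_ball_subset cK oU KU.
have sep : uniform_separator (~` U) K.
  apply: uniform_separatorW; exists [set zw | ball zw.1 e zw.2].
    by rewrite -entourage_ballE; exists e.
  rewrite -subset0 => -[z w] /= [[nUz Kw] zw].
  by apply: nUz; apply: (KeU _ Kw); exact: ball_sym.
exists (@Urysohn Z R (~` U) K); split.
- exact: Urysohn_continuous.
- move=> z; have /= := @Urysohn_range Z R (~` U) K (Urysohn (~` U) K z).
  by rewrite in_itv/=; apply; exists z.
- by move=> z Kz; apply: (Urysohn_sub1 sep); exists z.
- by move=> z Uz; apply: (Urysohn_sub0 sep); exists z.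
Qed.

Lemma compact_tube (R : realType) (X Y : pseudoMetricType R) (K : set X) (L : set Y)
    (O : set (X * Y)) : compact K -> compact L -> open O -> K `*` L `<=` O ->
  exists U V, [/\ open U, open V, K `<=` U, L `<=` V & U `*` V `<=` O].
Proof.
move=> cK cL oO KLO.
have [e e0 He] := compact_ball_subset (compact_setX cK cL) oO KLO.
exists (\bigcup_(x in K) (ball x e)°), (\bigcup_(y in L) (ball y e)°).
split.
- by apply: bigcup_open => x _; exact: open_interior.
- by apply: bigcup_open => x _; exact: open_interior.
- by move=> x Kx; exists x => //; exact: nbhsx_ballx.
- by move=> x Kx; exists x => //; exact: nbhsx_ballx.
- move=> [x y] [/= [x0 Kx0 /interior_subset xx0] [y0 Ly0 /interior_subset yy0]].
  by apply: (He (x0, y0)).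
Qed.

(** The estimate has to hold on an open neighbourhood of [K], because tightness controls the mass of
    such neighbourhoods and not of [K]. *)
Lemma compact_uniform_nbhs (R : realType) (P Z : topologicalType) (F : P * Z -> R)
    (p : P) (K : set Z) (e : R) : (forall z, {for (p, z), continuous F}) ->
  compact K -> 0 < e ->
  exists U, [/\ open U, K `<=` U &
    \forall q \near p, forall z, U z -> `|F (q, z) - F (p, z)| < e].
Proof.
move=> cF cK e0.
have /compact_near_coveringP/(_ _ _ (fun W z => \forall z' \near z, forall q, W q ->
  `|F (q, z') - F (p, z')| < e)) := cK.
move=> /(_ (powerset_filter_from (nbhs p)) _)[z Kz|].
  have /cvgrPdist_lt/(_ (e / 2)) := cF z.
  rewrite divr_gt0// => /(_ isT)[[A B]/= [pA zB] AB].
  exists (B°, [set W | W `<=` A]) => /=.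
    split; first exact: nbhs_interior.
    exact: small_set_sub.
  move=> [z' W] /= [z'B WA]; near=> w => q Wq.
  have Bw : B w by near: w.
  have := AB (q, w) (conj (WA _ Wq) Bw).
  have := AB (p, w) (conj (nbhs_singleton pA) Bw).
  rewrite /= => h1 h2; rewrite (splitr e) distrC.
  rewrite (le_lt_trans (ler_distD (F (p, z)) _ _))// ltrD//.
  by rewrite distrC.
move=> S [Sp _ [W SW]] SK; have pW := Sp _ SW; have KW := SK _ SW.
exists (interior [set z | forall q, W q -> `|F (q, z) - F (p, z)| < e]); split.
- exact: open_interior.
- by move=> z /KW.
- by apply: filterS pW => q Wq z /interior_subset; exact.
Unshelve. all: by end_near. Qed.

Section tight_families.
Context {R : realType} {Z : ptopologicalType}.

(** Mass is asked of the open neighbourhoods of [K] rather than of [K]: this is what survives weak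
    convergence, since a nearby measure may give no mass to [K] itself. *)
Definition tight_along (I : Type) (G : set_system I)
    (rho : I -> probability (borel Z) R) :=
  forall e : R, 0 < e -> exists2 K, compact K &
    forall U, open U -> K `<=` U -> \forall i \near G, 1 - e < pr (rho i) U.

Lemma tight_along_cvg (I : Type) (G H : set_system I) rho :
  H `=>` G -> tight_along G rho -> tight_along H rho.
Proof. by move=> HG tG e /tG[K cK KG]; exists K => // U oU KU; exact/HG/KG. Qed.

(* Off a neighbourhood of a compact set of almost full measure, only the bound
   on [F] is used. *)
Lemma cvg_mean_diff (P : topologicalType) (G : set_system P) (FG : Filter G)
    (p : P) (rho : P -> probability (borel Z) R) (F : P * Z -> R) (M : R) :
  G --> p -> tight_along G rho -> (forall z, {for (p, z), continuous F}) ->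
  (forall q, continuous (fun z => F (q, z))) -> (forall qz, `|F qz| <= M) ->
  (\int[rho q]_z F (q, z) - \int[rho q]_z F (p, z)) @[q --> G] --> 0.
Proof.
move=> Gp tG cF cFq FM; apply/cvgr0Pnorm_le => e e0.
have M0 : 0 <= M by apply: le_trans (FM (p, point)).
(* On [U] the difference is at most [d]; off [U], a set of mass at most [d], it is at most [2 * M].
   The two errors add up to [d * (1 + 2 * M)]. *)
pose d := e / (1 + 2 * M).
have d0 : 0 < d by rewrite divr_gt0// ltr_pwDl// mulr_ge0.
have [K cK KG] := tG d d0.
have [U [oU KU pU]] := compact_uniform_nbhs cF cK d0.
have bF q : bounded_borel (fun z => F (q, z)).
  by apply: bounded_continuous_borel; split => //; exists M.
have b1 := bounded_borel_indic (R := R) (open_borel oU).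
near=> q.
have rU : 1 - d < pr (rho q) U by near: q; exact: KG.
have FU : forall z, U z -> `|F (q, z) - F (p, z)| < d by near: q; exact: Gp.
rewrite -meanB//; apply: le_trans (norm_mean_le _ _) _; first exact: bounded_borelB.
have bb := bounded_borelB (bounded_borel_cst (Z := Z) (1 : R)) b1.
have bbM : bounded_borel (fun z => 2 * M * (1 - \1_U z)).
  by apply: bounded_borelM => //; exact: bounded_borel_cst.
apply: (@le_trans _ _ (\int[rho q]_z (d + 2 * M * (1 - \1_U z)))).
  apply: le_mean.
  - by apply: bounded_borel_norm; exact: bounded_borelB.
  - by apply: bounded_borelD => //; exact: bounded_borel_cst.
  move=> z; rewrite indicE; have [zU|zU] := boolP (z \in U).
    by rewrite subrr mulr0 addr0 ltW// FU//; exact: set_mem.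
  rewrite subr0 mulr1 (le_trans (ler_normB _ _))// (le_trans (lerD (FM _) (FM _)))//.
  by rewrite -mulr2n mulr_natl lerDr ltW.
rewrite meanD ?meanZ ?meanB ?mean_cst ?pr_mean//; do ? exact: bounded_borel_cst; last first.
  exact: open_borel.
apply: (@le_trans _ _ (d + 2 * M * d)).
  by rewrite lerD2l ler_wpM2l ?mulr_ge0// lerBlDr -lerBlDl ltW.
by rewrite -{1}[d]mulr1 [X in _ + X]mulrC -mulrDr divfK// gt_eqF// ltr_pwDl// mulr_ge0.
Unshelve. all: by end_near. Qed.

End tight_families.

Section weakly_continuous.
Context {R : realType} {Z : pseudoPMetricType R} {P : topologicalType}.
Hypothesis hZ : hausdorff_space Z.
Variables (rho : P -> probability (borel Z) R) (p : P).
Hypothesis rho_radon : radon_probability (rho p).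
Hypothesis rho_cvg : forall f, bounded_continuous f ->
  (\int[rho q]_z f z) @[q --> p] --> \int[rho p]_z f z.

(** A cutoff between [K] and [U] has mean above [1 - e] at [p]. This persists nearby by weak
    convergence, and the mean is at most the mass of [U]. *)
Lemma weak_tight : tight_along (nbhs p) rho.
Proof.
move=> e e0; have [K [cK _ KT]] := rho_radon measurableT e0.
exists K => // U oU KU; have [f [cf f01 fK fU]] := compact_cutoff cK oU KU.
have bcf : bounded_continuous f.
  by split => //; exists 1 => z; have /andP[? ?] := f01 z; rewrite ger0_norm.
have bf := bounded_continuous_borel bcf.
have mK : measurable (K : set (borel Z)) by apply: closed_borel; exact: compact_closed.
have fpe : 1 - e < \int[rho p]_z f z.
  apply: (@lt_le_trans _ _ (pr (rho p) K)).
    rewrite ltrBlDl -ltrBlDr -prC// -lte_fin EFin_pr; last exact: measurableC.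
    by move: KT; rewrite setTD.
  rewrite -pr_mean//; apply: le_mean => //; first exact: bounded_borel_indic.
  move=> z; rewrite indicE; have [zK|_] := boolP (z \in K).
    by rewrite fK//; exact: set_mem.
  by case/andP : (f01 z).
have := rho_cvg bcf => /cvgr_gt/(_ _ fpe); apply: filterS => q /lt_le_trans; apply.
rewrite -pr_mean; last exact: open_borel.
apply: le_mean => //; first by apply: bounded_borel_indic; exact: open_borel.
move=> z; rewrite indicE; have [zU|/negP zU] := boolP (z \in U).
  by case/andP : (f01 z).
by rewrite fU// => Uz; apply: zU; exact: mem_set.
Qed.

Lemma cvg_mean_joint (F : P * Z -> R) (M : R) :
  (forall z, {for (p, z), continuous F}) ->
  (forall q, continuous (fun z => F (q, z))) -> (forall qz, `|F qz| <= M) ->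
  (\int[rho q]_z F (q, z)) @[q --> p] --> \int[rho p]_z F (p, z).
Proof.
move=> cF cFq FM.
have h1 := cvg_mean_diff (nbhs_filter p) cvg_id weak_tight cF cFq FM.
have h2 : (\int[rho q]_z F (p, z)) @[q --> p] --> \int[rho p]_z F (p, z).
  by apply: rho_cvg; split; [exact: cFq|exists M => z; exact: FM].
rewrite (_ : (fun q => \int[rho q]_z F (q, z)) = fun q =>
    (\int[rho q]_z F (q, z) - \int[rho q]_z F (p, z)) + \int[rho q]_z F (p, z)).
  by rewrite -[X in _ --> X]add0r; exact: cvgD.
by apply/funext => q; rewrite subrK.
Qed.

End weakly_continuous.

Section plans_lemmas.
Context {R : realType} {X Y : pseudoPMetricType R}.

Lemma continuous_measurable_borel (Z W : ptopologicalType) (f : Z -> W) :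
  continuous f -> measurable_fun setT (f : borel Z -> borel W).
Proof.
move=> cf; apply: (@measurability _ _ (borel Z) (borel W) setT f (@open W) erefl).
move=> _ [U oU <-].
by rewrite setTI; apply: open_borel; apply: open_comp => // z _; exact: cf.
Qed.

Lemma measurable_fst_borel (A : set X) : measurable (A : set (borel X)) ->
  measurable (A `*` [set: Y] : set (borel (X * Y)%type)).
Proof.
move=> mA; rewrite (_ : _ `*` _ = fst @^-1` A); last first.
  by apply/seteqP; split => -[x y] //= [].
rewrite -[X in measurable X]setTI.
exact: (@continuous_measurable_borel (X * Y)%type X fst (fun=> cvg_fst)).
Qed.

Lemma measurable_snd_borel (B : set Y) : measurable (B : set (borel Y)) ->
  measurable ([set: X] `*` B : set (borel (X * Y)%type)).
Proof.
move=> mB; rewrite (_ : _ `*` _ = snd @^-1` B); last first.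
  by apply/seteqP; split => -[x y] //= [].
rewrite -[X in measurable X]setTI.
exact: (@continuous_measurable_borel (X * Y)%type Y snd (fun=> cvg_snd)).
Qed.

Lemma measurable_rect_borel (A : set X) (B : set Y) :
  measurable (A : set (borel X)) -> measurable (B : set (borel Y)) ->
  measurable (A `*` B : set (borel (X * Y)%type)).
Proof.
move=> mA mB; rewrite (_ : A `*` B = (A `*` [set: Y]) `&` ([set: X] `*` B)).
  by apply: measurableI; [exact: measurable_fst_borel|exact: measurable_snd_borel].
by apply/seteqP; split => -[x y] /=; tauto.
Qed.

(** The complement of the rectangle is the union of two strips, whose masses are given by the
    marginals. *)
Lemma plans_rect_ge (mu : probability (borel X) R) (nu : probability (borel Y) R)
    sigma (A : set X) (B : set Y) : plans mu nu sigma ->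
  measurable (A : set (borel X)) -> measurable (B : set (borel Y)) ->
  pr mu A + pr nu B - 1 <= pr sigma (A `*` B).
Proof.
move=> [smu snu] mA mB.
have mA' := measurable_fst_borel mA; have mB' := measurable_snd_borel mB.
have := prU_le sigma (measurableC mA') (measurableC mB').
rewrite -setCI -(_ : A `*` B = (A `*` [set: Y]) `&` ([set: X] `*` B)); last first.
  by apply/seteqP; split => -[x y] /=; tauto.
rewrite !prC//; last exact: measurable_rect_borel.
rewrite {2}/pr smu// {2}/pr snu// -/(pr mu A) -/(pr nu B); lra.
Qed.

Lemma tight_along_plans (I : Type) (G : set_system I) (FG : Filter G)
    (mu : I -> probability (borel X) R) (nu : I -> probability (borel Y) R)
    (sigma : I -> probability (borel (X * Y)%type) R) :
  tight_along G mu -> tight_along G nu ->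
  (forall i, plans (mu i) (nu i) (sigma i)) -> tight_along G sigma.
Proof.
move=> tmu tnu spl e e0.
have e2 : 0 < e / 2 by rewrite divr_gt0.
have [K cK KG] := tmu _ e2; have [L cL LG] := tnu _ e2.
exists (K `*` L); first exact: compact_setX.
move=> O oO KLO; have [U [V [oU oV KU LV UVO]]] := compact_tube cK cL oO KLO.
near=> i; have h1 : 1 - e / 2 < pr (mu i) U by near: i; exact: KG.
have h2 : 1 - e / 2 < pr (nu i) V by near: i; exact: LG.
have := plans_rect_ge (spl i) (open_borel oU) (open_borel oV).
have := le_pr (sigma i) (measurable_rect_borel (open_borel oU) (open_borel oV)) (open_borel oO) UVO.
rewrite (splitr e); lra.
Unshelve. all: by end_near. Qed.

End plans_lemmas.
(** * Limits of tight families along ultrafilters *)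

(** An exchange of quantifiers: finitely many members of [F] serve the whole compact set, and their
    intersection is the common [W]. *)
Lemma compact_nbhs_avoid (T : topologicalType) (F : set_system T) (FF : ProperFilter F)
    (K : set T) : compact K ->
  (forall x, K x -> exists2 W, F W & nbhs x (~` W)) ->
  exists2 W, F W & forall x, K x -> nbhs x (~` W).
Proof.
move=> cK KF.
have /compact_near_coveringP/(_ _ _ (fun W x => nbhs x (~` W))) := cK.
move=> /(_ (powerset_filter_from F) _)[x Kx|S [SF _ [W SW]] SK].
  have [W FW xW] := KF _ Kx.
  exists ((~` W)°, [set V | V `<=` W]) => /=.
    by split; [exact: nbhs_interior|exact: small_set_sub].
  move=> [x' V] /= [x'W VW]; apply: filterS x'W => z /=; apply: contra_not; exact: VW.
by exists W; [exact: SF|move=> x Kx; exact: SK SW _ Kx].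
Qed.

Lemma hausdorff_compact_separation (T : topologicalType) (C D : set T) :
  hausdorff_space T -> compact C -> compact D -> [disjoint C & D] ->
  exists U V, [/\ open U, open V, C `<=` U, D `<=` V & [disjoint U & V]].
Proof.
move=> hT cC cD /disj_setPS CD.
(* The filter of neighbourhoods of the empty set is not proper, so this case is set apart. *)
have [->|/set0P C0] := eqVneq C set0.
  exists set0, setT; split => //; [exact: open0|exact: openT|].
  by apply/disj_setPS; rewrite set0I.

have [|W CW DW] := compact_nbhs_avoid (set_nbhs_pfilter C0) cD.
  move=> y Dy; have [|W yW CW] := compact_nbhs_avoid (nbhs_pfilter y) cC.
    move=> x Cx; have xy : x != y.
      by apply/eqP => xy; apply: (CD x); split => //; rewrite xy.
    move: hT; rewrite open_hausdorff => /(_ _ _ xy)[[A B] /=].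
    rewrite !inE => -[Ax By] [oA oB AB0].
    exists B; first exact: open_nbhs_nbhs.
    apply: filterS (open_nbhs_nbhs (conj oA Ax)) => z Az Bz.
    by have : (A `&` B) z by []; rewrite AB0.
  exists (~` W) => //; by rewrite setCK.
exists W°, (~` W)°; split; try exact: open_interior.
- by move=> x Cx; apply: CW.
- by move=> y /DW.
- by apply/disj_setPS => z [/interior_subset zW /interior_subset].
Qed.

Section ultrafilter_limits.
Context {I : Type} {U : set_system I} {UU : UltraFilter U}.

Lemma ultra_fmap (J : Type) (f : I -> J) : UltraFilter (f @ U).
Proof.
apply: Build_UltraFilter => G PG UG; apply/seteqP; split => // A GA.
have [//|nA] := in_ultra_setVsetC (f @^-1` A) UU.
have : G (A `&` ~` A) by apply: filterI => //; exact: UG.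
by rewrite setICr => /filter_not_empty.
Qed.

Lemma ultra_bounded_cvg (R : realType) (phi : I -> R) (M : R) :
  (forall i, `|phi i| <= M) -> cvg (phi @ U).
Proof.
move=> phiM; have := @segment_compact R (- M) M.
rewrite compact_ultra => /(_ _ (ultra_fmap phi))[].
  apply: (@filterE _ U) => i.
  by rewrite /= in_itv/= -ler_norml; exact: phiM.
by move=> l [_ phil]; apply/cvg_ex; exists l.
Qed.

End ultrafilter_limits.

(** The sum counts the integers among [1, ..., m] below [y]. The third clause serves the induction:
    when a new integer is counted, all smaller ones were. *)
Lemma layer_count (R : realType) (m : nat) (y : R) : 0 <= y ->
  [/\ \sum_(k < m) (k.+1%:R < y)%R%:R <= y,
      y <= m.+1%:R -> y <= 1 + \sum_(k < m) (k.+1%:R < y)%R%:R &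
      m%:R < y -> \sum_(k < m) (k.+1%:R < y)%R%:R = m%:R :> R].
Proof.
move=> y0; elim: m => [|m [IH1 IH2 IH3]].
  by rewrite big_ord0; split => //; rewrite addr0.
rewrite big_ord_recr/=; have [my|ym] := ltP (m.+1%:R) y.
  have my' : m%:R < y by rewrite (le_lt_trans _ my)// ler_nat.
  by rewrite IH3// natr1; split; rewrite ?(ltW my)// => my2; rewrite addrC natr1.
rewrite addr0; split => // _; exact: IH2.
Qed.

(** Layer-cake approximation: up to [1 / (n + 1)], [f] is an average of indicators of strict
    superlevel sets, which are open when [f] is continuous. *)
Lemma layer_bounds (R : realType) (T : Type) (n : nat) (f : T -> R) (z : T) :
  0 <= f z <= 1 ->
  n.+1%:R^-1 * \sum_(k < n.+1) \1_[set z | k.+1%:R / n.+1%:R < f z] z <= f z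
    <= n.+1%:R^-1 * (1 + \sum_(k < n.+1) \1_[set z | k.+1%:R / n.+1%:R < f z] z).
Proof.
move=> /andP[x0 x1].
have n0 : 0 < n.+1%:R :> R by rewrite ltr0n.
have [h1 h2 _] := @layer_count R n.+1 (n.+1%:R * f z) (mulr_ge0 (ltW n0) x0).
have E (k : 'I_n.+1) : \1_[set z | k.+1%:R / n.+1%:R < f z] z =
    (k.+1%:R < n.+1%:R * f z)%R%:R :> R.
  rewrite indicE; congr (nat_of_bool _)%:R.
  by apply/idP/idP; rewrite inE/= ltr_pdivrMr// mulrC.
under eq_bigr do rewrite E.
rewrite -[X in X && _](@ler_pM2l _ n.+1%:R)// -[X in _ && X](@ler_pM2l _ n.+1%:R)//.
rewrite !mulrA divff ?gt_eqF// !mul1r h1 h2//.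
apply: (@le_trans _ _ n.+1%:R); last by rewrite ler_nat.
by rewrite -[leRHS]mulr1 ler_wpM2l// ltW.
Qed.

Section prokhorov.
Context {R : realType} {Z : ptopologicalType} {I : Type} {U : set_system I}
  {UU : UltraFilter U}.
Hypothesis hZ : hausdorff_space Z.
Variable sigma : I -> probability (borel Z) R.
Hypothesis sigma_tight : tight_along U sigma.
Local Open Scope ereal_scope.

Let le_lim (f g : I -> R) (l l' : R) : f @ U --> l -> g @ U --> l' ->
  (forall i, f i <= g i)%R -> (l <= l')%R.
Proof.
move=> fl gl fg; rewrite -subr_ge0; apply: (cvgr_to_ge (cvgB gl fl)).
by apply: nearW => i; rewrite subr_ge0.
Qed.

(** Along an ultrafilter the limit exists for every Borel set, but in general it is only finitely
    additive. A measure is rebuilt from its values on open sets. *)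
Let lim_pr (A : set Z) : R := lim (pr (sigma i) A @[i --> U]).

Let lim_prP A : measurable (A : set (borel Z)) ->
  pr (sigma i) A @[i --> U] --> lim_pr A.
Proof.
move=> mA; apply: (@ultra_bounded_cvg _ _ _ _ _ 1) => i.
by rewrite ger0_norm ?pr_ge0// pr_le1.
Qed.

Let lim_pr_ge0 A : measurable (A : set (borel Z)) -> (0 <= lim_pr A)%R.
Proof.
by move=> mA; apply: (cvgr_to_ge (lim_prP mA)); apply: nearW => i; exact: pr_ge0.
Qed.

Let le_lim_pr A B : measurable (A : set (borel Z)) ->
  measurable (B : set (borel Z)) -> A `<=` B -> (lim_pr A <= lim_pr B)%R.
Proof.
move=> mA mB AB; apply: (le_lim (lim_prP mA) (lim_prP mB)) => i; exact: le_pr.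
Qed.

Let lim_pr_le1 A : measurable (A : set (borel Z)) -> (lim_pr A <= 1)%R.
Proof.
by move=> mA; apply: (cvgr_to_le (lim_prP mA)); apply: nearW => i; exact: pr_le1.
Qed.

Let lim_prU_le A B : measurable (A : set (borel Z)) ->
  measurable (B : set (borel Z)) -> (lim_pr (A `|` B) <= lim_pr A + lim_pr B)%R.
Proof.
move=> mA mB; have mAB := measurableU _ _ mA mB.
apply: (le_lim (lim_prP mAB) (cvgD (lim_prP mA) (lim_prP mB))) => i; exact: prU_le.
Qed.

Let lim_prU A B : measurable (A : set (borel Z)) ->
  measurable (B : set (borel Z)) -> [disjoint A & B] ->
  (lim_pr A + lim_pr B <= lim_pr (A `|` B))%R.
Proof.
move=> mA mB dAB; have mAB := measurableU _ _ mA mB.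
apply: (le_lim (cvgD (lim_prP mA) (lim_prP mB)) (lim_prP mAB)) => i /=.
by rewrite prU.
Qed.

(** A content on compact sets, as in the Riesz-Markov construction. *)
Let inn (C : set Z) : \bar R :=
  ereal_inf [set (lim_pr H)%:E | H in [set H | open H /\ C `<=` H]].

Let inn_le C H : open H -> C `<=` H -> inn C <= (lim_pr H)%:E.
Proof. by move=> oH CH; apply: ereal_inf_lbound; exists H. Qed.

Let inn_ge0 C : 0 <= inn C.
Proof.
by apply: le_ereal_inf_tmp => _ [H [oH CH] <-]; rewrite lee_fin lim_pr_ge0//; exact: open_borel.
Qed.

Let inn_le1 C : inn C <= 1.
Proof.
apply: le_trans (inn_le openT (@subsetT _ C)) _.
by rewrite lee_fin; apply: lim_pr_le1; exact: open_borel openT.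
Qed.

Let inn_fin C : inn C \is a fin_num.
Proof. by rewrite ge0_fin_numE ?inn_ge0// (le_lt_trans (inn_le1 C))// ltry. Qed.

(** Disjoint compact sets have disjoint open neighbourhoods in a Hausdorff space. Intersected with
    any open [H] around the union, they bring superadditivity down from [lim_pr]. *)
Let innU C D : compact C -> compact D -> [disjoint C & D] ->
  inn C + inn D <= inn (C `|` D).
Proof.
move=> cC cD CD.
have [V [W [oV oW CV DW VW]]] := hausdorff_compact_separation hZ cC cD CD.
apply: le_ereal_inf_tmp => _ [H [oH CDH] <-].
apply: (@le_trans _ _ ((lim_pr (H `&` V))%:E + (lim_pr (H `&` W))%:E)).
  apply: leeD; apply: inn_le.
  - exact: openI.
  - by move=> x Cx; split; [apply: CDH; left|exact: CV].
  - exact: openI.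
  - by move=> x Cx; split; [apply: CDH; right|exact: DW].
rewrite -EFinD lee_fin; apply: (@le_trans _ _ (lim_pr (H `&` V `|` H `&` W))).
  apply: lim_prU; [by apply: open_borel; exact: openI..|].
  apply/disj_setPS => x [[_ Vx] [_ Wx]]; move/disj_setPS : VW; apply; exact: (conj Vx Wx).
apply: le_lim_pr; [|exact: open_borel|by move=> x [[]|[]]].
by apply: open_borel; apply: openU; exact: openI.
Qed.

(** The value on an open set is taken from the compact sets inside and may be smaller than [lim_pr].
    In exchange it is countably subadditive, since a compact subset of a countable union of open
    sets lies in a finite one. *)
Let out (G : set Z) : \bar R :=
  ereal_sup [set inn C | C in [set C | compact C /\ C `<=` G]].

Let out_ge C G : compact C -> C `<=` G -> inn C <= out G.
Proof. by move=> cC CG; apply: ereal_sup_ubound; exists C. Qed.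

Let out_ge0 G : 0 <= out G.
Proof. by apply: le_trans (inn_ge0 set0) _; apply: out_ge => //; exact: compact0. Qed.

Let out_le1 G : out G <= 1.
Proof. by apply: ge_ereal_sup => _ [C _ <-]; exact: inn_le1. Qed.

Let le_out G H : G `<=` H -> out G <= out H.
Proof.
move=> GH; apply: ge_ereal_sup => _ [C [cC CG] <-].
by apply: out_ge => //; exact: subset_trans GH.
Qed.

Let out_le_lim_pr G : open G -> out G <= (lim_pr G)%:E.
Proof. by move=> oG; apply: ge_ereal_sup => _ [C [cC CG] <-]; exact: inn_le. Qed.

Let out0 : out set0 = 0.
Proof.
apply/eqP; rewrite eq_le out_ge0 andbT; apply: le_trans (out_le_lim_pr open0) _.
rewrite lee_fin; apply: (cvgr_to_le (lim_prP measurable0)).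
by apply: nearW => i; rewrite /pr measure0.
Qed.

(* [C `\` G2] is a compact subset of [G1]; for an open [H1] around it of nearly
   the same mass, [C `\` H1] is a compact subset of [G2]. *)
Let outU_le G1 G2 : open G1 -> open G2 -> out (G1 `|` G2) <= out G1 + out G2.
Proof.
move=> o1 o2; apply: ge_ereal_sup => _ [C [cC CG] <-].
apply/lee_addgt0Pr => e e0; have e2 : (0 < e / 2)%R by rewrite divr_gt0.
have compactD H : open H -> compact (C `\` H).
  move=> oH; apply: (subclosed_compact _ cC (@subDsetl _ _ _)).
  by apply: closedI; [exact: compact_closed|exact: open_closedC].
have [_ [H1 [oH1 CH1] <-] l1] := lb_ereal_inf_adherent e2 (inn_fin (C `\` G2)).
have [_ [H2 [oH2 CH2] <-] l2] := lb_ereal_inf_adherent e2 (inn_fin (C `\` H1)).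
have h1 : inn (C `\` G2) <= out G1.
  by apply: out_ge; [exact: compactD|move=> x [/CG[]]].
have h2 : inn (C `\` H1) <= out G2.
  apply: out_ge; [exact: compactD|move=> x [Cx nH1]].
  by apply: contrapT => nG2; apply: nH1; exact: CH1.
have h3 : inn C <= (lim_pr (H1 `|` H2))%:E.
  apply: inn_le; [exact: openU|move=> x Cx].
  by have [H1x|nH1x] := pselect (H1 x); [left|right; exact: CH2].
apply: le_trans h3 _.
apply: (@le_trans _ _ ((lim_pr H1)%:E + (lim_pr H2)%:E)).
  by rewrite -EFinD lee_fin; apply: lim_prU_le; exact: open_borel.
rewrite [e]splitr EFinD addeACA; apply: leeD.
  by apply: le_trans (ltW l1) _; rewrite leeD2r.
by apply: le_trans (ltW l2) _; rewrite leeD2r.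
Qed.

Let out_bigsetU_le (G : (set Z)^nat) n : (forall k, open (G k)) ->
  out (\big[setU/set0]_(k < n) G k) <= \sum_(k < n) out (G k).
Proof.
move=> oG; elim: n => [|n IH]; first by rewrite !big_ord0 out0.
rewrite !big_ord_recr/=; apply: le_trans (leeD2r _ IH); apply: outU_le => //.
by rewrite -bigcup_mkord; apply: bigcup_open.
Qed.

Let out_bigcup_le (G : (set Z)^nat) : (forall k, open (G k)) ->
  out (\bigcup_k G k) <= \sum_(0 <= k <oo) out (G k).
Proof.
move=> oG; apply: ge_ereal_sup => _ [C [cC CG] <-].
have /compact_near_coveringP/(_ _ _ (fun n => \big[setU/set0]_(k < n) G k)) := cC.
move=> /(_ \oo _)[x /CG [k _ Gkx]|n _ nC].
  exists (G k, [set n | (k < n)%N]) => /=.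
    by split; [exact: open_nbhs_nbhs|exact: nbhs_infty_gt].
  by move=> [x' n] /= [Gx' kn]; rewrite -bigcup_mkord; exists k.
apply: (@le_trans _ _ (\sum_(k < n) out (G k))).
  apply: le_trans (out_bigsetU_le _ oG); apply: out_ge => //.
  exact: (nC n (leqnn n)).
rewrite -(big_mkord xpredT (out \o G)); apply: nneseries_lim_ge => k _ _; exact: out_ge0.
Qed.

Let outer (A : set Z) : \bar R :=
  ereal_inf [set out G | G in [set G | open G /\ A `<=` G]].

Let outer_le A G : open G -> A `<=` G -> outer A <= out G.
Proof. by move=> oG AG; apply: ereal_inf_lbound; exists G. Qed.

Let outer_open G : open G -> outer G = out G.
Proof.
move=> oG; apply/eqP; rewrite eq_le outer_le//=.
by apply: le_ereal_inf_tmp => _ [H [oH GH] <-]; exact: le_out.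
Qed.

Let outer_ge0 A : 0 <= outer A.
Proof. by apply: le_ereal_inf_tmp => _ [H [oH CH] <-]; exact: out_ge0. Qed.

Let outer_fin A : outer A \is a fin_num.
Proof.
rewrite ge0_fin_numE ?outer_ge0//.
by rewrite (le_lt_trans (outer_le openT (@subsetT _ A)))// (le_lt_trans (out_le1 _))// ltry.
Qed.

Let outer0 : outer set0 = 0.
Proof. by rewrite outer_open ?out0//; exact: open0. Qed.

Let le_outer : {homo outer : A B / A `<=` B >-> A <= B}.
Proof.
move=> A B AB; apply: le_ereal_inf_tmp => _ [H [oH CH] <-].
by apply: outer_le => //; exact: subset_trans CH.
Qed.

Let outer_sigma_subadditive : sigma_subadditive outer.
Proof.
move=> A; apply/lee_addgt0Pr => e e0.
apply: le_trans (epsilon_trick _ _ _); [|by move=> n; exact: outer_ge0|exact: ltW].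
have /choice[G HG] n : exists G, [/\ open G, A n `<=` G &
    out G <= outer (A n) + (e / (2 ^ n.+1)%:R)%:E].
  have en : (0 < e / (2 ^ n.+1)%:R)%R by rewrite divr_gt0// ltr0n expn_gt0.
  have [_ [G [oG AG] <-] h] := lb_ereal_inf_adherent en (outer_fin (A n)).
  by exists G; split => //; exact: ltW.
have oG n : open (G n) by case: (HG n).
apply: (@le_trans _ _ (out (\bigcup_n G n))).
  by apply: outer_le; [exact: bigcup_open|apply: subset_bigcup => n _; case: (HG n)].
apply: le_trans (out_bigcup_le oG) _; apply: lee_nneseries => n _.
  by move=> _; exact: out_ge0.
by case: (HG n).
Qed.

HB.instance Definition _ := isOuterMeasure.Build R Z outer
  outer0 outer_ge0 le_outer outer_sigma_subadditive.

(** Inside an open [V], the part in [G] is exhausted by a compact [C]. The complement of [C] in [V],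
    an open set containing the part of [V] outside [G], is then exhausted by a compact [D] disjoint
    from [C], and [inn] is superadditive on [C] and [D]. *)
Let open_caratheodory G : open G -> outer.-caratheodory G.
Proof.
move=> oG; apply: le_caratheodory_measurable => X.
rewrite -[leLHS]/(outer (X `&` G) + outer (X `\` G)) -[leRHS]/(outer X).
apply: le_ereal_inf_tmp => _ [V [oV XV] <-].
apply: (@le_trans _ _ (out (V `&` G) + outer (V `\` G))).
  apply: leeD; last by apply: le_outer; exact: setSI.
  by apply: outer_le; [exact: openI|exact: setSI].
rewrite -leeBrDr//; apply: ge_ereal_sup => _ [C [cC CVG] <-].
rewrite leeBrDr//; apply: (@le_trans _ _ (inn C + out (V `\` C))).
  rewrite leeD2l//; apply: outer_le; last first.
    by move=> x [Vx nGx]; split => // /CVG[].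
  by apply: openI => //; apply: closed_openC; exact: compact_closed.
rewrite addeC -leeBrDr//; apply: ge_ereal_sup => _ [D [cD DVC] <-].
rewrite leeBrDr// addeC; apply: le_trans (innU cC cD _) _.
  by apply/disj_setPS => x [Cx /DVC[]].
apply: out_ge; first exact: compactU.
by move=> x [/CVG[]|/DVC[]].
Qed.

Let borel_caratheodory (A : set (borel Z)) : measurable A -> outer.-caratheodory A.
Proof.
apply: smallest_sub; last by move=> G; exact: open_caratheodory.
exact: (@sigma_algebra_measurable _ (caratheodory_type outer)).
Qed.

Definition prokhorov_limit : set (borel Z) -> \bar R := outer.

Let lambda0 : prokhorov_limit set0 = 0. Proof. exact: outer0. Qed.

Let lambda_ge0 A : 0 <= prokhorov_limit A. Proof. exact: outer_ge0. Qed.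

Let lambda_sigma_additive : semi_sigma_additive prokhorov_limit.
Proof.
move=> F mF tF mUF; apply: (@caratheodory_measure_sigma_additive R Z outer) => //.
- by move=> i; exact: borel_caratheodory.
- exact: borel_caratheodory.
Qed.

HB.instance Definition _ := isMeasure.Build _ _ _ prokhorov_limit
  lambda0 lambda_ge0 lambda_sigma_additive.

(** Tightness enters here: every open neighbourhood of [K] keeps limit mass at least [1 - e], so no
    mass is lost. *)
Let lambdaT : prokhorov_limit setT = 1.
Proof.
rewrite /prokhorov_limit outer_open; last exact: openT.
apply/eqP; rewrite eq_le out_le1/=; apply/lee_addgt0Pr => e e0.
have [K cK KU] := sigma_tight e0.
rewrite -leeBlDr//; apply: le_trans (out_ge cK (@subsetT _ _)).
apply: le_ereal_inf_tmp => _ [H [oH KH] <-].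
rewrite -EFinB lee_fin; apply: (cvgr_to_ge (lim_prP (open_borel oH))).
by apply: filterS (KU _ oH KH) => i /ltW.
Qed.

HB.instance Definition _ := Measure_isProbability.Build _ _ _ prokhorov_limit lambdaT.

Let pr_limit_le G : open G -> (pr prokhorov_limit G <= lim_pr G)%R.
Proof.
move=> oG; rewrite -lee_fin EFin_pr; last exact: open_borel.
by rewrite -[leLHS]/(outer G) outer_open//; exact: out_le_lim_pr.
Qed.

(** Only one inequality is available at this stage, since [pr_limit_le] bounds the limit measure of
    open sets from above. The superlevel sets of [f] are open, and the layers transfer the bound to
    means. *)
Let mean_limit_le (f : Z -> R) (l : R) : continuous f ->
  (forall z, 0 <= f z <= 1)%R -> (\int[sigma i]_z f z @[i --> U] --> l)%R ->
  (\int[prokhorov_limit]_z f z <= l)%R.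
Proof.
move=> cf f01 fl; apply/ler_addgt0Pr => e e0.
have [n ne] : exists n, (n.+1%:R^-1 < e)%R.
  by have [n ne] := ltr_add_invr e0; exists n; rewrite add0r in ne.
have bf : bounded_borel f.
  apply: bounded_continuous_borel; split => //; exists 1%R => z.
  by have /andP[? ?] := f01 z; rewrite ger0_norm.
pose G (k : 'I_n.+1) := [set z | k.+1%:R / n.+1%:R < f z]%R.
have oG k : open (G k).
  apply: (@open_comp _ _ f [set x | k.+1%:R / n.+1%:R < x]%R) => [z _|]; [exact: cf|exact: open_gt].
have bG k : bounded_borel (\1_(G k) : Z -> R).
  by apply: bounded_borel_indic; exact: open_borel.
have bS := bounded_borel_sum (index_enum 'I_n.+1) bG.
have b1 := bounded_borel_cst (Z := Z) (1%R : R).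
have bM := bounded_borel_cst (Z := Z) (n.+1%:R^-1 : R).
apply: (@le_trans _ _ (n.+1%:R^-1 * (1 + \sum_(k < n.+1) lim_pr (G k)))%R).
  apply: (@le_trans _ _ (\int[prokhorov_limit]_z
      (n.+1%:R^-1 * (1 + \sum_(k < n.+1) \1_(G k) z)))%R).
    apply: le_mean => // [|z]; last by have /andP[] := layer_bounds n (f01 z).
    by apply: bounded_borelM => //; exact: bounded_borelD.
  rewrite meanZ; last exact: bounded_borelD.
  rewrite meanD// mean_cst mean_sum// ler_wpM2l// lerD2l; apply: ler_sum => k _.
  by rewrite pr_mean; [exact: (pr_limit_le (oG k))|exact: (open_borel (oG k))].
rewrite mulrDr mulr1 addrC; apply: lerD; last exact: ltW.
apply: (@le_lim (fun i => n.+1%:R^-1 * \sum_(k < n.+1) pr (sigma i) (G k))%R) fl _.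
  apply: cvgMr; apply: cvg_sum => k; exact: (lim_prP (open_borel (oG k))).
move=> i /=.
apply: (@le_trans _ _ (\int[sigma i]_z (n.+1%:R^-1 * \sum_(k < n.+1) \1_(G k) z))%R).
  rewrite meanZ// mean_sum// ler_wpM2l//; apply: ler_sum => k _.
  by rewrite (pr_mean _ (open_borel (oG k))).
apply: le_mean => // [|z]; first exact: bounded_borelM.
by have /andP[] := layer_bounds n (f01 z).
Qed.

(** The one-sided bound is applied to [f] and to [- f], each moved into the unit interval by an
    affine map; together the two inequalities give equality. *)
Lemma prokhorov_limitP f : bounded_continuous f ->
  (\int[sigma i]_z f z @[i --> U] --> \int[prokhorov_limit]_z f z)%R.
Proof.
move=> [cf [M Mf]]; have bf : bounded_borel f.
  by apply: bounded_continuous_borel; split => //; exists M.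
have : cvg (\int[sigma i]_z f z @[i --> U])%R.
  by apply: (@ultra_bounded_cvg _ _ _ _ _ M) => i; exact: norm_mean_bound.
move=> /cvg_ex[l fl]; suff <- : l = (\int[prokhorov_limit]_z f z)%R by [].
have [N N0 fN] : exists2 N, (0 < 2 * N)%R & forall z, (- N <= f z <= N)%R.
  exists (1 + `|M|)%R; first by rewrite mulr_gt0// ltr_pwDl.
  by move=> z; rewrite -ler_norml (le_trans (Mf z))// (le_trans (ler_norm _))// lerDr.
pose g s z := ((2 * N)^-1 * (s * f z + N))%R.
have key s : (`|s| = 1)%R -> (s * \int[prokhorov_limit]_z f z <= s * l)%R.
  move=> s1; have bsf : bounded_borel (fun z => s * f z)%R.
    by apply: bounded_borelM => //; exact: bounded_borel_cst.
  have gE (P : probability (borel Z) R) : (\int[P]_z g s z = (2 * N)^-1 * (s * \int[P]_z f z + N))%R.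
    rewrite meanZ ?meanD ?meanZ ?mean_cst//; first exact: bounded_borel_cst.
    by apply: bounded_borelD => //; exact: bounded_borel_cst.
  have : (\int[prokhorov_limit]_z g s z <= (2 * N)^-1 * (s * l + N))%R.
    apply: mean_limit_le.
    - move=> z; apply: cvgMr; apply: cvgD; last exact: cvg_cst.
      by apply: cvgMr; exact: cf.
    - move=> z; have sf : (- N <= s * f z <= N)%R.
        by rewrite -ler_norml normrM s1 mul1r ler_norml.
      have /andP[sf1 sf2] := sf.
      rewrite /g mulr_ge0/= ?invr_ge0 ?(ltW N0)//; last by rewrite -lerBlDr sub0r.
      by rewrite ler_pdivrMl// mulr1 mulr_natl mulr2n lerD2r.
    - under eq_fun do rewrite gE.
      by apply: cvgMr; apply: cvgD; [exact: cvgMr|exact: cvg_cst].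
  by move=> h; rewrite gE ler_pM2l ?invr_gt0// lerD2r in h.
have := key 1%R (normr1 _); have := key (-1)%R; rewrite normrN normr1 => /(_ erefl).
rewrite !mulN1r !mul1r lerN2 => h1 h2.
by apply/eqP; rewrite eq_le h1 h2.
Qed.

Theorem prokhorov : exists lambda : probability (borel Z) R,
  forall f, bounded_continuous f ->
  (\int[sigma i]_z f z @[i --> U] --> \int[lambda]_z f z)%R.
Proof. by exists prokhorov_limit; exact: prokhorov_limitP. Qed.

End prokhorov.
(** * Limits of plans *)

Section image_measure.
Context {R : realType} {Z W : ptopologicalType}.
Variables (f : Z -> W) (P : probability (borel Z) R) (Q : probability (borel W) R).
Hypothesis cf : continuous f.
Hypothesis PQ : forall B : set (borel W), measurable B -> P (f @^-1` B) = Q B.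

Lemma ge0_integral_image (g : borel W -> \bar R) : measurable_fun setT g ->
  (forall w, 0 <= g w)%E -> (\int[P]_z g (f z) = \int[Q]_w g w)%E.
Proof.
move=> mg g0; have mf := continuous_measurable_borel cf.
rewrite -(@eq_measure_integral _ _ _ _ Q (pushforward P (f : borel Z -> borel W)))//; last first.
  by move=> A mA _; exact: PQ.
by rewrite (ge0_integral_pushforward mf).
Qed.

(** Adding the bound [M] reduces to the change of variables for nonnegative functions. *)
Lemma mean_image (g : W -> R) : bounded_borel g ->
  \int[P]_z g (f z) = \int[Q]_w g w.
Proof.
move=> [mg [M gM]]; have bg : bounded_borel g by split => //; exists M.
have bM := bounded_borel_cst (Z := W) M.
have bMZ := bounded_borel_cst (Z := Z) M.
have bgf : bounded_borel (g \o f).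
  split; last by exists M => z; exact: gM.
  exact: (measurableT_comp mg (continuous_measurable_borel cf)).
have : \int[P]_z (g (f z) + M) = \int[Q]_w (g w + M).
  rewrite /Rintegral -ge0_integral_image//.
    by apply/measurable_EFinP; apply: measurable_funD => //; exact: measurable_cst.
  by move=> w; rewrite lee_fin -lerBlDr sub0r; have := gM w; rewrite ler_norml => /andP[].
by rewrite (meanD _ bgf)// meanD// !mean_cst => /addIr.
Qed.

End image_measure.

Lemma image_probability (R : realType) (Z W : ptopologicalType) (f : Z -> W)
    (P : probability (borel Z) R) : continuous f ->
  exists Q : probability (borel W) R,
    forall B : set (borel W), measurable B -> P (f @^-1` B) = Q B.
Proof.
move=> cf; have mf := continuous_measurable_borel cf.
have mf_mixin := isMeasurableFun.Build _ _ (borel Z) (borel W) f mf.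
pose X : {mfun borel Z >-> borel W} := HB.pack f mf_mixin.
by exists (distribution P X).
Qed.

Section radon_unique.
Context {R : realType} {Z : pseudoPMetricType R}.
Hypothesis hZ : hausdorff_space Z.
Variables (mu rho : probability (borel Z) R).
Hypothesis mu_radon : radon_probability mu.
Hypothesis mean_eq : forall f, bounded_continuous f -> \int[mu]_z f z = \int[rho]_z f z.

(** The open sets [F n] decrease to [K]. A cutoff from [K] to [F n] compares [mu K] with
    [rho (F n)], and continuity of [rho] from above concludes. *)
Let compact_le (K : set Z) : compact K -> (mu K <= rho K)%E.
Proof.
move=> cK; have clK : closed K by exact: compact_closed.
pose F n := \bigcup_(x in K) (ball x n.+1%:R^-1)°.
have oF n : open (F n) by apply: bigcup_open => x _; exact: open_interior.
have KF n : K `<=` F n by move=> x Kx; exists x => //; exact: nbhsx_ballx.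
have FK : \bigcap_n F n = K.
  apply/seteqP; split => [z Fz|z Kz n _]; last exact: KF.
  apply: contrapT => nKz.
  have /nbhs_ballP[e /= e0 eK] : nbhs z (~` K).
    by apply: open_nbhs_nbhs; split => //; exact: closed_openC.
  have [n ne] := ltr_add_invr e0; rewrite add0r in ne.
  have [x Kx /interior_subset xz] := Fz n I.
  by apply: (eK x) => //; apply: ball_sym; apply: le_ball xz; exact: ltW.
have FKcvg : rho \o F @ \oo --> rho K.
  rewrite -FK; apply: nonincreasing_cvg_mu.
  - by rewrite (le_lt_trans (probability_le1 _ (open_borel (oF 0%N))))// ltry.
  - by move=> n; exact: open_borel.
  - by rewrite FK; exact: closed_borel.
  - move=> m n mn; apply/subsetPset => z [x Kx]; move=> xz; exists x => //.
    apply: interiorS xz; apply: le_ball.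
    by rewrite lef_pV2 ?posrE ?ltr0n// ler_nat.
apply: (cvge_to_ge FKcvg).
apply: nearW => n /=; have [f [f_cont f01 fK fF]] := compact_cutoff cK (oF n) (KF n).
have bcf : bounded_continuous (f : Z -> R).
  by split => //; exists 1 => z; have /andP[? ?] := f01 z; rewrite ger0_norm.
have bf : bounded_borel (f : Z -> R) by exact: bounded_continuous_borel.
rewrite -(EFin_pr mu (closed_borel clK)) -(EFin_pr rho (open_borel (oF n))) lee_fin.
apply: (@le_trans _ _ (\int[mu]_z f z)).
  rewrite -(pr_mean _ (closed_borel clK)); apply: le_mean => //.
    exact: (bounded_borel_indic (closed_borel clK)).
  move=> z; rewrite indicE; have [zK|_] := boolP (z \in K).
    by rewrite fK//; exact: set_mem.
  by case/andP : (f01 z).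
rewrite mean_eq// -(pr_mean _ (open_borel (oF n))); apply: le_mean => //.
  exact: (bounded_borel_indic (open_borel (oF n))).
move=> z; rewrite indicE; have [zU|/negP zU] := boolP (z \in F n).
  by case/andP : (f01 z).
by rewrite fF// => Uz; apply: zU; exact: mem_set.
Qed.

Let radon_le (B : set (borel Z)) : measurable B -> (mu B <= rho B)%E.
Proof.
move=> mB; apply/lee_addgt0Pr => e e0.
have [K [cK KB muK]] := mu_radon mB e0.
have mK : measurable (K : set (borel Z)) by apply: closed_borel; exact: compact_closed.
rewrite -(setDUK KB) measureU//; last 2 first.
- exact: measurableD.
- by rewrite setDE setIC -setIA setICl setI0.
apply: leeD; last exact: ltW.
apply: le_trans (compact_le cK) _; rewrite le_measure ?inE//.
by rewrite setDUK.
Qed.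

(** Compact subsets of [B] give [mu B <= rho B]; the same inequality for the complement gives the
    converse, as both masses total one. In the application [rho] is a marginal of a limit plan,
    known through its means of bounded continuous functions. *)
Lemma radon_mean_unique (B : set (borel Z)) : measurable B -> mu B = rho B.
Proof.
move=> mB; apply/eqP; rewrite eq_le radon_le//=.
have := radon_le (measurableC mB); rewrite !probability_setC//.
by rewrite -(EFin_pr rho mB) -(EFin_pr mu mB) -!EFinB !lee_fin lerD2l lerN2.
Qed.

End radon_unique.

Lemma hausdorff_pair (S T : topologicalType) :
  hausdorff_space S -> hausdorff_space T -> hausdorff_space (S * T)%type.
Proof.
move=> hS hT [s t] [s' t'] st; congr (_, _).
- apply: hS => A B sA sB.
  have [] := st (fst @^-1` A) (fst @^-1` B); [exact: cvg_fst|exact: cvg_fst|].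
  by move=> [u v] [Au Bu]; exists u.
- apply: hT => A B sA sB.
  have [] := st (snd @^-1` A) (snd @^-1` B); [exact: cvg_snd|exact: cvg_snd|].
  by move=> [u v] [Au Bu]; exists v.
Qed.

Section plans_limit.
Context {R : realType} {X Y : pseudoPMetricType R}.
Hypotheses (hX : hausdorff_space X) (hY : hausdorff_space Y).

Lemma plans_image1 (mu : probability (borel X) R) (nu : probability (borel Y) R)
    sigma : plans mu nu sigma ->
  forall A : set (borel X), measurable A -> sigma (fst @^-1` A) = mu A.
Proof.
move=> [smu _] A mA; rewrite -smu//; congr (sigma _).
by apply/seteqP; split => -[x y] //= [].
Qed.

Lemma plans_image2 (mu : probability (borel X) R) (nu : probability (borel Y) R)
    sigma : plans mu nu sigma ->
  forall B : set (borel Y), measurable B -> sigma (snd @^-1` B) = nu B.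
Proof.
move=> [_ snu] A mA; rewrite -snu//; congr (sigma _).
by apply/seteqP; split => -[x y] //= [].
Qed.

Lemma continuous_fst : continuous (fst : X * Y -> X).
Proof. by move=> z; exact: cvg_fst. Qed.

Lemma continuous_snd : continuous (snd : X * Y -> Y).
Proof. by move=> z; exact: cvg_snd. Qed.

Context {P : topologicalType} {U : set_system P} {UU : UltraFilter U}.
Variables (p : P) (mu : P -> probability (borel X) R)
  (nu : P -> probability (borel Y) R)
  (sigma : P -> probability (borel (X * Y)%type) R).
Hypothesis Up : U --> p.
Hypotheses (mu_radon : radon_probability (mu p)) (nu_radon : radon_probability (nu p)).
Hypothesis mu_cvg : forall f, bounded_continuous f ->
  \int[mu q]_z f z @[q --> p] --> \int[mu p]_z f z.
Hypothesis nu_cvg : forall f, bounded_continuous f ->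
  \int[nu q]_z f z @[q --> p] --> \int[nu p]_z f z.
Hypothesis sigma_plans : forall q, plans (mu q) (nu q) (sigma q).

(** The mean of a function of one coordinate has two limits along [U], one from the limit measure
    and one from the weak continuity of the marginals. They agree, and the Radon property of [mu p]
    and [nu p] identifies the marginals as measures. *)
Lemma plans_limit : exists lambda, plans (mu p) (nu p) lambda /\
  forall f, bounded_continuous f ->
    \int[sigma q]_z f z @[q --> U] --> \int[lambda]_z f z.
Proof.
have st : tight_along U sigma.
  apply: (tight_along_plans _ _ _ sigma_plans).
  - by apply: (tight_along_cvg (G := nbhs p)) => //; exact: weak_tight.
  - by apply: (tight_along_cvg (G := nbhs p)) => //; exact: weak_tight.
have hXY : hausdorff_space (X * Y)%type.
  exact: hausdorff_pair.
have [lambda lambdaP] := prokhorov hXY st.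
exists lambda; split => //.
have [rho rhoP] := image_probability lambda continuous_fst.
have [pi piP] := image_probability lambda continuous_snd.
split=> A mA.
- rewrite (_ : A `*` _ = fst @^-1` A); last first.
    by apply/seteqP; split => -[x y] //= [].
  rewrite rhoP//; apply/esym; apply: radon_mean_unique => // f bcf.
  have bcf' : bounded_continuous (f \o fst : X * Y -> R).
    case: bcf => cf [M fM]; split; last by exists M => z; exact: fM.
    by move=> z; apply: continuous_comp; [exact: continuous_fst|exact: cf].
  have bf := bounded_continuous_borel bcf.
  rewrite -(mean_image continuous_fst rhoP bf).
  have h1 := lambdaP _ bcf'.
  have h2 : \int[sigma q]_z (f \o fst) z @[q --> U] --> \int[mu p]_z f z.
    rewrite (_ : (fun q => _) = (fun q => \int[mu q]_z f z)).
      by apply: cvg_trans (mu_cvg bcf); exact: cvg_app.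
    apply/funext => q.
    exact: (mean_image continuous_fst (plans_image1 (sigma_plans q)) bf).
  by rewrite -(cvg_lim (@norm_hausdorff _ R) h2) -(cvg_lim (@norm_hausdorff _ R) h1).
- rewrite (_ : _ `*` A = snd @^-1` A); last first.
    by apply/seteqP; split => -[x y] //= [].
  rewrite piP//; apply/esym; apply: radon_mean_unique => // f bcf.
  have bcf' : bounded_continuous (f \o snd : X * Y -> R).
    case: bcf => cf [M fM]; split; last by exists M => z; exact: fM.
    by move=> z; apply: continuous_comp; [exact: continuous_snd|exact: cf].
  have bf := bounded_continuous_borel bcf.
  rewrite -(mean_image continuous_snd piP bf).
  have h1 := lambdaP _ bcf'.
  have h2 : \int[sigma q]_z (f \o snd) z @[q --> U] --> \int[nu p]_z f z.
    rewrite (_ : (fun q => _) = (fun q => \int[nu q]_z f z)).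
      by apply: cvg_trans (nu_cvg bcf); exact: cvg_app.
    apply/funext => q.
    exact: (mean_image continuous_snd (plans_image2 (sigma_plans q)) bf).
  by rewrite -(cvg_lim (@norm_hausdorff _ R) h2) -(cvg_lim (@norm_hausdorff _ R) h1).
Qed.

End plans_limit.
(** * Probabilities with a density with respect to a product *)

Section bounded_convergence.
Context {R : realType} {Z : ptopologicalType}.

Lemma mean_bounded_cvg0 (P : probability (borel Z) R) (f : nat -> Z -> R) (M : R) :
  (forall n, bounded_borel (f n)) -> (forall n z, `|f n z| <= M) ->
  (forall z, f n z @[n --> \oo] --> 0) -> \int[P]_z f n z @[n --> \oo] --> 0.
Proof.
move=> bf fM f0.
have := @dominated_convergence _ (borel Z) R P setT measurableT
  (fun n z => (f n z)%:E) (cst 0%E) (cst M%:E).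
case.
- by move=> n; apply/measurable_EFinP; case: (bf n).
- exact: measurable_cst.
- by apply: aeW => z _; apply: cvg_EFin; [exact: nearW|exact: f0].
- exact: (bounded_borel_integrable P (bounded_borel_cst M)).
- by apply: aeW => z n _; rewrite lee_fin.
move=> _ _; rewrite integral0 => h.
exact: (cvg_trans _ (fine_cvg h)).
Qed.

(* A form of the Daniell representation theorem, for functionals that are
   given on all bounded Borel functions. *)
Section functional_measure.
Variable J : (Z -> R) -> R.
Hypothesis JD : forall f g, bounded_borel f -> bounded_borel g ->
  J (fun z => f z + g z) = J f + J g.
Hypothesis JZ : forall (r : R) f, bounded_borel f -> J (fun z => r * f z) = r * J f.
Hypothesis J_ge0 : forall f, bounded_borel f -> (forall z, 0 <= f z) -> 0 <= J f.
Hypothesis J1 : J (fun=> 1) = 1.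
Hypothesis J_cvg : forall (f : nat -> Z -> R) M, (forall n, bounded_borel (f n)) ->
  (forall n z, `|f n z| <= M) -> (forall z, f n z @[n --> \oo] --> 0) ->
  J (f n) @[n --> \oo] --> 0.

Let JB f g : bounded_borel f -> bounded_borel g ->
  J (fun z => f z - g z) = J f - J g.
Proof.
move=> bf bg; rewrite -[X in _ = _ + X]mulN1r -JZ// -JD//.
  by congr J; apply/funext => z; rewrite mulN1r.
by apply: bounded_borelM => //; exact: bounded_borel_cst.
Qed.

Let le_J f g : bounded_borel f -> bounded_borel g -> (forall z, f z <= g z) -> J f <= J g.
Proof.
move=> bf bg fg; rewrite -subr_ge0 -JB//; apply: J_ge0; first exact: bounded_borelB.
by move=> z; rewrite subr_ge0.
Qed.

Let J_sum (I : Type) (s : seq I) (F : I -> Z -> R) : (forall i, bounded_borel (F i)) ->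
  J (fun z => \sum_(i <- s) F i z) = \sum_(i <- s) J (F i).
Proof.
move=> bF; elim: s => [|i s IH].
  rewrite big_nil; under eq_fun do rewrite big_nil.
  transitivity (J (fun z => 0 * (fun=> 0) z)).
    by congr J; apply/funext => z; rewrite mul0r.
  by rewrite JZ ?mul0r//; exact: bounded_borel_cst.
rewrite big_cons -IH -JD//; last exact: bounded_borel_sum.
by congr J; apply/funext => z; rewrite big_cons.
Qed.

(** [J] is controlled on Borel functions only, whereas a measure assigns a value to every set. The
    other sets get zero, which keeps [m] nonnegative. *)
Let m (A : set (borel Z)) : \bar R := if `[< measurable A >] then (J \1_A)%:E else 0%E.

Let mE A : measurable A -> m A = (J \1_A)%:E.
Proof. by move=> mA; rewrite /m asboolT. Qed.

Let m0 : m set0 = 0%E.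
Proof.
rewrite mE// (_ : \1_set0 = fun=> 0 * 1); last first.
  by apply/funext => z; rewrite indic0 mul0r.
by rewrite JZ ?mul0r//; exact: bounded_borel_cst.
Qed.

Let m_ge0 A : (0 <= m A)%E.
Proof.
rewrite /m; case: asboolP => // mA; rewrite lee_fin; apply: J_ge0 => //.
exact: bounded_borel_indic.
Qed.

(** The partial sums are indicators, by disjointness, so the remainders are bounded by one. They
    tend to zero pointwise, and [J_cvg] applies to them. *)
Let m_sigma_additive : semi_sigma_additive m.
Proof.
move=> F mF tF mUF; rewrite mE//.
have bF n : bounded_borel (\1_(F n) : Z -> R) by exact: bounded_borel_indic.
have bU : bounded_borel (\1_(\bigcup_n F n) : Z -> R) by exact: bounded_borel_indic.
pose S n (z : Z) : R := \sum_(0 <= i < n) \1_(F i) z.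
have bS n : bounded_borel (S n) by exact: bounded_borel_sum.
have SE n z : S n z = \1_(\big[setU/set0]_(i < n) F i) z.
  rewrite /S big_mkord.
  elim: n => [|n IH]; first by rewrite !big_ord0 indic0.
  rewrite !big_ord_recr/= IH !indicE in_setU.
  have [zn|_] := boolP (z \in F n); last by rewrite orbF addr0.
  rewrite orbT (_ : (z \in _) = false) ?add0r//; apply/negbTE/negP.
  rewrite -bigcup_mkord inE => -[k/= kn Fkz].
  have := tF k n Logic.I Logic.I; move/set_mem : zn => Fnz.
  have /[swap]/[apply] : (F k `&` F n) !=set0 by exists z.
  by move=> kE; rewrite kE ltnn in kn.
have J0 : J (fun z => \1_(\bigcup_n F n) z - S n z) @[n --> \oo] --> 0.
  apply: (@J_cvg _ 1).
  - by move=> n; exact: bounded_borelB.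
  - move=> n z; rewrite SE !indicE.
    case: (_ \in _); case: (_ \in _);
    by rewrite ?subrr ?subr0 ?sub0r ?normrN ?normr0 ?normr1.
  - move=> z; apply: cvg_near_cst.
    have [[k _ Fkz]|nU] := pselect ((\bigcup_n F n) z).
      exists k.+1 => // n /= kn; rewrite SE !indicE !mem_set ?subrr//; last by exists k.
      by rewrite -bigcup_mkord; exists k.
    apply: nearW => n; rewrite SE !indicE !memNset ?subrr//.
    by rewrite -bigcup_mkord => -[k _ Fkz]; apply: nU; exists k.
have : J (S n) @[n --> \oo] --> J \1_(\bigcup_n F n).
  rewrite (_ : (fun n => J (S n)) = fun n => J \1_(\bigcup_n F n) -
      J (fun z => \1_(\bigcup_n F n) z - S n z)).
    by rewrite -[X in _ --> X]subr0; apply: cvgB => //; exact: cvg_cst.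
  by apply/funext => n; rewrite JB// subKr.
rewrite (_ : (fun n => J (S n)) = fun n => \sum_(0 <= i < n) J \1_(F i)); last first.
  by apply/funext => n; exact: J_sum.
rewrite (_ : (fun n => (\sum_(0 <= i < n) m (F i))%E) =
    EFin \o (fun n => \sum_(0 <= i < n) J \1_(F i))).
  by move=> h; apply: cvg_EFin => //; exact: nearW.
by apply/funext => n /=; rewrite -sumEFin; apply: eq_bigr => i _; rewrite mE.
Qed.

HB.instance Definition _ := isMeasure.Build _ _ _ m m0 m_ge0 m_sigma_additive.

Let mT : m setT = 1%E.
Proof. by rewrite mE// indicT J1. Qed.

HB.instance Definition _ := Measure_isProbability.Build _ _ _ m mT.

Let pr_m A : measurable (A : set (borel Z)) -> pr m A = J \1_A.
Proof. by move=> mA; rewrite -[LHS]/(fine (m A)) mE. Qed.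

(** On indicators the mean and [J] agree by construction, and both are monotone. So both values lie
    between the same two layer sums, which differ by [1 / (n + 1)]. *)
Let mean_m01 f : bounded_borel f -> (forall z, 0 <= f z <= 1) -> \int[m]_z f z = J f.
Proof.
move=> bf f01; have mf := bf.1.
have b1 := bounded_borel_cst (Z := Z) (1 : R).
have close n : `|\int[m]_z f z - J f| <= n.+1%:R^-1.
  pose G (k : 'I_n.+1) := [set z | k.+1%:R / n.+1%:R < f z].
  have mG k : measurable (G k : set (borel Z)).
    rewrite -[X in measurable X]setTI (_ : G k = f @^-1` `]k.+1%:R / n.+1%:R, +oo[).
      by apply: mf => //; exact: measurable_itv.
    by apply/seteqP; split => z; rewrite /G/= in_itv/= andbT.
  have bG k : bounded_borel (\1_(G k) : Z -> R) by exact: bounded_borel_indic.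
  have bS := bounded_borel_sum (index_enum 'I_n.+1) bG.
  have bM := bounded_borel_cst (Z := Z) (n.+1%:R^-1 : R).
  pose c := n.+1%:R^-1 * \sum_(k < n.+1) J \1_(G k).
  have lo z : n.+1%:R^-1 * \sum_(k < n.+1) \1_(G k) z <= f z.
    by have /andP[] := layer_bounds n (f01 z).
  have hi z : f z <= n.+1%:R^-1 * (1 + \sum_(k < n.+1) \1_(G k) z).
    by have /andP[] := layer_bounds n (f01 z).
  have bSM := bounded_borelM bM bS.
  have b1S := bounded_borelD b1 bS.
  have b1SM := bounded_borelM bM b1S.
  have h1 : c <= J f by rewrite /c -J_sum// -JZ//; exact: le_J.
  have h2 : J f <= n.+1%:R^-1 + c.
    by rewrite -[X in X + c]mulr1 -mulrDr -J_sum// -[X in X + _]J1 -JD// -JZ//; exact: le_J.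
  have cE : c = n.+1%:R^-1 * \int[m]_z (\sum_(k < n.+1) \1_(G k) z).
    by rewrite mean_sum//; congr (_ * _); apply: eq_bigr => k _; rewrite pr_mean// pr_m.
  have h3 : c <= \int[m]_z f z by rewrite cE -meanZ//; exact: le_mean.
  have h4 : \int[m]_z f z <= n.+1%:R^-1 + c.
    by rewrite cE -{1}[n.+1%:R^-1]mulr1 -mulrDr -{2}[1](mean_cst m) -meanD// -meanZ//; exact: le_mean.
  move: h1 h2 h3 h4; move: (J f) c {cE} (Rintegral _ _ _) (n.+1%:R^-1) => u c v w.
  by rewrite ler_norml => *; apply/andP; split; lra.
apply/eqP; rewrite -subr_eq0 -normr_le0; apply/ler_addgt0Pr => e e0; rewrite add0r.
have [n ne] := ltr_add_invr e0; rewrite add0r in ne.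
exact: le_trans (close n) (ltW ne).
Qed.

Theorem functional_measure : exists Q : probability (borel Z) R,
  forall f, bounded_borel f -> \int[Q]_z f z = J f.
Proof.
exists m => f bf; have [mf [M fM]] := bf.
have [N N0 fN] : exists2 N, 0 < 2 * N & forall z, - N <= f z <= N.
  exists (1 + `|M|); first by rewrite mulr_gt0// ltr_pwDl.
  by move=> z; rewrite -ler_norml (le_trans (fM z))// (le_trans (ler_norm _))// lerDr.
have b1 := bounded_borel_cst (Z := Z) (1 : R).
have bN := bounded_borel_cst (Z := Z) N.
have bfN := bounded_borelD bf bN.
have bNN := bounded_borel_cst (Z := Z) (2 * N)^-1.
have := @mean_m01 (fun z => (2 * N)^-1 * (f z + N)) (bounded_borelM bNN bfN).
rewrite meanZ// meanD// mean_cst JZ// JD// (_ : J (fun=> N) = N); last first.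
  by rewrite -{2}[N]mulr1 -J1 -JZ//; congr J; apply/funext => z; rewrite mulr1.
move=> H; have {H} := H _; have nz : (2 * N)^-1 != 0 by rewrite invr_eq0 gt_eqF.
move=> H; apply: (addIr N); apply: (mulfI nz); apply: H => z.
have /andP[f1 f2] := fN z.
rewrite mulr_ge0/= ?invr_ge0 ?(ltW N0)//; last by rewrite -lerBlDr sub0r.
by rewrite ler_pdivrMl// mulr1 mulr_natl mulr2n lerD2r.
Qed.

End functional_measure.
End bounded_convergence.

Section product.
Context {R : realType} {X Y : pseudoPMetricType R}.
Implicit Types (mu : probability (borel X) R) (nu : probability (borel Y) R).

Lemma continuous_pair (x : X) : continuous (pair x : Y -> X * Y).
Proof. by move=> y; apply: cvg_pair => //; exact: cvg_cst. Qed.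

Lemma measurable_pair_borel (x : X) :
  measurable_fun setT (pair x : borel Y -> borel (X * Y)%type).
Proof.
exact: (@continuous_measurable_borel Y (X * Y)%type (pair x) (@continuous_pair x)).
Qed.

(* If [U] is open, [U x y] holds with a neighbourhood of [x], so sections of [U]
   shrink by little mass when [x] moves. *)
Lemma open_section_lsc nu (U : set (X * Y)) (r : R) : open U ->
  open [set x | r < pr nu (pair x @^-1` U)].
Proof.
move=> oU; have oUx x : open (pair x @^-1` U).
  by apply: open_comp => // y _; exact: (@continuous_pair x y).
rewrite openE => x /= rx.
pose E n := interior [set y | forall x', ball x n.+1%:R^-1 x' -> U (x', y)].
have oE n : open (E n) by exact: open_interior.
have EU : \bigcup_n E n = pair x @^-1` U.
  apply/seteqP; split => [y [n _ /interior_subset]|y Uxy].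
    by apply; exact: ballxx.
  have [[A B] /= [xA yB] ABU] : nbhs (x, y) U by apply: open_nbhs_nbhs.
  have /nbhs_ballP[e /= e0 eA] := xA.
  have [n ne] := ltr_add_invr e0; rewrite add0r in ne.
  exists n => //; apply: filterS yB => y' By' x' xx'; apply: (ABU (x', y')); split => //=.
  by apply: eA; apply: le_ball xx'; exact: ltW.
have Ecvg : nu \o E @ \oo --> nu (pair x @^-1` U).
  rewrite -EU; apply: nondecreasing_cvg_mu.
  - by move=> n; exact: open_borel.
  - by rewrite EU; exact: open_borel.
  - move=> m n mn; apply/subsetPset; apply: interiorS => y h x' xx'; apply: h.
    by apply: le_ball xx'; rewrite lef_pV2 ?posrE ?ltr0n// ler_nat.
have [n rn] : exists n, r < pr nu (E n).
  have : fine \o (nu \o E) @ \oo --> pr nu (pair x @^-1` U).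
    by apply: fine_cvg; rewrite EFin_pr//; exact: open_borel.
  by move=> /cvgr_gt/(_ _ rx)[n _ h]; exists n; exact: (h n (leqnn n)).
apply/nbhs_ballP; exists n.+1%:R^-1 => //= x' xx'.
apply: (lt_le_trans rn); apply: le_pr; [exact: open_borel..|].
by move=> y /interior_subset; apply.
Qed.

(** Rectangles need not generate the Borel sets of the product, so the Dynkin argument starts from
    open sets, whose sections have lower semicontinuous mass. *)
Lemma measurable_section nu (B : set (borel (X * Y)%type)) : measurable B ->
  measurable_fun setT ((fun x => nu (pair x @^-1` B)) : borel X -> \bar R).
Proof.
have msec x (A : set (borel (X * Y)%type)) : measurable A ->
    measurable (pair x @^-1` A : set (borel Y)).
  move=> mA; rewrite -[X in measurable X]setTI.
  exact: measurable_pair_borel.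
move=> mB; apply: (@dynkin_induction _ (borel (X * Y)%type) (@open (X * Y)%type)
  (fun B => measurable_fun setT ((fun x => nu (pair x @^-1` B)) : borel X -> \bar R))) => //.
- by move=> U V oU oV; exact: openI.
- rewrite (_ : (fun x => _) = cst 1%E); first exact: measurable_cst.
  by apply/funext => x; rewrite preimage_setT (probability_setT nu).
- move=> U oU; rewrite (_ : (fun x => _) = EFin \o (fun x => pr nu (pair x @^-1` U))).
    apply/measurable_EFinP.
    apply: (@measurability _ _ (borel X) R setT _ _ (RGenOInfty.measurableE R)).
    move=> _ [_ [r ->] <-]; rewrite setTI; apply: open_borel.
    rewrite (_ : _ @^-1` _ = [set x | r < pr nu (pair x @^-1` U)]).
      exact: open_section_lsc.
    by apply/seteqP; split => x /=; rewrite in_itv/= andbT.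
  by apply/funext => x /=; rewrite EFin_pr//; apply: msec; exact: open_borel.
- move=> S mS mfS.
  rewrite (_ : (fun x => _) = (fun x => 1 - nu (pair x @^-1` S))%E).
    by apply: emeasurable_funB => //; exact: measurable_cst.
  by apply/funext => x; rewrite preimage_setC probability_setC//; exact: msec.
- move=> F mF tF mfF.
  rewrite (_ : (fun x => _) = (fun x => \sum_(0 <= i <oo) nu (pair x @^-1` F i))%E).
    by apply: ge0_emeasurable_sum.
  apply/funext => x; rewrite preimage_bigcup measure_semi_bigcup//.
  + by move=> i; exact: msec.
  + by move=> i j _ _ [y [Fi Fj]]; apply: tF => //; exists (x, y).
  + by rewrite -preimage_bigcup; apply: msec; exact: bigcup_measurable.
Qed.

Lemma bounded_borel_section (x : X) (F : X * Y -> R) :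
  bounded_borel F -> bounded_borel (fun y => F (x, y)).
Proof.
move=> [mF [M FM]]; split; last by exists M => y; exact: FM.
exact: (measurableT_comp mF (measurable_pair_borel x)).
Qed.

(** The images of [nu] under [pair x] form a measurable kernel, so the integral of a fixed
    nonnegative function against them is measurable in [x]. The bound [M] is added to [F] for this
    purpose and subtracted afterwards. *)
Lemma bounded_borel_mean_section nu (F : X * Y -> R) :
  bounded_borel F -> bounded_borel (fun x => \int[nu]_y F (x, y)).
Proof.
move=> bF; have [mF [M FM]] := bF; split; last first.
  by exists M => x; apply: norm_mean_bound => // ; exact: bounded_borel_section.
pose k x : giry (borel (X * Y)%type) R := giry_map (measurable_pair_borel x) nu.
have mk : measurable_fun setT (k : borel X -> _).
  by apply: measurable_giry_codensity => // B mB; exact: measurable_section.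
pose G p := (F p + M)%:E.
have mG : measurable_fun setT (G : borel (X * Y)%type -> \bar R).
  by apply/measurable_EFinP; apply: measurable_funD => //; exact: measurable_cst.
have G0 p : (0 <= G p)%E.
  by rewrite lee_fin -lerBlDr sub0r; have := FM p; rewrite ler_norml => /andP[].
have mkG := measurableT_comp (measurable_giry_int mG G0) mk.
rewrite (_ : (fun x => _) = (fun x => fine (giry_int (k x) G) - M)).
  apply: measurable_funB; last exact: measurable_cst.
  exact: (measurableT_comp _ mkG).
apply/funext => x; rewrite giry_int_map// -[fine _]/(\int[nu]_y (F (x, y) + M)).
rewrite meanD ?mean_cst ?addrK//; first exact: bounded_borel_section.
exact: bounded_borel_cst.
Qed.

(** The iterated mean is a functional on bounded Borel functions. Its continuity under bounded
    pointwise convergence comes from dominated convergence, used in each of the two variables. *)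
Lemma product_density mu nu (D : X * Y -> R) : bounded_borel D ->
  (forall p, 0 <= D p) -> \int[mu]_x \int[nu]_y D (x, y) = 1 ->
  exists Q : probability (borel (X * Y)%type) R, forall F, bounded_borel F ->
    \int[Q]_p F p = \int[mu]_x \int[nu]_y (F (x, y) * D (x, y)).
Proof.
move=> bD D0 D1; have [M DM] := bD.2.
pose J (F : X * Y -> R) := \int[mu]_x \int[nu]_y (F (x, y) * D (x, y)).
have bs x F : bounded_borel F -> bounded_borel (fun y => F (x, y) * D (x, y)).
  by move=> bF; exact: (bounded_borel_section x (bounded_borelM bF bD)).
have bm F : bounded_borel F -> bounded_borel (fun x => \int[nu]_y (F (x, y) * D (x, y))).
  by move=> bF; exact: (bounded_borel_mean_section nu (bounded_borelM bF bD)).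
apply: (@functional_measure _ _ J).
- move=> f g bf bg; rewrite /J -meanD; [|exact: bm..].
  apply: eq_Rintegral => x _; rewrite -meanD; [|exact: bs..].
  by apply: eq_Rintegral => y _; rewrite mulrDl.
- move=> r f bf; rewrite /J -meanZ; [|exact: bm].
  apply: eq_Rintegral => x _; rewrite -meanZ; [|exact: bs].
  by apply: eq_Rintegral => y _; rewrite mulrA.
- by move=> f bf f0; apply: Rintegral_ge0 => x _; apply: Rintegral_ge0 => y _; exact: mulr_ge0.
- rewrite /J -[RHS]D1; apply: eq_Rintegral => x _; apply: eq_Rintegral => y _.
  by rewrite mul1r.
- move=> f N bf fN f0; have bnd n x y : `|f n (x, y) * D (x, y)| <= N * M.
    by rewrite normrM ler_pM.
  apply: (@mean_bounded_cvg0 _ _ _ _ (N * M)) => [n|n x|x]; first exact: bm.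
    by apply: norm_mean_bound => //; exact: bs.
  apply: (@mean_bounded_cvg0 _ _ _ _ (N * M)) => [n|n y|y //]; [exact: bs|exact: bnd|].
  by rewrite -[X in _ --> X](mul0r (D (x, y))); apply: cvgMl; exact: f0.
Qed.

End product.
(** * Completion of a tensor density to a plan *)

Section tensor_plan.
Context {R : realType} {X Y : pseudoPMetricType R}.
Variables (mu : probability (borel X) R) (nu : probability (borel Y) R).
Variables (K : Type) (ks : seq K) (a : K -> X -> R) (b : K -> Y -> R).
Hypotheses (ba : forall k, bounded_borel (a k)) (bb : forall k, bounded_borel (b k)).
Hypotheses (a0 : forall k x, 0 <= a k x) (b0 : forall k y, 0 <= b k y).

(** [G] is the density of a sub-plan with respect to the product of [mu] and [nu]; [u] and [v] are
    the densities of its marginals and [m] is its missing mass. Both [1 - u] and [1 - v] have mean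
    [m], so their product is divided by [m] to restore the marginals. *)
Let G (z : X * Y) := \sum_(k <- ks) a k z.1 * b k z.2.
Let u x := \sum_(k <- ks) a k x * \int[nu]_y b k y.
Let v y := \sum_(k <- ks) \int[mu]_x a k x * b k y.
Let m := 1 - \sum_(k <- ks) \int[mu]_x a k x * \int[nu]_y b k y.
Let D (z : X * Y) := G z + (1 - u z.1) * (1 - v z.2) * m^-1.

Hypotheses (u1 : forall x, u x <= 1) (v1 : forall y, v y <= 1).

Let bcX (r : R) := bounded_borel_cst (Z := X) r.
Let bcY (r : R) := bounded_borel_cst (Z := Y) r.

Let bu : bounded_borel u.
Proof. by apply: bounded_borel_sum => k; exact: bounded_borelM. Qed.

Let bv : bounded_borel v.
Proof. by apply: bounded_borel_sum => k; exact: bounded_borelM. Qed.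

Let bu1 : bounded_borel (fun x => 1 - u x). Proof. exact: bounded_borelB. Qed.
Let bv1 : bounded_borel (fun y => 1 - v y). Proof. exact: bounded_borelB. Qed.

Let mean_u1 : \int[mu]_x (1 - u x) = m.
Proof.
rewrite meanB// mean_cst mean_sum; last by move=> k; exact: bounded_borelM.
congr (1 - _); apply: eq_bigr => k _; rewrite mulrC -meanZ//.
by apply: eq_Rintegral => x _; rewrite mulrC.
Qed.

Let mean_v1 : \int[nu]_y (1 - v y) = m.
Proof.
rewrite meanB// mean_cst mean_sum; last by move=> k; exact: bounded_borelM.
by congr (1 - _); apply: eq_bigr => k _; rewrite meanZ.
Qed.

Let u1_ge0 x : 0 <= 1 - u x. Proof. by rewrite subr_ge0. Qed.
Let v1_ge0 y : 0 <= 1 - v y. Proof. by rewrite subr_ge0. Qed.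

Let m_ge0 : 0 <= m.
Proof. by rewrite -mean_u1; apply: Rintegral_ge0. Qed.

Let bounded_borel_fst (f : X -> R) : bounded_borel f ->
  bounded_borel (fun z : X * Y => f z.1).
Proof.
move=> [mf [M fM]]; split; last by exists M => z.
exact: (measurableT_comp mf (continuous_measurable_borel continuous_fst)).
Qed.

Let bounded_borel_snd (f : Y -> R) : bounded_borel f ->
  bounded_borel (fun z : X * Y => f z.2).
Proof.
move=> [mf [M fM]]; split; last by exists M => z.
exact: (measurableT_comp mf (continuous_measurable_borel continuous_snd)).
Qed.

Let bD : bounded_borel D.
Proof.
apply: bounded_borelD.
  apply: bounded_borel_sum => k.
  by apply: bounded_borelM; [exact: bounded_borel_fst|exact: bounded_borel_snd].
apply: bounded_borelM; last exact: bounded_borel_cst.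
apply: bounded_borelM; [exact: (bounded_borel_fst bu1)|exact: (bounded_borel_snd bv1)].
Qed.

Let D_ge0 z : 0 <= D z.
Proof.
rewrite addr_ge0// ?mulr_ge0 ?invr_ge0//.
by apply: sumr_ge0 => k _; rewrite mulr_ge0.
Qed.

Let mean_snd_D (g : Y -> R) x : bounded_borel g ->
  \int[nu]_y (g y * D (x, y)) =
  \sum_(k <- ks) a k x * \int[nu]_y (g y * b k y) +
  (1 - u x) * (m^-1 * \int[nu]_y (g y * (1 - v y))).
Proof.
move=> bg; have bgb k := bounded_borelM bg (bb k).
have bgv := bounded_borelM bg bv1.
rewrite -meanZ// -meanZ; last exact: bounded_borelM.
under [in RHS]eq_bigr do rewrite -meanZ//.
rewrite -mean_sum => [|k]; last exact: bounded_borelM.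
rewrite -meanD.
- apply: eq_Rintegral => y _; rewrite /D/= mulrDr; congr (_ + _).
    by rewrite mulr_sumr; apply: eq_bigr => k _; rewrite mulrCA.
  by move: (m^-1) => mi /=; ring.
- by apply: bounded_borel_sum => k; exact: bounded_borelM.
- by apply: bounded_borelM => //; exact: bounded_borelM.
Qed.

(** Where [m] vanishes its inverse is zero by convention, but so is every missing mass [r]; the
    completed marginals are right in this case too. *)
Let mm (r : R) : 0 <= r <= m -> r * (m^-1 * m) = r.
Proof.
have [->|mn0 _] := eqVneq m 0.
  move=> /andP[r0 r1]; have -> : r = 0 by apply/eqP; rewrite eq_le r0 r1.
  by rewrite !mul0r.
by rewrite mulVf// mulr1.
Qed.

(** The condition [f x <= 1], true of indicators, bounds the missing part of the mean of [f] by [m],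
    as [mm] requires. *)
Let mean_D_fst (f : X -> R) : bounded_borel f -> (forall x, 0 <= f x <= 1) ->
  \int[mu]_x \int[nu]_y (f x * D (x, y)) = \int[mu]_x f x.
Proof.
move=> bf f01; have bfu := bounded_borelM bf bu; have bfu1 := bounded_borelM bf bu1.
transitivity (\int[mu]_x (f x * u x + m^-1 * m * (f x * (1 - u x)))).
  apply: eq_Rintegral => x _; rewrite meanZ; last exact: bounded_borel_section.
  rewrite -[\int[nu]_y D (x, y)]/(Rintegral nu setT (fun y => D (x, y))).
  rewrite (_ : (fun y => D (x, y)) = (fun y => 1 * D (x, y))); last first.
    by apply/funext => y; rewrite mul1r.
  rewrite mean_snd_D// mulrDr; congr (_ * _ + _).
    apply: eq_bigr => k _; congr (_ * _).
    by apply: eq_Rintegral => y _; rewrite mul1r.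
  rewrite (_ : \int[nu]_y (1 * (1 - v y)) = m); last first.
    by rewrite -mean_v1; apply: eq_Rintegral => y _; rewrite mul1r.
  by rewrite mulrA mulrC.
rewrite meanD// ?meanZ//; last by apply: bounded_borelM.
rewrite [X in _ + X]mulrC mm; last first.
  apply/andP; split.
    by apply: Rintegral_ge0 => x _; rewrite mulr_ge0//; case/andP : (f01 x).
  rewrite -mean_u1; apply: le_mean => // x; rewrite ler_piMl//.
  by case/andP : (f01 x).
rewrite -meanD//; apply: eq_Rintegral => x _.
by rewrite mulrBr mulr1 addrC subrK.
Qed.

Let mean_D_snd (g : Y -> R) : bounded_borel g -> (forall y, 0 <= g y <= 1) ->
  \int[mu]_x \int[nu]_y (g y * D (x, y)) = \int[nu]_y g y.
Proof.
move=> bg g01; have bgv := bounded_borelM bg bv; have bgv1 := bounded_borelM bg bv1.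
under eq_Rintegral do rewrite mean_snd_D//.
rewrite meanD; last 2 first.
- by apply: bounded_borel_sum => k; exact: bounded_borelM.
- exact: bounded_borelM.
rewrite mean_sum => [|k]; last exact: bounded_borelM.
pose c := m^-1 * \int[nu]_y (g y * (1 - v y)).
rewrite (_ : \int[mu]_x ((1 - u x) * _) = m * c); last first.
  rewrite -[X in X * c]mean_u1 [RHS]mulrC -(meanZ _ c bu1).
  by apply: eq_Rintegral => x _; rewrite mulrC.
rewrite /c mulrCA mulrA [X in _ + X]mulrC mm; last first.
  apply/andP; split.
    by apply: Rintegral_ge0 => y _; rewrite mulr_ge0//; case/andP : (g01 y).
  rewrite -mean_v1; apply: le_mean => // y; rewrite ler_piMl//.
  by case/andP : (g01 y).
rewrite (_ : \sum_(k <- ks) _ = \int[nu]_y (g y * v y)); last first.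
  transitivity (\int[nu]_y (\sum_(k <- ks) \int[mu]_x a k x * (g y * b k y))).
    rewrite mean_sum => [|k]; last first.
      by apply: bounded_borelM => //; exact: bounded_borelM.
    apply: eq_bigr => k _; rewrite meanZ; last exact: bounded_borelM.
    rewrite mulrC -meanZ//.
    by apply: eq_Rintegral => x _; rewrite mulrC.
  apply: eq_Rintegral => y _; rewrite mulr_sumr.
  by apply: eq_bigr => k _; rewrite mulrCA.
rewrite -meanD//; apply: eq_Rintegral => y _.
by rewrite mulrBr mulr1 addrC subrK.
Qed.

Lemma tensor_plan : exists2 Q, plans mu nu Q & forall F, bounded_borel F ->
  \int[Q]_z F z = \int[mu]_x \int[nu]_y (F (x, y) *
    (\sum_(k <- ks) a k x * b k y +
     (1 - \sum_(k <- ks) a k x * \int[nu]_y b k y) *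
     (1 - \sum_(k <- ks) \int[mu]_x a k x * b k y) *
     (1 - \sum_(k <- ks) \int[mu]_x a k x * \int[nu]_y b k y)^-1)).
Proof.
have D1 : \int[mu]_x \int[nu]_y D (x, y) = 1.
  transitivity (\int[mu]_x \int[nu]_y (1 * D (x, y))).
    apply: eq_Rintegral => x _; apply: eq_Rintegral => y _.
    by rewrite mul1r.
  by rewrite (mean_D_fst (bcX 1)) ?mean_cst// => x; rewrite lexx ler01.
have [Q QF] := product_density bD D_ge0 D1.
exists Q; last exact: QF.
split=> A mA.
- have mA' := measurable_fst_borel (Y := Y) mA.
  rewrite -(EFin_pr Q mA') -(EFin_pr mu mA) -!pr_mean// QF; last exact: bounded_borel_indic.
  have bA : bounded_borel (\1_A : X -> R) by exact: bounded_borel_indic.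
  rewrite -(mean_D_fst bA); last first.
    by move=> x; rewrite indicE; case: (_ \in _); rewrite ?lexx ?ler01.
  congr EFin; apply: eq_Rintegral => x _; apply: eq_Rintegral => y _.
  by congr (_ * _); rewrite !indicE in_setX/= in_setT andbT.
- have mA' := measurable_snd_borel (X := X) mA.
  rewrite -(EFin_pr Q mA') -(EFin_pr nu mA) -!pr_mean// QF; last exact: bounded_borel_indic.
  have bA : bounded_borel (\1_A : Y -> R) by exact: bounded_borel_indic.
  rewrite -(mean_D_snd bA); last first.
    by move=> x; rewrite indicE; case: (_ \in _); rewrite ?lexx ?ler01.
  congr EFin; apply: eq_Rintegral => x _; apply: eq_Rintegral => y _.
  by congr (_ * _); rewrite !indicE in_setX/= in_setT.
Qed.

End tensor_plan.

(** * Bounded continuous functions, and means depending on a parameter *)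

Section bounded_continuous_functions.
Context {R : realType}.

(** The same condition as [bounded_continuous], over spaces that need not be pointed, such as the
    parameter space and its products with [X] and [Y]. *)
Definition bdc (S : topologicalType) (f : S -> R) :=
  continuous f /\ exists M : R, forall s, `|f s| <= M.

Lemma bdc_cst (S : topologicalType) (r : R) : bdc ((fun=> r) : S -> R).
Proof. by split; [move=> s; exact: cvg_cst|exists `|r|]. Qed.

Lemma bdcD (S : topologicalType) (f g : S -> R) : bdc f -> bdc g -> bdc (fun s => f s + g s).
Proof.
move=> [cf [M fM]] [cg [N gN]]; split; first by move=> s; apply: cvgD; [exact: cf|exact: cg].
by exists (M + N) => s; rewrite (le_trans (ler_normD _ _))// lerD.
Qed.

Lemma bdcM (S : topologicalType) (f g : S -> R) : bdc f -> bdc g -> bdc (fun s => f s * g s).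
Proof.
move=> [cf [M fM]] [cg [N gN]]; split; first by move=> s; apply: cvgM; [exact: cf|exact: cg].
by exists (M * N) => s; rewrite normrM ler_pM.
Qed.

Lemma bdcN (S : topologicalType) (f : S -> R) : bdc f -> bdc (fun s => - f s).
Proof.
move=> [cf [M fM]]; split; first by move=> s; apply: cvgN; exact: cf.
by exists M => s; rewrite normrN.
Qed.

Lemma bdcB (S : topologicalType) (f g : S -> R) : bdc f -> bdc g -> bdc (fun s => f s - g s).
Proof. by move=> bf bg; apply: bdcD => //; exact: bdcN. Qed.

Lemma bdc_sum (S : topologicalType) (I : Type) (s : seq I) (f : I -> S -> R) :
  (forall i, bdc (f i)) -> bdc (fun z => \sum_(i <- s) f i z).
Proof.
move=> bf; elim: s => [|i s IH].
  by under eq_fun do rewrite big_nil; exact: bdc_cst.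
by under eq_fun do rewrite big_cons; exact: bdcD.
Qed.

Lemma bdc_comp (S S' : topologicalType) (f : S -> R) (g : S' -> S) :
  continuous g -> bdc f -> bdc (f \o g).
Proof.
move=> cg [cf [M fM]]; split; last by exists M => s; exact: fM.
by move=> s; apply: continuous_comp; [exact: cg|exact: cf].
Qed.

Lemma bdc_borel (Z : ptopologicalType) (f : Z -> R) : bdc f -> bounded_borel f.
Proof. exact: bounded_continuous_borel. Qed.

End bounded_continuous_functions.

Definition weakly_continuous_radon (R : realType) (P : topologicalType)
    (Z : ptopologicalType) (rho : P -> probability (borel Z) R) :=
  (forall p, radon_probability (rho p)) /\
  (forall f, bounded_continuous f -> continuous (fun p => \int[rho p]_z f z)).

Lemma bdc_mean (R : realType) (P : topologicalType) (Z : pseudoPMetricType R)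
    (rho : P -> probability (borel Z) R) (F : P * Z -> R) :
  hausdorff_space Z -> weakly_continuous_radon rho -> bdc F ->
  bdc (fun p => \int[rho p]_z F (p, z)).
Proof.
move=> hZ [rr rc] [cF [M FM]].
have cFp p : continuous (fun z => F (p, z)).
  move=> z; apply: (@continuous_comp _ _ _ (fun z => (p, z)) F); last exact: cF.
  by apply: cvg_pair => //; exact: cvg_cst.
split.
  move=> p; apply: (@cvg_mean_joint _ _ _ hZ rho p _ _ F M) => //.
  - by move=> f bf; exact: rc.
  - by move=> z; exact: cF.
exists M => p; apply: norm_mean_bound => //.
by apply: bounded_continuous_borel; split => //; exists M.
Qed.

Section iterated.
Context {R : realType} {X Y : pseudoPMetricType R} {P : topologicalType}.
Hypotheses (hX : hausdorff_space X) (hY : hausdorff_space Y).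
Variables (mu : P -> probability (borel X) R) (nu : P -> probability (borel Y) R).
Hypotheses (mu_wcr : weakly_continuous_radon mu) (nu_wcr : weakly_continuous_radon nu).

(** The inner mean is bounded and continuous on [P * X], with [nu] regarded as a family over that
    space; the outer mean is then of the same kind. *)
Lemma bdc_iterated_mean (F : P * (X * Y) -> R) : bdc F ->
  bdc (fun p => \int[mu p]_x \int[nu p]_y F (p, (x, y))).
Proof.
move=> bF; apply: (@bdc_mean _ _ _ mu (fun q => \int[nu q.1]_y F (q.1, (q.2, y)))) => //.
apply: (@bdc_mean _ _ _ (fun q : P * X => nu q.1) (fun r => F (r.1.1, (r.1.2, r.2)))) => //.
  split; first by move=> q; exact: nu_wcr.1.
  move=> f bf q; apply: (@continuous_comp _ _ _ fst (fun p => \int[nu p]_z f z)).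
    exact: cvg_fst.
  exact: nu_wcr.2.
apply: (@bdc_comp _ _ _ F (fun r : P * X * Y => (r.1.1, (r.1.2, r.2)))) => //.
move=> r; apply: (@cvg_pair _ _ _ _ (nbhs r.1.1) (nbhs (r.1.2, r.2))).
  by apply: (@continuous_comp _ _ _ fst fst); exact: cvg_fst.
apply: (@cvg_pair _ _ _ _ (nbhs r.1.2) (nbhs r.2)); last exact: cvg_snd.
by apply: (@continuous_comp _ _ _ fst snd); [exact: cvg_fst|exact: cvg_snd].
Qed.

End iterated.

Lemma compact_partition (R : realType) (Z : pseudoPMetricType R) (K : set Z) (d : R) :
  hausdorff_space Z -> compact K -> 0 < d ->
  exists (s : seq Z) (f : Z -> Z -> R), [/\ forall x, x \in s -> K x,
    forall x, bdc (f x), forall x z, 0 <= f x z,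
    (forall z, \sum_(x <- s) f x z <= 1) /\ (forall z, K z -> \sum_(x <- s) f x z = 1) &
    forall x z, f x z != 0 -> ball x d z].
Proof.
move=> hZ cK d0.
have /choice[g Hg] x : exists g : Z -> R, [/\ continuous g, forall z, 0 <= g z <= 1,
    g x = 1 & forall z, ~ ball x d z -> g z = 0].
  have xd : [set x] `<=` (ball x d)° by move=> _ ->; exact: nbhsx_ballx.
  have [g [cg g01 gK gU]] := compact_cutoff (@compact_set1 _ x) (@open_interior _ (ball x d)) xd.
  exists g; split => //; first exact: gK.
  by move=> z nz; apply: gU => /interior_subset.
have gc x : continuous (g x) by case: (Hg x).
have g01 x z : 0 <= g x z <= 1 by case: (Hg x).
pose V x := [set z | 2^-1 < g x z].
have := cK; rewrite compact_cover => /(_ Z K V)[].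
- move=> x _; apply: (@open_comp _ _ (g x) [set y | 2^-1 < y]) => [z _|].
    exact: gc.
  exact: open_gt.
- move=> x Kx; exists x => //; rewrite /V/=; have [_ _ -> _] := Hg x.
  by rewrite invf_lt1// ltr1n.
move=> D DK KD; pose s : seq Z := finmap.enum_fset D.
pose S z := \sum_(x <- s) g x z.
have cS : continuous S.
  by move=> z; apply: cvg_sum => x; exact: gc.
have S0 z : 0 <= S z by apply: sumr_ge0 => x _; case/andP : (g01 x z).
(* At each point of [K] some cutoff exceeds [1 / 2], so there the maximum is the sum itself.
   Elsewhere it keeps the denominator away from zero and the normalised sum at most one. *)
pose N z := Num.max (S z) 2^-1.
have N0 z : 0 < N z by rewrite lt_max invr_gt0 ltr0n orbT.
have cN : continuous (fun z => (N z)^-1).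
  move=> z; apply: cvgV; first by rewrite gt_eqF.
  exact: (continuous_max (cS z) (@cvg_cst _ _ _ _ _)).
exists s, (fun x z => g x z / N z); split.
- by move=> x xs; apply: set_mem; exact: DK.
- move=> x; split; first by move=> z; apply: cvgM; [exact: gc|exact: cN].
  exists 2 => z; have /andP[g0 g1] := g01 x z.
  rewrite ger0_norm ?divr_ge0 ?(ltW (N0 z))// ler_pdivrMr//.
  rewrite (le_trans g1)// -ler_pdivrMl// mulr1.
  by rewrite le_max lexx orbT.
- by move=> x z; rewrite divr_ge0 ?(ltW (N0 z))//; case/andP : (g01 x z).
- split=> z; rewrite -mulr_suml.
    by rewrite ler_pdivrMr// mul1r le_max lexx.
  move=> Kz; have [x xD xz] := KD _ Kz.
  have Sz : 2^-1 <= S z.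
    rewrite /S (big_rem x)//= (le_trans (ltW xz))// lerDl.
    by apply: sumr_ge0 => x' _; case/andP : (g01 x' z).
  by rewrite /N max_l// divff// gt_eqF// (lt_le_trans _ Sz)// invr_gt0.
- move=> x z; apply: contra_neqP => nz; have [_ _ _ ->//] := Hg x.
  by rewrite mul0r.
Qed.
(** * Continuous selections through a given plan *)

(** Only the centre [z] is taken in [K]: the cells to which this is applied have their base point in
    a compact set but may stick out of it. *)
Lemma compact_oscillation (R : realType) (Z : pseudoMetricType R) (F : Z -> R)
    (K : set Z) (e : R) : continuous F -> compact K -> 0 < e ->
  exists2 d : R, 0 < d & forall z z', K z -> ball z d z' -> `|F z' - F z| <= e.
Proof.
move=> cF cK e0.
have /compact_near_coveringP/(_ _ _ (fun d z => forall z', ball z d z' -> `|F z' - F z| <= e)) := cK.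
move=> /(_ (0^'+) _)[z Kz|d /= d0 Hd].
  have e2 : 0 < e / 2 by rewrite divr_gt0.
  have := cF z => /cvgrPdist_lt/(_ _ e2)/nbhs_ballP[r /= r0 rF].
  exists (ball z (r / 2), [set e | e <= r / 2]) => /=.
    split; first by apply: nbhsx_ballx; rewrite divr_gt0.
    by apply: nbhs_right_le; rewrite divr_gt0.
  move=> [z' d] /= [zz' dr] w z'w.
  have zw : ball z r w.
    by rewrite [r]splitr; apply: ball_triangle zz' _; exact: le_ball z'w.
  have zz'' : ball z r z' by apply: le_ball zz'; rewrite ler_pdivrMr// ler_pMr// ler1n.
  have h1 := rF _ zw; have h2 := rF _ zz''.
  rewrite (le_trans (ler_distD (F z) _ _))// [e]splitr lerD// ltW//.
  by rewrite distrC.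
exists (d / 2); first by rewrite divr_gt0.
move=> z z' Kz; apply: (Hd (d / 2)) => //=.
- by rewrite sub0r normrN gtr0_norm ?divr_gt0// ltr_pdivrMr// ltr_pMr// ltr1n.
- by rewrite divr_gt0.
Qed.

Section lift.
Context {R : realType} {X Y : pseudoPMetricType R} {P : topologicalType}.
Hypotheses (hX : hausdorff_space X) (hY : hausdorff_space Y).
Variables (mu : P -> probability (borel X) R) (nu : P -> probability (borel Y) R).
Hypotheses (mu_wcr : weakly_continuous_radon mu) (nu_wcr : weakly_continuous_radon nu).

(* A continuous selection of plans with explicit densities: what is missing from
   a sub-plan of density [\sum_k a k * b k] is completed by a multiple of the
   product of the missing marginals. *)
Section tensor_selection.
Variables (K : Type) (ks : seq K) (c : K -> P -> R) (f : K -> X -> R) (g : K -> Y -> R).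
Hypotheses (bc : forall k, bdc (c k)) (bf : forall k, bdc (f k)) (bg : forall k, bdc (g k)).
Hypotheses (c0 : forall k t, 0 <= c k t) (f0 : forall k x, 0 <= f k x)
  (g0 : forall k y, 0 <= g k y).

Let p k t := \int[mu t]_x f k x.
Let q k t := \int[nu t]_y g k y.
(** Here [u] and [v] are the missing marginal densities themselves, not those of the sub-plan. *)
Let u t x := 1 - \sum_(k <- ks) c k t * f k x * q k t.
Let v t y := 1 - \sum_(k <- ks) c k t * p k t * g k y.
Let m t := 1 - \sum_(k <- ks) c k t * p k t * q k t.

Hypotheses (u0 : forall t x, 0 <= u t x) (v0 : forall t y, 0 <= v t y).

Let bp k : bdc (p k).
Proof.
apply: (@bdc_mean _ _ _ mu (fun r => f k r.2)) => //.
by apply: (@bdc_comp _ _ _ (f k) snd) => // r; exact: cvg_snd.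
Qed.

Let bq k : bdc (q k).
Proof.
apply: (@bdc_mean _ _ _ nu (fun r => g k r.2)) => //.
by apply: (@bdc_comp _ _ _ (g k) snd) => // r; exact: cvg_snd.
Qed.

Let bm : bdc m.
Proof.
apply: bdcB; first exact: bdc_cst.
by apply: bdc_sum => k; apply: bdcM => //; exact: bdcM.
Qed.

Let but t : bdc (u t).
Proof.
apply: bdcB; first exact: bdc_cst.
apply: bdc_sum => k; apply: bdcM; last exact: bdc_cst.
by apply: bdcM => //; exact: bdc_cst.
Qed.

Let bvt t : bdc (v t).
Proof.
apply: bdcB; first exact: bdc_cst.
by apply: bdc_sum => k; apply: bdcM => //; exact: bdc_cst.
Qed.

Let mean_u t : \int[mu t]_x u t x = m t.
Proof.
have bk k : bounded_borel (fun x => c k t * f k x * q k t).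
  by apply: bdc_borel; apply: bdcM; [apply: bdcM => //|]; exact: bdc_cst.
rewrite meanB ?mean_cst; [|exact: bounded_borel_cst|exact: bounded_borel_sum].
rewrite mean_sum//; congr (1 - _); apply: eq_bigr => k _.
rewrite -mulrA [p k t * _]mulrC mulrA -[RHS]meanZ; last exact: bdc_borel.
by apply: eq_Rintegral => x _; rewrite mulrAC.
Qed.

Let mean_v t : \int[nu t]_y v t y = m t.
Proof.
have bk k : bounded_borel (fun y => c k t * p k t * g k y).
  by apply: bdc_borel; apply: bdcM => //; exact: bdc_cst.
rewrite meanB ?mean_cst; [|exact: bounded_borel_cst|exact: bounded_borel_sum].
rewrite mean_sum//; congr (1 - _); apply: eq_bigr => k _.
by rewrite meanZ//; exact: bdc_borel.
Qed.

Let m0 t : 0 <= m t.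
Proof. by rewrite -mean_u; apply: Rintegral_ge0. Qed.

Let G t (z : X * Y) := \sum_(k <- ks) c k t * f k z.1 * g k z.2.
Let H (F : X * Y -> R) t := \int[mu t]_x \int[nu t]_y (F (x, y) * G t (x, y)).
Let W (F : X * Y -> R) t := \int[mu t]_x \int[nu t]_y (F (x, y) * (u t x * v t y)).

Let bG : bdc (fun r : P * (X * Y) => G r.1 r.2).
Proof.
apply: bdc_sum => k; apply: bdcM; first apply: bdcM.
- by apply: (@bdc_comp _ _ _ (c k) fst) => // r; exact: cvg_fst.
- apply: (@bdc_comp _ _ _ (f k) (fun r : P * (X * Y) => r.2.1)) => // r.
  by apply: (@continuous_comp _ _ _ snd fst); [exact: cvg_snd|exact: cvg_fst].
- apply: (@bdc_comp _ _ _ (g k) (fun r : P * (X * Y) => r.2.2)) => // r.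
  by apply: (@continuous_comp _ _ _ snd snd); exact: cvg_snd.
Qed.

Let buv : bdc (fun r : P * (X * Y) => u r.1 r.2.1 * v r.1 r.2.2).
Proof.
have b1 (S : topologicalType) := @bdc_cst R S 1.
have bF1 (a : P -> R) : bdc a -> bdc (fun r : P * (X * Y) => a r.1).
  by move=> ba; apply: (@bdc_comp _ _ _ a fst) => // r; exact: cvg_fst.
apply: bdcM; apply: bdcB; [exact: b1| |exact: b1|]; apply: bdc_sum => k.
- apply: bdcM; last exact: bF1; apply: bdcM; first exact: bF1.
  apply: (@bdc_comp _ _ _ (f k) (fun r : P * (X * Y) => r.2.1)) => // r.
  by apply: (@continuous_comp _ _ _ snd fst); [exact: cvg_snd|exact: cvg_fst].
- apply: bdcM; first by apply: bdcM; exact: bF1.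
  apply: (@bdc_comp _ _ _ (g k) (fun r : P * (X * Y) => r.2.2)) => // r.
  by apply: (@continuous_comp _ _ _ snd snd); exact: cvg_snd.
Qed.

Let bF2 (F : X * Y -> R) : bdc F -> bdc (fun r : P * (X * Y) => F r.2).
Proof. by move=> bF; apply: (@bdc_comp _ _ _ F snd) => // r; exact: cvg_snd. Qed.

Let bH F : bdc F -> bdc (H F).
Proof.
move=> bF; apply: (@bdc_iterated_mean _ _ _ _ hX hY _ _ mu_wcr nu_wcr
  (fun r => F r.2 * G r.1 r.2)).
by apply: bdcM => //; exact: bF2.
Qed.

Let bW F : bdc F -> bdc (W F).
Proof.
move=> bF; apply: (@bdc_iterated_mean _ _ _ _ hX hY _ _ mu_wcr nu_wcr
  (fun r => F r.2 * (u r.1 r.2.1 * v r.1 r.2.2))).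
by apply: bdcM => //; exact: bF2.
Qed.

Let bdc_slice t (F : P * (X * Y) -> R) : bdc F -> bounded_borel (fun z => F (t, z)).
Proof.
move=> bF; apply: bdc_borel; apply: (@bdc_comp _ _ _ F (fun z => (t, z))) => //.
move=> z; apply: (@cvg_pair _ _ _ _ (nbhs t) (nbhs z) _ _ _ (fun=> t) id) => //.
exact: cvg_cst.
Qed.

(** Both missing marginals have mass [m t], so this numerator is of second order in [m t], and its
    quotient by [m t] is still of first order. *)
Let W_le F M t : bdc F -> (forall z, `|F z| <= M) -> `|W F t| <= M * m t * m t.
Proof.
move=> bF FM; have M0 : 0 <= M by apply: le_trans (FM (point, point)).
have bFW := bdc_slice t (bdcM (bF2 bF) buv).
apply: le_trans (norm_mean_le _ _) _; first exact: bounded_borel_mean_section bFW.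
rewrite -{1}(mean_u t) -!mulrA [_ * (m t)]mulrC mulrA -[leRHS]meanZ; last exact: bdc_borel.
apply: le_mean.
- apply: bounded_borel_norm; exact: bounded_borel_mean_section bFW.
- by apply: bounded_borelM; [exact: bounded_borel_cst|exact: bdc_borel].
move=> x; have bFWx := bounded_borel_section x bFW.
apply: le_trans (norm_mean_le _ bFWx) _.
rewrite mulrAC -(mean_v t) -meanZ; last exact: bdc_borel.
apply: le_mean.
- exact: bounded_borel_norm.
- by apply: bounded_borelM; [exact: bounded_borel_cst|exact: bdc_borel].
move=> y /=; rewrite normrM [`|_ * v t y|]ger0_norm; last exact: mulr_ge0.
by rewrite -mulrA ler_wpM2r// mulr_ge0.
Qed.

Lemma tensor_selection : exists s : P -> probability (borel (X * Y)%type) R,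
  [/\ forall t, plans (mu t) (nu t) (s t),
    forall F, bdc F -> continuous (fun t => \int[s t]_z F z) &
    forall t F M, bdc F -> (forall z, `|F z| <= M) ->
      `|\int[s t]_z F z - H F t| <= M * m t].
Proof.
have /choice[s Hs] t : exists Q, plans (mu t) (nu t) Q /\ forall F, bdc F ->
    \int[Q]_z F z = H F t + W F t * (m t)^-1.
  have [||||x|y|Q pQ QF] := @tensor_plan R X Y (mu t) (nu t) K ks
      (fun k x => c k t * f k x) g.
  - by move=> k; apply: bdc_borel; apply: bdcM => //; exact: bdc_cst.
  - by move=> k; exact: bdc_borel.
  - by move=> k x; rewrite mulr_ge0.
  - by [].
  - by have := u0 t x; rewrite subr_ge0.
  - have := v0 t y; rewrite subr_ge0; apply: le_trans.
    apply: ler_sum => k _; rewrite meanZ//; exact: bdc_borel.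
  exists Q; split=> // F bF; rewrite QF; last exact: bdc_borel.
  have bFG := bdc_slice t (bdcM (bF2 bF) bG).
  have bFW := bdc_slice t (bdcM (bF2 bF) buv).
  have bm1 (Z : ptopologicalType) := bounded_borel_cst (Z := Z) (m t)^-1.
  have bsG := bounded_borel_mean_section (nu t) bFG.
  have bsW := bounded_borel_mean_section (nu t) bFW.
  rewrite /H /W [X in _ = _ + X]mulrC -[X in _ = _ + X](meanZ (mu t) (m t)^-1 bsW).
  rewrite -[RHS](meanD (mu t) bsG (bounded_borelM (bm1 _) bsW)).
  apply: eq_Rintegral => x _.
  have bFGx := bounded_borel_section x bFG.
  have bFWx := bounded_borel_section x bFW.
  rewrite -[X in _ = _ + X](meanZ (nu t) (m t)^-1 bFWx).
  rewrite -[RHS](meanD (nu t) bFGx (bounded_borelM (bm1 _) bFWx)).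
  apply: eq_Rintegral => y _.
  have -> : 1 - \sum_(k <- ks) \int[mu t]_x (c k t * f k x) * g k y = v t y.
    by congr (1 - _); apply: eq_bigr => k _; rewrite meanZ//; exact: bdc_borel.
  have -> : 1 - \sum_(k <- ks) \int[mu t]_x (c k t * f k x) * \int[nu t]_y g k y = m t.
    by congr (1 - _); apply: eq_bigr => k _; rewrite meanZ//; exact: bdc_borel.
  by rewrite mulrDr; congr (_ + _); rewrite -/(u t x); move: (m t)^-1 => mi /=; ring.
have m1 t : m t <= 1.
  rewrite lerBlDr lerDl; apply: sumr_ge0 => k _; rewrite !mulr_ge0//.
  - by apply: Rintegral_ge0 => x _; exact: f0.
  - by apply: Rintegral_ge0 => y _; exact: g0.
have Wm F M t : bdc F -> (forall z, `|F z| <= M) -> `|W F t * (m t)^-1| <= M * m t.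
  move=> bF FM; have [mt0|mt0] := eqVneq (m t) 0.
    by rewrite mt0 invr0 !mulr0 normr0.
  have mt : 0 < m t by rewrite lt_neqAle eq_sym mt0 m0.
  by rewrite normrM [`|_^-1|]ger0_norm ?invr_ge0// ler_pdivrMr//; exact: W_le.
exists s; split.
- by move=> t; case: (Hs t).
- move=> F bF; have [M FM] := bF.2.
  have -> : (fun t => \int[s t]_z F z) = (fun t => H F t + W F t * (m t)^-1).
    by apply/funext => t; rewrite (Hs t).2.
  move=> t; apply: cvgD; first exact: (bH bF).1.
  (* Where [m] is nonzero, this is a quotient of continuous functions. Where it vanishes, the
     quotient is zero by the convention for inverses, and nearby it is bounded by [M * m], which
     tends to zero. *)
  have [mt0|mt0] := eqVneq (m t) 0; last first.
    by apply: cvgM; [exact: (bW bF).1|apply: cvgV => //; exact: bm.1].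
  rewrite mt0 invr0 mulr0; apply/cvgr0Pnorm_le => e e0.
  have : (fun t' => M * m t') @ t --> 0.
    by rewrite -[X in _ --> X](mulr0 M) -mt0; apply: cvgMr; exact: bm.1.
  move=> /cvgr0Pnorm_le/(_ e e0); apply: filterS => t' Me.
  by rewrite (le_trans (Wm _ _ _ bF FM))// (le_trans (ler_norm _)).
- by move=> t F M bF FM; rewrite (Hs t).2// addrC addKr; exact: Wm.
Qed.

End tensor_selection.

Lemma ratio_le1 (x y : R) : 0 <= x -> x <= y -> x / y <= 1.
Proof.
move=> x0 xy; have [->|y0] := eqVneq y 0; first by rewrite invr0 mulr0.
have yp : 0 < y by rewrite lt_neqAle eq_sym y0 (le_trans x0).
by rewrite ler_pdivrMr// mul1r.
Qed.

Lemma radon_compact (Z : pseudoPMetricType R) (rho : probability (borel Z) R) (d : R) :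
  hausdorff_space Z -> radon_probability rho -> 0 < d ->
  exists2 K, compact K & 1 - d <= pr rho K.
Proof.
move=> hZ rr d0; have [K [cK _ KT]] := rr setT measurableT d d0.
have mK : measurable (K : set (borel Z)) by apply: closed_borel; exact: compact_closed.
exists K => //; rewrite lerBlDl -lerBlDr -prC// -lee_fin EFin_pr; last exact: measurableC.
by apply: ltW; move: KT; rewrite setTD.
Qed.

Section plan_selection.
Variables (t0 : P) (sigma0 : probability (borel (X * Y)%type) R).
Hypothesis sigma0_plan : plans (mu t0) (nu t0) sigma0.
Variables (s : seq X) (r : seq Y) (f : X -> X -> R) (g : Y -> Y -> R).
Hypotheses (bf : forall x, bdc (f x)) (bg : forall y, bdc (g y)).
Hypotheses (f0 : forall x z, 0 <= f x z) (g0 : forall y z, 0 <= g y z).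
Hypotheses (f1 : forall z, \sum_(x <- s) f x z <= 1)
  (g1 : forall z, \sum_(y <- r) g y z <= 1).

Let p x t := \int[mu t]_z f x z.
Let q y t := \int[nu t]_z g y z.
Let phi (k : X * Y) (z : X * Y) := f k.1 z.1 * g k.2 z.2.
Let w k := \int[sigma0]_z phi k z.
(** At [t0] the maxima are the marginal masses of the cell, so the tensor piece receives the mass
    [w k] that [sigma0] gives to the cell. For other [t] the maxima keep the denominator above its
    value at [t0], whence continuity of [c], and above the marginal masses at [t], whence marginals
    below [mu t] and [nu t]. *)
Let c (k : X * Y) t :=
  w k / (Num.max (p k.1 t) (p k.1 t0) * Num.max (q k.2 t) (q k.2 t0)).
Let ks := [seq (x, y) | x <- s, y <- r].

Let bp x : bdc (p x).
Proof.
apply: (@bdc_mean _ _ _ mu (fun r => f x r.2)) => //.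
by apply: (@bdc_comp _ _ _ (f x) snd) => // ?; exact: cvg_snd.
Qed.

Let bq y : bdc (q y).
Proof.
apply: (@bdc_mean _ _ _ nu (fun r => g y r.2)) => //.
by apply: (@bdc_comp _ _ _ (g y) snd) => // ?; exact: cvg_snd.
Qed.

Let p0 x t : 0 <= p x t. Proof. by apply: Rintegral_ge0. Qed.
Let q0 y t : 0 <= q y t. Proof. by apply: Rintegral_ge0. Qed.

Let bf1 x : bdc (fun z : X * Y => f x z.1).
Proof. by apply: (@bdc_comp _ _ _ (f x) fst) => // ?; exact: cvg_fst. Qed.

Let bg2 y : bdc (fun z : X * Y => g y z.2).
Proof. by apply: (@bdc_comp _ _ _ (g y) snd) => // ?; exact: cvg_snd. Qed.

Let bphi k : bdc (phi k). Proof. exact: bdcM. Qed.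

Let phi0 k z : 0 <= phi k z. Proof. exact: mulr_ge0. Qed.

Let w0 k : 0 <= w k. Proof. by apply: Rintegral_ge0. Qed.

Let mean_f x : \int[sigma0]_z f x z.1 = p x t0.
Proof. exact: (mean_image continuous_fst (plans_image1 sigma0_plan) (bdc_borel (bf x))). Qed.

Let mean_g y : \int[sigma0]_z g y z.2 = q y t0.
Proof. exact: (mean_image continuous_snd (plans_image2 sigma0_plan) (bdc_borel (bg y))). Qed.

Let sum_ks (F : X * Y -> R) :
  \sum_(k <- ks) F k = \sum_(x <- s) \sum_(y <- r) F (x, y).
Proof. by rewrite big_allpairs. Qed.

Let w_sumr x : \sum_(y <- r) w (x, y) <= p x t0.
Proof.
have bs : bdc (fun z : X * Y => \sum_(y <- r) g y z.2) by exact: bdc_sum.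
rewrite -mean_sum => [|y]; last exact: bdc_borel.
rewrite -mean_f; apply: le_mean.
- by apply: bdc_borel; apply: bdc_sum => y; exact: bphi.
- exact: bdc_borel.
- by move=> z; rewrite /phi/= -mulr_sumr ler_piMr.
Qed.

Let w_suml y : \sum_(x <- s) w (x, y) <= q y t0.
Proof.
rewrite -mean_sum => [|x]; last exact: bdc_borel.
rewrite -mean_g; apply: le_mean.
- by apply: bdc_borel; apply: bdc_sum => x; exact: bphi.
- exact: bdc_borel.
- by move=> z; rewrite /phi/= -mulr_suml ler_piMl.
Qed.

(** The cell mass is at most a multiple of the marginal mass, so a zero denominator in [c] at [t0]
    comes with a zero numerator. *)
Let w_p0 k : p k.1 t0 = 0 -> w k = 0.
Proof.
move=> pk0; have [M gM] := (bg k.2).2; apply/eqP; rewrite eq_le w0 andbT.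
rewrite -[leRHS](mulr0 M) -pk0 -mean_f -meanZ; last exact: bdc_borel.
apply: le_mean; [exact: bdc_borel|by apply: bdc_borel; apply: bdcM => //; exact: bdc_cst|].
by move=> z; rewrite /phi mulrC ler_wpM2r// (le_trans (ler_norm _)).
Qed.

Let w_q0 k : q k.2 t0 = 0 -> w k = 0.
Proof.
move=> qk0; have [M fM] := (bf k.1).2; apply/eqP; rewrite eq_le w0 andbT.
rewrite -[leRHS](mulr0 M) -qk0 -mean_g -meanZ; last exact: bdc_borel.
apply: le_mean; [exact: bdc_borel|by apply: bdc_borel; apply: bdcM => //; exact: bdc_cst|].
by move=> z; rewrite /phi ler_wpM2r// (le_trans (ler_norm _)).
Qed.

Let c0 k t : 0 <= c k t.
Proof. by rewrite divr_ge0// mulr_ge0// le_max ?p0 ?q0. Qed.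

Let bc k : bdc (c k).
Proof.
have [wk|wk] := eqVneq (w k) 0.
  rewrite (_ : c k = fun=> 0); first exact: bdc_cst.
  by apply/funext => t; rewrite /c wk mul0r.
have pk : 0 < p k.1 t0.
  by rewrite lt_neqAle p0 andbT eq_sym; apply: contra_neq wk; exact: w_p0.
have qk : 0 < q k.2 t0.
  by rewrite lt_neqAle q0 andbT eq_sym; apply: contra_neq wk; exact: w_q0.
have Dge t : p k.1 t0 * q k.2 t0 <=
    Num.max (p k.1 t) (p k.1 t0) * Num.max (q k.2 t) (q k.2 t0).
  by apply: ler_pM; rewrite ?p0 ?q0// le_max lexx orbT.
have D0 t : 0 < Num.max (p k.1 t) (p k.1 t0) * Num.max (q k.2 t) (q k.2 t0).
  by apply: lt_le_trans (Dge t); exact: mulr_gt0.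
split.
  move=> t; apply: cvgM; first exact: cvg_cst.
  apply: cvgV; first by rewrite gt_eqF.
  apply: cvgM.
    exact: (continuous_max ((bp k.1).1 t) (@cvg_cst _ _ _ _ _)).
  exact: (continuous_max ((bq k.2).1 t) (@cvg_cst _ _ _ _ _)).
exists (w k / (p k.1 t0 * q k.2 t0)) => t; rewrite ger0_norm//.
by rewrite ler_wpM2l// lef_pV2// posrE// mulr_gt0.
Qed.

Let cq k t : c k t * q k.2 t <= w k / Num.max (p k.1 t) (p k.1 t0).
Proof.
rewrite /c invfM mulrA -mulrA ler_piMr//.
  by rewrite divr_ge0// le_max p0.
by rewrite mulrC ratio_le1// le_max lexx.
Qed.

Let cp k t : c k t * p k.1 t <= w k / Num.max (q k.2 t) (q k.2 t0).
Proof.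
rewrite /c invfM [_^-1 * _^-1]mulrC mulrA -mulrA ler_piMr//.
  by rewrite divr_ge0// le_max q0.
by rewrite mulrC ratio_le1// le_max lexx.
Qed.

(** The quotient of [q k.2 t] by its maximum is at most one. The masses [w] of a row add up to at
    most [p x' t0], hence to at most the other maximum. What remains is the sum of the [f x']. *)
Let u0 t x : 0 <= 1 - \sum_(k <- ks) c k t * f k.1 x * q k.2 t.
Proof.
rewrite subr_ge0 sum_ks; apply: le_trans (f1 x); apply: ler_sum => x' _.
under eq_bigr do rewrite /= mulrAC.
rewrite -mulr_suml ler_piMl//.
apply: (@le_trans _ _ (\sum_(y <- r) w (x', y) / Num.max (p x' t) (p x' t0))).
  by apply: ler_sum => y _; exact: (cq (x', y)).
rewrite -mulr_suml ratio_le1//; first by apply: sumr_ge0.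
by rewrite (le_trans (w_sumr x'))// le_max lexx orbT.
Qed.

Let v0 t y : 0 <= 1 - \sum_(k <- ks) c k t * p k.1 t * g k.2 y.
Proof.
rewrite subr_ge0 sum_ks exchange_big/=; apply: le_trans (g1 y); apply: ler_sum => y' _.
rewrite -mulr_suml ler_piMl//.
apply: (@le_trans _ _ (\sum_(x <- s) w (x, y') / Num.max (q y' t) (q y' t0))).
  by apply: ler_sum => x _; exact: (cp (x, y')).
rewrite -mulr_suml ratio_le1//; first by apply: sumr_ge0.
by rewrite (le_trans (w_suml y'))// le_max lexx orbT.
Qed.

Let cpq k : c k t0 * p k.1 t0 * q k.2 t0 = w k.
Proof.
rewrite /c !maxxx; have [wk|wk] := eqVneq (w k) 0; first by rewrite wk !mul0r.
have pk : p k.1 t0 != 0 by apply: contra_neq wk; exact: w_p0.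
have qk : q k.2 t0 != 0 by apply: contra_neq wk; exact: w_q0.
by rewrite -mulrA divfK// mulf_neq0.
Qed.

Variables (F : X * Y -> R) (M e : R).
Hypotheses (bF : bdc F) (FM : forall z, `|F z| <= M).
Hypothesis osc : forall k z, k \in ks -> phi k z != 0 -> `|F z - F k| <= e.

(** This is used both for [sigma0] and for the product of the marginals at [t0], which are compared
    through the values [F k] at the base points of the cells. *)
Let osc_mean (Q : probability (borel (X * Y)%type) R) k : k \in ks ->
  `|\int[Q]_z (F z * phi k z) - F k * \int[Q]_z phi k z| <= e * \int[Q]_z phi k z.
Proof.
move=> kks; have bFk : bdc (fun z => F k * phi k z) by apply: bdcM => //; exact: bdc_cst.
have bek : bdc (fun z => e * phi k z) by apply: bdcM => //; exact: bdc_cst.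
have bFp : bdc (fun z => F z * phi k z) by exact: bdcM.
rewrite -!meanZ; [|exact: bdc_borel..]; rewrite -meanB; [|exact: bdc_borel..].
apply: le_trans (norm_mean_le _ _) _; first by apply: bdc_borel; exact: bdcB.
apply: le_mean; [|exact: bdc_borel|].
  by apply: bounded_borel_norm; apply: bdc_borel; exact: bdcB.
move=> z; rewrite -mulrBl normrM [`|phi k z|]ger0_norm//.
have [->|pz] := eqVneq (phi k z) 0; first by rewrite !mulr0.
by rewrite ler_wpM2r//; exact: osc.
Qed.

(** The error has two oscillations inside cells, one for the tensor pieces and one for [sigma0], and
    two contributions of the mass not caught by the cells, one from the completion and one from
    [sigma0]. *)
Lemma plan_selection_tensor : exists S : P -> probability (borel (X * Y)%type) R,
  [/\ forall t, plans (mu t) (nu t) (S t),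
    forall F, bdc F -> continuous (fun t => \int[S t]_z F z) &
    `|\int[S t0]_z F z - \int[sigma0]_z F z| <=
      2 * e * \sum_(k <- ks) w k + 2 * M * (1 - \sum_(k <- ks) w k)].
Proof.
have [S [Sp Sc SF]] := @tensor_selection _ ks c (fun k => f k.1) (fun k => g k.2)
  bc (fun k => bf k.1) (fun k => bg k.2) c0 (fun k => f0 k.1) (fun k => g0 k.2) u0 v0.
exists S; split => //.
have {SF} := SF t0 F M bF FM.
(* [N] is the product of the marginals at [t0], obtained from the constant density one. *)
have [N NE] : exists N : probability (borel (X * Y)%type) R, forall G, bdc G ->
    \int[N]_z G z = \int[mu t0]_x \int[nu t0]_y G (x, y).
  have [|||N NE] := @product_density R X Y (mu t0) (nu t0) (fun=> 1).
  - exact: bounded_borel_cst.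
  - by [].
  - by rewrite -[RHS](mean_cst (mu t0)); apply: eq_Rintegral => x _; rewrite mean_cst.
  exists N => G bG; rewrite NE; last exact: bdc_borel.
  by apply: eq_Rintegral => x _; apply: eq_Rintegral => y _; rewrite mulr1.
have Nphi k : \int[N]_z phi k z = p k.1 t0 * q k.2 t0.
  rewrite NE//= mulrC -meanZ; last exact: bdc_borel.
  apply: eq_Rintegral => x _; rewrite mulrC -meanZ//; exact: bdc_borel.
have bFp k : bdc (fun z => F z * phi k z) by exact: bdcM.
have bcFp k : bdc (fun z => c k t0 * (F z * phi k z)) by apply: bdcM => //; exact: bdc_cst.
set HF := (X in `|_ - X|); have -> : HF = \sum_(k <- ks) c k t0 * \int[N]_z (F z * phi k z).
  transitivity (\int[N]_z (\sum_(k <- ks) c k t0 * (F z * phi k z))).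
    rewrite NE; last exact: bdc_sum.
    apply: eq_Rintegral => x _; apply: eq_Rintegral => y _.
    by rewrite mulr_sumr; apply: eq_bigr => k _; rewrite /phi/=; ring.
  rewrite mean_sum => [|k]; last exact: bdc_borel.
  by apply: eq_bigr => k _; rewrite meanZ//; exact: bdc_borel.
have -> : \sum_(k <- ks) c k t0 * \int[mu t0]_x f k.1 x * \int[nu t0]_y g k.2 y =
    \sum_(k <- ks) w k by apply: eq_bigr => k _; exact: cpq.
set A := \sum_(k <- ks) _; set w_ := \sum_(k <- ks) w k; set B := \sum_(k <- ks) F k * w k.
move=> h1; have h2 : `|A - B| <= e * w_.
  rewrite -sumrB (le_trans (ler_norm_sum _ _ _))// mulr_sumr.
  rewrite big_seq [leRHS]big_seq; apply: ler_sum => k kks.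
  rewrite -cpq -mulrA -Nphi.
  rewrite [F k * _]mulrCA -mulrBr normrM ger0_norm// [e * _]mulrCA ler_wpM2l//.
  exact: osc_mean.
have bsp : bdc (fun z => \sum_(k <- ks) phi k z) by exact: bdc_sum.
have h3 : `|\int[sigma0]_z (F z * \sum_(k <- ks) phi k z) - B| <= e * w_.
  have -> : \int[sigma0]_z (F z * \sum_(k <- ks) phi k z) =
      \sum_(k <- ks) \int[sigma0]_z (F z * phi k z).
    rewrite -mean_sum => [|k]; last exact: bdc_borel.
    by apply: eq_Rintegral => z _; rewrite mulr_sumr.
  rewrite -sumrB (le_trans (ler_norm_sum _ _ _))// mulr_sumr.
  by rewrite big_seq [leRHS]big_seq; apply: ler_sum => k kks; exact: osc_mean.
have sum_phi z : \sum_(k <- ks) phi k z = (\sum_(x <- s) f x z.1) * \sum_(y <- r) g y z.2.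
  rewrite sum_ks mulr_suml; apply: eq_bigr => x _.
  by rewrite mulr_sumr.
have sum_phi1 z : \sum_(k <- ks) phi k z <= 1.
  by rewrite sum_phi mulr_ile1// sumr_ge0.
have h4 : `|\int[sigma0]_z F z - \int[sigma0]_z (F z * \sum_(k <- ks) phi k z)| <=
    M * (1 - w_).
  have b1s : bdc (fun z => 1 - \sum_(k <- ks) phi k z) by apply: bdcB => //; exact: bdc_cst.
  have -> : w_ = \int[sigma0]_z (\sum_(k <- ks) phi k z).
    by rewrite mean_sum// => k; exact: bdc_borel.
  have -> : 1 - \int[sigma0]_z (\sum_(k <- ks) phi k z) =
      \int[sigma0]_z (1 - \sum_(k <- ks) phi k z).
    rewrite meanB ?mean_cst//; [exact: bounded_borel_cst|exact: bdc_borel].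
  rewrite -[leRHS](meanZ sigma0 M (bdc_borel b1s)).
  have bFs1 : bdc (fun z => F z * \sum_(k <- ks) phi k z) by exact: bdcM.
  rewrite -(meanB sigma0 (bdc_borel bF) (bdc_borel bFs1)).
  have bFs : bdc (fun z => F z - F z * \sum_(k <- ks) phi k z) by apply: bdcB => //; exact: bdcM.
  apply: le_trans (norm_mean_le _ (bdc_borel bFs)) _.
  apply: le_mean.
  - by apply: bounded_borel_norm; exact: bdc_borel.
  - by apply: bdc_borel; apply: bdcM => //; exact: bdc_cst.
  move=> z; rewrite -{1}[F z]mulr1 -mulrBr normrM [`|1 - _|]ger0_norm ?subr_ge0//.
  by rewrite ler_wpM2r// subr_ge0.
move: h1 h2 h3 h4.
move: A B w_ (\int[sigma0]_z (F z * _)) (\int[sigma0]_z F z) (\int[S t0]_z F z).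
move=> A B w_ C D E; rewrite !ler_norml => /andP[? ?] /andP[? ?] /andP[? ?] /andP[? ?].
by apply/andP; split; lra.
Qed.

End plan_selection.

Theorem plan_selection (t0 : P) (sigma0 : probability (borel (X * Y)%type) R)
    (F : X * Y -> R) (e : R) :
  plans (mu t0) (nu t0) sigma0 -> bdc F -> 0 < e ->
  exists S : P -> probability (borel (X * Y)%type) R,
  [/\ forall t, plans (mu t) (nu t) (S t),
    forall F, bdc F -> continuous (fun t => \int[S t]_z F z) &
    `|\int[S t0]_z F z - \int[sigma0]_z F z| <= e].
Proof.
move=> sp bF e0; have [M FM] := bF.2.
have M0 : 0 <= M by apply: le_trans (FM (point, point)).
(* [sigma0] will have mass at most [2 * d] outside the rectangle of [K] and [L]. The total error is
   then at most [2 * (e / 4) + 2 * M * (2 * d)], hence at most [e]. *)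
pose d := e / (8 * (M + 1)).
have d0 : 0 < d by rewrite divr_gt0// mulr_gt0// ltr_wpDl.
have [K cK muK] := radon_compact hX (mu_wcr.1 t0) d0.
have [L cL nuL] := radon_compact hY (nu_wcr.1 t0) d0.
have e4 : 0 < e / 4 by rewrite divr_gt0.
have [h h0 osc] := compact_oscillation bF.1 (compact_setX cK cL) e4.
have [s [f [sK bf f0 [f1 fK] fh]]] := compact_partition hX cK h0.
have [r [g [rL bg g0 [g1 gL] gh]]] := compact_partition hY cL h0.
have [|S [Sp Sc SF]] := @plan_selection_tensor t0 sigma0 sp s r f g bf bg f0 g0 f1 g1
  F M (e / 4) bF FM.
  move=> [x y] [x' y'] /allpairsP[[x1 y1]]/= [xs yr [-> ->]] fg; apply: osc.
    by split; [exact: sK|exact: rL].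
  by split; [apply: fh|apply: gh]; apply: contra_neq fg => /= ->; rewrite ?mul0r ?mulr0.
exists S; split => //; apply: (le_trans SF).
set w := \sum_(k <- _) _.
have mK : measurable (K : set (borel X)) by apply: closed_borel; exact: compact_closed.
have mL : measurable (L : set (borel Y)) by apply: closed_borel; exact: compact_closed.
have bphi k : bdc (fun z : X * Y => f k.1 z.1 * g k.2 z.2).
  apply: bdcM.
    by apply: (@bdc_comp _ _ _ (f k.1) fst) => // ?; exact: cvg_fst.
  by apply: (@bdc_comp _ _ _ (g k.2) snd) => // ?; exact: cvg_snd.
have bphis : bounded_borel (fun z : X * Y => \sum_(k <- [seq (x, y) | x <- s, y <- r])
    f k.1 z.1 * g k.2 z.2) by apply: bdc_borel; exact: bdc_sum.
have sum_phi z : \sum_(k <- [seq (x, y) | x <- s, y <- r]) f k.1 z.1 * g k.2 z.2 =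
    (\sum_(x <- s) f x z.1) * \sum_(y <- r) g y z.2.
  rewrite big_allpairs mulr_suml; apply: eq_bigr => x _.
  by rewrite mulr_sumr.
have wE : w = \int[sigma0]_z \sum_(k <- [seq (x, y) | x <- s, y <- r]) f k.1 z.1 * g k.2 z.2.
  by rewrite mean_sum// => k; exact: bdc_borel.
have w1 : w <= 1.
  rewrite wE -[leRHS](mean_cst sigma0); apply: le_mean => //; first exact: bounded_borel_cst.
  by move=> z; rewrite sum_phi mulr_ile1// sumr_ge0.
have wd : 1 - 2 * d <= w.
  apply: (@le_trans _ _ (pr sigma0 (K `*` L))).
    have := plans_rect_ge sp mK mL; lra.
  have mKL := measurable_rect_borel mK mL.
  rewrite wE -pr_mean//; apply: le_mean => //; first exact: bounded_borel_indic.
  move=> z; rewrite sum_phi indicE; have [/set_mem[Kz Lz]|_] := boolP (z \in _).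
    by rewrite fK// gL// mulr1.
  by rewrite mulr_ge0// sumr_ge0.
have Md : M * d <= e / 8.
  rewrite /d mulrA ler_pdivrMr; last by rewrite mulr_gt0// ltr_wpDl.
  have -> : e / 8 * (8 * (M + 1)) = e * (M + 1) by field.
  by rewrite mulrC ler_wpM2l ?(ltW e0)// lerDl.
have : M * (1 - w) <= M * (2 * d) by rewrite ler_wpM2l// lerBlDr -lerBlDl; lra.
have : e / 4 * w <= e / 4 by rewrite ler_piMr// ltW.
lra.
Qed.

End lift.
(** * The Kantorovich cost *)

(** The trace of the neighbourhood filter on the complement of [B] is proper, hence contained in an
    ultrafilter. This turns statements about neighbourhoods into contradictions with limits of
    plans. *)
Lemma ultrafilter_avoiding (T : topologicalType) (t : T) (B : set T) :
  ~ nbhs t B -> exists U, [/\ UltraFilter U, U --> t & U (~` B)].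
Proof.
move=> nB; pose G : set_system T := [set A | nbhs t (fun s => ~ B s -> A s)].
have FG : ProperFilter G.
  apply: Build_ProperFilter_ex => [A GA|].
    apply: contrapT => nA; apply: nB.
    have : \forall s \near t, ~ B s -> A s := GA.
    apply: filterS => s h.
    by apply: contrapT => nBs; apply: nA; exists s; exact: h.
  split.
  - exact: nearW.
  - move=> A C GA GC; have GA' : \forall s \near t, ~ B s -> A s := GA.
    have GC' : \forall s \near t, ~ B s -> C s := GC.
    by apply: filterS2 GA' GC' => s hA hC nBs; split; [exact: hA|exact: hC].
  - move=> A C AC GA; have : \forall s \near t, ~ B s -> A s := GA.
    by apply: filterS => s h nBs; exact/AC/h.
have [U [UU GU]] := ultraFilterLemma FG.
exists U; split => //.
- by move=> A tA; apply: GU; apply: filterS tA.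
- by apply: GU; apply: nearW => s.
Qed.

Section costs.
Context {R : realType} {X Y : pseudoPMetricType R} {T : topologicalType}.
Hypotheses (hX : hausdorff_space X) (hY : hausdorff_space Y).
Variables (mu : T -> probability (borel X) R) (nu : T -> probability (borel Y) R).
Hypotheses (mu_wcr : weakly_continuous_radon mu) (nu_wcr : weakly_continuous_radon nu).
Variable h : T -> X -> Y -> R.
Hypothesis h_cont : continuous (fun p : T * X * Y => h p.1.1 p.1.2 p.2).
Hypothesis h_ge0 : forall t x y, 0 <= h t x y.
Variables (a : T -> borel X -> R) (b : T -> borel Y -> R).
Hypotheses (a_ge0 : forall t x, 0 <= a t x) (b_ge0 : forall t y, 0 <= b t y).
Hypotheses (a_borel : forall t, measurable_fun setT (a t))
  (b_borel : forall t, measurable_fun setT (b t)).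
Hypothesis h_le : forall t x y, h t x y <= a t x + b t y.
Hypothesis ab_unif :
  (ereal_sup [set (\int[mu t]_(x in [set x | (r <= a t x)%R]) (a t x)%:E +
                   \int[nu t]_(y in [set y | (r <= b t y)%R]) (b t y)%:E)%E
             | t in [set: T]]) @[r --> +oo%R] --> (0%E : \bar R).

Let cost t := transport_cost (h t).
Let K t := kantorovich_cost (h t) (mu t) (nu t).
Let plan t := plans (mu t) (nu t).

Let trunc N (r : T * (X * Y)) := Num.min (h r.1 r.2.1 r.2.2) N.

Let h_cont' : continuous (fun r : T * (X * Y) => h r.1 r.2.1 r.2.2).
Proof.
move=> r; apply: (@continuous_comp _ _ _
  (fun r : T * (X * Y) => (r.1, r.2.1, r.2.2)) (fun p => h p.1.1 p.1.2 p.2)).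
  apply: (@cvg_pair _ _ _ _ (nbhs (r.1, r.2.1)) (nbhs r.2.2)).
    apply: (@cvg_pair _ _ _ _ (nbhs r.1) (nbhs r.2.1)); first exact: cvg_fst.
    by apply: (@continuous_comp _ _ _ snd fst); [exact: cvg_snd|exact: cvg_fst].
  by apply: (@continuous_comp _ _ _ snd snd); exact: cvg_snd.
exact: h_cont.
Qed.

Let continuous_slice t (F : T * (X * Y) -> R) : continuous F -> continuous (fun z => F (t, z)).
Proof.
move=> cF z; apply: (@continuous_comp _ _ _ (fun z => (t, z)) F); last exact: cF.
apply: (@cvg_pair _ _ _ _ (nbhs t) (nbhs z) _ _ _ (fun=> t) id) => //.
exact: cvg_cst.
Qed.

Let h_meas t : measurable_fun setT ((fun z => (h t z.1 z.2)%:E) : borel (X * Y)%type -> \bar R).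
Proof.
apply/measurable_EFinP; apply: (@continuous_borel R (X * Y)%type).
exact: (@continuous_slice t _ h_cont').
Qed.

Let trunc_bdc N : 0 <= N -> bdc (trunc N).
Proof.
move=> N0; split.
  by move=> r; apply: (continuous_min (h_cont' (x := r)) (@cvg_cst _ _ _ _ _)).
exists N => r; rewrite ger0_norm ?ge_min ?lexx ?orbT//.
by rewrite le_min h_ge0.
Qed.

Let trunc_slice N t : 0 <= N -> bdc (fun z => trunc N (t, z)).
Proof.
move=> N0; have [cF [M FM]] := trunc_bdc N0.
by split; [exact: (@continuous_slice t _ cF)|exists M => z; exact: FM].
Qed.

Let mean_trunc_le N t (sigma : probability (borel (X * Y)%type) R) : 0 <= N ->
  ((\int[sigma]_z trunc N (t, z))%:E <= cost t sigma)%E.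
Proof.
move=> N0; rewrite EFin_mean; last exact/bdc_borel/trunc_slice.
apply: ge0_le_integral => //.
- by move=> z _; rewrite lee_fin le_min h_ge0.
- by apply/measurable_EFinP; case: (bdc_borel (trunc_slice t N0)).
- by move=> z _; rewrite lee_fin ge_min lexx.
Qed.

Let marginal_tail d (Z : measurableType d) (P : probability Z R) (f : Z -> R) (r : R) :
  (\int[P]_(z in [set z | (r <= f z)%R]) (f z)%:E =
   \int[P]_z ((f \_ [set z | (r <= f z)%R]) z)%:E)%E.
Proof. by rewrite integral_mkcond; apply: eq_integral => z _; rewrite restrict_EFin. Qed.

Let tail_meas d (Z : measurableType d) (f : Z -> R) (r : R) :
  measurable_fun setT f -> measurable_fun setT (f \_ [set z | r <= f z]).
Proof.
move=> mf; apply/measurable_restrict => //.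
  rewrite (_ : [set z | r <= f z] = setT `&` f @^-1` `[r, +oo[%classic); first exact: mf.
  by rewrite setTI; apply/seteqP; split=> z /=; rewrite in_itv/= andbT.
exact: measurable_funTS.
Qed.

(** Each tail depends on one coordinate, so its mean is the same under every plan at [t]; the bound
    is uniform in the plan as well as in [t]. *)
Lemma cost_truncation (e : R) : 0 < e -> exists2 N : R, 0 <= N &
  forall t sigma, plan t sigma ->
  (cost t sigma <= (\int[sigma]_z trunc N (t, z) + e)%:E)%E.
Proof.
move=> e0.
have oe : open [set y : \bar R | (y < e%:E)%E] by exact: open_ereal_lt_ereal.
have [r [r0 hr]] : exists r : R, 0 <= r /\ (ereal_sup
    [set (\int[mu t]_(x in [set x | (r <= a t x)%R]) (a t x)%:E +
          \int[nu t]_(y in [set y | (r <= b t y)%R]) (b t y)%:E)%E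
    | t in [set: T]] < e%:E)%E.
  have /ab_unif : nbhs (0%E : \bar R) [set y : \bar R | (y < e%:E)%E].
    by apply: open_nbhs_nbhs; split => //=; rewrite lte_fin.
  rewrite nbhs_simpl => re; near (pinfty_nbhs R) => r; exists r; split => //.
  by near: r.
(* If [h] exceeds [2 * r], the excess is at most [(a - r) + (b - r)]. Each summand is at most the
   corresponding tail, being negative where the tail is cut off. *)
exists (r + r) => [|t sigma sp]; first exact: addr_ge0.
set N := r + r; have N0 : 0 <= N by exact: addr_ge0.
pose fa x := (a t \_ [set x | (r <= a t x)%R]) x.
pose fb y := (b t \_ [set y | (r <= b t y)%R]) y.
have tailP (Z : ptopologicalType) (f : borel Z -> R) z :
    0 <= f z -> 0 <= (f \_ [set z | (r <= f z)%R]) z /\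
    f z - r <= (f \_ [set z | (r <= f z)%R]) z /\
    (r <= f z -> (f \_ [set z | (r <= f z)%R]) z = f z).
  move=> fz; rewrite patchE; case: ifPn => [zr|].
    by split => //; split => //; rewrite lerBlDr lerDl.
  by move=> /negP zr; split => //; split; rewrite ?subr_le0;
    [apply/ltW; rewrite ltNge; apply/negP => h'; apply: zr; rewrite inE|
     move=> h'; exfalso; apply: zr; rewrite inE].
have mfa : measurable_fun setT (fa : borel X -> R) by exact: tail_meas.
have mfb : measurable_fun setT (fb : borel Y -> R) by exact: tail_meas.
have fa0 x : (0 <= (fa x)%:E)%E by rewrite lee_fin; case: (tailP _ (a t) x (a_ge0 t x)).
have fb0 y : (0 <= (fb y)%:E)%E by rewrite lee_fin; case: (tailP _ (b t) y (b_ge0 t y)).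
have mt := (bdc_borel (trunc_slice t N0)).1.
have mfa1 : measurable_fun setT ((fun z => fa z.1) : borel (X * Y)%type -> R).
  exact: (measurableT_comp mfa (continuous_measurable_borel continuous_fst)).
have mfb2 : measurable_fun setT ((fun z => fb z.2) : borel (X * Y)%type -> R).
  exact: (measurableT_comp mfb (continuous_measurable_borel continuous_snd)).
apply: (@le_trans _ _ (\int[sigma]_z ((trunc N (t, z))%:E + ((fa z.1)%:E + (fb z.2)%:E)))%E).
  apply: ge0_le_integral => //.
  - by move=> z _; rewrite lee_fin.
  - apply: emeasurable_funD; first exact/measurable_EFinP.
    by apply: emeasurable_funD; exact/measurable_EFinP.
  - move=> z _; rewrite -!EFinD lee_fin /trunc/= minEle.
    have [a1 [a2 a3]] := tailP _ (a t) z.1 (a_ge0 t z.1).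
    have [b1 [b2 b3]] := tailP _ (b t) z.2 (b_ge0 t z.2).
    have := h_le t z.1 z.2; rewrite -/(fa z.1) -/(fb z.2) in a1 a2 a3 b1 b2 b3 *.
    case: ifPn => _; first by rewrite lerDl addr_ge0.
    rewrite /N; lra.
rewrite ge0_integralD//; last 4 first.
- by move=> z _; rewrite lee_fin le_min h_ge0.
- exact/measurable_EFinP.
- by move=> z _; exact: adde_ge0.
- by apply: emeasurable_funD; exact/measurable_EFinP.
rewrite -(EFin_mean _ (bdc_borel (trunc_slice t N0))) EFinD leeD2l//.
rewrite ge0_integralD//; [|exact/measurable_EFinP|exact/measurable_EFinP].
have /measurable_EFinP mfaE := mfa; have /measurable_EFinP mfbE := mfb.
rewrite (ge0_integral_image continuous_fst (plans_image1 sp) mfaE fa0).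
rewrite (ge0_integral_image continuous_snd (plans_image2 sp) mfbE fb0).
apply: le_trans (ltW hr); rewrite -!marginal_tail.
by apply: ereal_sup_ubound; exists t.
Unshelve. all: by end_near. Qed.

Lemma plans_nonempty t : exists sigma, plan t sigma.
Proof.
(* The empty sub-plan leaves all the mass missing, and its completion is the product of [mu t] and
   [nu t]. *)
have [||||||sigma sp _] := @tensor_plan R X Y (mu t) (nu t) unit [::] (fun _ _ => 0) (fun _ _ => 0).
- by move=> _; exact: bounded_borel_cst.
- by move=> _; exact: bounded_borel_cst.
- by [].
- by [].
- by move=> x; rewrite big_nil ler01.
- by move=> x; rewrite big_nil ler01.
by exists sigma.
Qed.

Lemma cost_fin_num t : K t \is a fin_num.
Proof.
have [sigma sp] := plans_nonempty t.
have [N N0 /(_ t sigma sp) sN] := cost_truncation ltr01.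
rewrite ge0_fin_numE; last first.
  apply: le_ereal_inf_tmp => _ [s _ <-]; apply: integral_ge0 => z _; rewrite lee_fin; exact: h_ge0.
apply: le_lt_trans (le_lt_trans sN (ltry _)).
by apply: ereal_inf_lbound; exists sigma.
Qed.

Lemma near_optimal t (e : R) : 0 < e ->
  exists2 sigma, plan t sigma & (cost t sigma <= K t + e%:E)%E.
Proof.
move=> e0; have [_ [sigma sp <-] se] := lb_ereal_inf_adherent e0 (cost_fin_num t).
by exists sigma => //; exact: ltW.
Qed.

Lemma cvg_mean_trunc (G : set_system T) {FG : Filter G} t0 N
    (sigma : T -> probability (borel (X * Y)%type) R) : 0 <= N -> G --> t0 ->
  (forall t, plan t (sigma t)) ->
  (\int[sigma t]_z trunc N (t, z) - \int[sigma t]_z trunc N (t0, z)) @[t --> G] --> 0.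
Proof.
move=> N0 Gt sp; have [cF [M FM]] := trunc_bdc N0.
apply: (@cvg_mean_diff _ _ _ _ FG t0 sigma (trunc N) M) => //.
- apply: (tight_along_plans _ _ _ sp).
  + apply: (tight_along_cvg (G := nbhs t0)) => //; apply: weak_tight => //; first exact: mu_wcr.1.
    by move=> f bf; exact: mu_wcr.2.
  + apply: (tight_along_cvg (G := nbhs t0)) => //; apply: weak_tight => //; first exact: nu_wcr.1.
    by move=> f bf; exact: nu_wcr.2.
- by move=> z; exact: cF.
- by move=> t; case: (trunc_slice t N0).
Qed.

(** The error of truncation is paid once, at [t0]: along [U] the truncated mean is at most the cost,
    whatever the level. *)
Lemma cost_limit (U : set_system T) {UU : UltraFilter U} t0
    (sigma : T -> probability (borel (X * Y)%type) R) : U --> t0 ->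
  (forall t, plan t (sigma t)) -> exists lambda, [/\ plan t0 lambda,
    forall F, bdc F -> \int[sigma t]_z F z @[t --> U] --> \int[lambda]_z F z &
    forall c : R, U [set t | (cost t (sigma t) <= c%:E)%E] -> (cost t0 lambda <= c%:E)%E].
Proof.
move=> Ut sp.
have [lambda [lp lc]] := plans_limit hX hY Ut (mu_wcr.1 t0) (nu_wcr.1 t0)
  (fun f bf => mu_wcr.2 f bf t0) (fun f bf => nu_wcr.2 f bf t0) sp.
exists lambda; split => // c Uc; apply/lee_addgt0Pr => e e0.
have [N N0 /(_ t0 lambda lp) lN] := cost_truncation e0.
apply: (le_trans lN); rewrite -EFinD lee_fin lerD2r.
have h1 : (\int[sigma t]_z trunc N (t, z) - \int[sigma t]_z trunc N (t0, z)
    + \int[sigma t]_z trunc N (t0, z)) @[t --> U] --> 0 + \int[lambda]_z trunc N (t0, z).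
  by apply: cvgD; [exact: cvg_mean_trunc|exact: lc _ (trunc_slice t0 N0)].
rewrite add0r in h1.
apply: cvgr_to_le h1 _.
apply: filterS Uc => t /= ct; rewrite subrK -lee_fin.
exact: le_trans (mean_trunc_le _ _ N0) ct.
Qed.

Lemma cost_selection t0 (e : R) : 0 < e ->
  exists S : T -> probability (borel (X * Y)%type) R, [/\ forall t, plan t (S t),
    forall F, bdc F -> continuous (fun t => \int[S t]_z F z) &
    \forall t \near t0, (cost t (S t) <= K t0 + e%:E)%E].
Proof.
(* Five errors of [e / 5]: near optimality of [sigma], the selection at [t0], its continuity in [t],
   the variation of the truncated cost with [t], and the truncation. *)
move=> e0; have d0 : 0 < e / 5 by rewrite divr_gt0.
have [N N0 costN] := cost_truncation d0.
have [sigma sp se] := near_optimal t0 d0.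
have [S [Sp Sc Ss]] := plan_selection hX hY mu_wcr nu_wcr sp (trunc_slice t0 N0) d0.
exists S; split => //.
have /cvgrPdist_lt n1 := Sc _ (trunc_slice t0 N0) t0.
have /cvgr0Pnorm_lt n2 : (\int[S t]_z trunc N (t, z) - \int[S t]_z trunc N (t0, z))
    @[t --> t0] --> 0 by exact: cvg_mean_trunc.
have h0 := mean_trunc_le t0 sigma N0.
near=> t; have h1 := costN t (S t) (Sp t).
have h2 : `|\int[S t0]_z trunc N (t0, z) - \int[S t]_z trunc N (t0, z)| < e / 5.
  by near: t; exact: n1.
have h3 : `|\int[S t]_z trunc N (t, z) - \int[S t]_z trunc N (t0, z)| < e / 5.
  by near: t; exact: n2.
apply: (le_trans h1); have := le_trans h0 se.
rewrite -(fineK (cost_fin_num t0)) -!EFinD !lee_fin => h4.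
move: h2 h3 Ss; rewrite !ltr_norml ler_norml => /andP[? ?] /andP[? ?] /andP[? ?].
lra.
Unshelve. all: by end_near. Qed.

(** If the inequality fails along an ultrafilter, plans that are [e / 2]-optimal cost at most
    [K t0 - e / 2] there, and so does their limit, a plan at [t0]. *)
Lemma cost_lower_semicontinuous t0 (e : R) : 0 < e ->
  \forall t \near t0, (K t0 <= K t + e%:E)%E.
Proof.
move=> e0; apply: contrapT => /ultrafilter_avoiding[U [UU Ut UB]].
have e2 : 0 < e / 2 by rewrite divr_gt0.
have /choice[sigma sigmaP] t : exists s, plan t s /\ (cost t s <= K t + (e / 2)%:E)%E.
  by have [s] := near_optimal t e2; exists s.
have [lambda [lp _ lc]] := cost_limit Ut (fun t => (sigmaP t).1).
have /lc : U [set t | (cost t (sigma t) <= (fine (K t0) - e / 2)%:E)%E].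
  apply: filterS UB => t /negP; rewrite -ltNge => Kt; apply: (le_trans (sigmaP t).2).
  move: Kt; rewrite -(fineK (cost_fin_num t0)) -(fineK (cost_fin_num t)) -!EFinD.
  by rewrite lte_fin lee_fin/=; lra.
have : (K t0 <= cost t0 lambda)%E by apply: ereal_inf_lbound; exists lambda.
move=> h1 /(le_trans h1); rewrite -(fineK (cost_fin_num t0)) lee_fin/=; lra.
Qed.

Lemma optimal_plan_continuous (sigma : T -> probability (borel (X * Y)%type) R) :
  (forall t, unique_optimal_plan (h t) (mu t) (nu t) (sigma t)) ->
  forall F, bdc F -> continuous (fun t => \int[sigma t]_z F z).
Proof.
move=> so F bF t0 A nA; apply: contrapT => /ultrafilter_avoiding[U [UU Ut UB]].
have [lambda [lp lF lc]] := cost_limit Ut (fun t => (so t).1.1).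
have lopt : optimal_plan (h t0) (mu t0) (nu t0) lambda.
  split=> //; apply/eqP; rewrite eq_le; apply/andP; split; last first.
    by apply: ereal_inf_lbound; exists lambda.
  apply/lee_addgt0Pr => e e0; rewrite -/(K t0) -(fineK (cost_fin_num t0)) -EFinD.
  (* Near [t0] the optimal cost is at most [K t0 + e], because it is at most the cost of a selection
     that is nearly optimal at [t0]. *)
  apply: lc; have [S [Sp _ SK]] := cost_selection t0 e0.
  apply: Ut; apply: filterS SK => t /= SK; rewrite /cost (so t).1.2 EFinD fineK ?cost_fin_num//.
  by apply: (le_trans _ SK); apply: ereal_inf_lbound; exists (S t); first exact: Sp.
have FE : \int[lambda]_z F z = \int[sigma t0]_z F z.
  rewrite /Rintegral; congr fine; apply: eq_measure_integral => B mB _.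
  exact: (so t0).2 lopt B mB.
have UA : U ((fun t => \int[sigma t]_z F z) @^-1` A).
  by apply: (lF F bF); rewrite FE.
by have [t []] := filter_ex (filterI UA UB).
Qed.

(** One half of [e] is spent on each semicontinuity. *)
Lemma local_eps_selection (t0 : T) (e : R) : 0 < e ->
  exists S : T -> probability (borel (X * Y)%type) R, [/\ forall t, plan t (S t),
    forall F, bdc F -> continuous (fun t => \int[S t]_z F z) &
    \forall t \near t0, eps_optimal_plan e (h t) (mu t) (nu t) (S t)].
Proof.
move=> e0; have e2 : 0 < e / 2 by rewrite divr_gt0.
have [S [Sp Sc SK]] := cost_selection t0 e2; exists S; split => //.
apply: filterS2 SK (cost_lower_semicontinuous t0 e2) => t SK K0; split; first exact: Sp.
apply: (le_trans SK); rewrite [e in leRHS]splitr EFinD addeA.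
by rewrite leeD2r.
Qed.

(** The convex formula holds for bounded functions, so the cost of [Q] is replaced by a truncated
    mean at the price of [d]. Optimality is asked where the weight is positive, since a local
    selection is nearly optimal only near its base point. *)
Lemma eps_optimal_convex (t : T) (e : R) (N : nat) (w : nat -> R)
    (S : nat -> probability (borel (X * Y)%type) R) (Q : probability (borel (X * Y)%type) R) :
  (forall n, 0 <= w n) -> \sum_(n < N) w n = 1 ->
  (forall n, 0 < w n -> eps_optimal_plan e (h t) (mu t) (nu t) (S n)) ->
  (forall F, bounded_borel F -> \int[Q]_z F z = \sum_(n < N) w n * \int[S n]_z F z) ->
  eps_optimal_plan e (h t) (mu t) (nu t) Q.
Proof.
move=> w0 w1 Sopt QE.
have sumE (f g : nat -> R) : (forall n, 0 < w n -> f n = g n) ->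
    \sum_(n < N) w n * f n = \sum_(n < N) w n * g n.
  move=> fg; apply: eq_bigr => n _; have := w0 n; rewrite le_eqVlt => /predU1P[<-|/fg->//].
  by rewrite !mul0r.
have Qpr (A : set (borel (X * Y)%type)) (p : R) : measurable A ->
    (forall n, 0 < w n -> S n A = p%:E) -> Q A = p%:E.
  move=> mA SA; rewrite -EFin_pr// -pr_mean// QE; last exact: bounded_borel_indic.
  rewrite (sumE (fun n => \int[S n]_z \1_A z) (fun=> p)); first by rewrite -mulr_suml w1 mul1r.
  by move=> n /SA Sp; rewrite pr_mean// /pr Sp.
have Qplan : plan t Q.
  split=> [A mA|B mB].
    rewrite -(EFin_pr (mu t) mA); apply: Qpr => [|n /Sopt[[-> //]]]; last by rewrite EFin_pr.
    exact: (@measurable_rect_borel R X Y A setT mA measurableT).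
  rewrite -(EFin_pr (nu t) mB); apply: Qpr => [|n /Sopt[[_ -> //]]]; last by rewrite EFin_pr.
  exact: (@measurable_rect_borel R X Y setT B measurableT mB).
split=> //; apply/lee_addgt0Pr => d d0.
have [M M0 /(_ t Q Qplan) QM] := cost_truncation d0.
apply: (le_trans QM); rewrite EFinD leeD2r// -/(K t) -(fineK (cost_fin_num t)) -EFinD lee_fin.
rewrite QE; last exact/bdc_borel/trunc_slice.
rewrite -[leRHS]mul1r -w1 mulr_suml; apply: ler_sum => n _.
have := w0 n; rewrite le_eqVlt => /predU1P[<-|wn]; first by rewrite !mul0r.
rewrite ler_pM2l// -lee_fin; apply: le_trans (mean_trunc_le _ _ M0) _.
by rewrite EFinD fineK ?cost_fin_num//; exact: (Sopt n wn).2.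
Qed.

End costs.
(** * Gluing of local selections *)

Section partition.
Context {R : realType} {T : metricType R}.

Lemma continuous_mdist_bound (f : T -> R) :
  (forall s t, f s <= f t + mdist s t) -> continuous f.
Proof.
move=> fl t; apply/cvgrPdist_lt => e e0; near=> s.
have : ball t e s by near: s; exact: nbhsx_ballx.
rewrite ballEmdist /= => st; apply: le_lt_trans st.
by have := fl s t; have := fl t s; rewrite metric_sym ler_norml => ? ?; apply/andP; split; lra.
Unshelve. all: by end_near. Qed.

(* M. E. Rudin's proof of paracompactness: two points of [E n] whose indices differ
   are at distance at least [3 / 2 ^+ n]. *)
Lemma discrete_refinement (W : T -> set T) : (forall i, nbhs i (W i)) ->
  exists (phi : nat -> T -> R) (idx : nat -> T -> T),
  [/\ forall n, continuous (phi n), forall n t, 0 <= phi n t <= 1,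
    forall t, exists n, 0 < phi n t,
    forall n t, 0 < phi n t -> W (idx n t) t &
    forall n t, 0 < phi n t -> \forall s \near t, idx n s = idx n t].
Proof.
move=> nW; have [le wo] := well_ordering_principle T.
(* [i t] is the least index, in a well-order of [T], whose set contains [t] in its interior. *)
have /choice[i iP] t : exists i, (W i)^° t /\ forall j, (W j)^° t -> le i j.
  have [|i [[ti ilb] _]] := wo [pred i | `[< (W i)^° t >]].
    by exists t; rewrite inE; apply: nW.
  exists i; split; first by move: ti; rewrite inE.
  by move=> j tj; apply: ilb; rewrite inE.
(* Each index is admissible for the other point, so each is below the other. Antisymmetry is read
   off from the uniqueness of the least element of the pair. *)
have iI t s : (W (i t))^° s -> (W (i s))^° t -> i t = i s.
  move=> ts st; have le_ts := (iP t).2 _ st; have le_st := (iP s).2 _ ts.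
  have le_tt := (iP t).2 _ (iP t).1; have le_ss := (iP s).2 _ (iP s).1.
  have [|z [_ zu]] := wo [pred j | (j == i t) || (j == i s)].
    by exists (i t); rewrite inE eqxx.
  rewrite -(zu (i t)); last first.
    by split=> [|j]; rewrite inE ?eqxx// => /orP[]/eqP->.
  by apply: zu; split=> [|j]; rewrite inE ?eqxx ?orbT// => /orP[]/eqP->.
pose r n : R := 2^-1 ^+ n.
have r0 n : 0 < r n by rewrite exprn_gt0.
pose E n := [set x | ball x (3 * r n) `<=` (W (i x))^°].
have iE n x y : E n x -> E n y -> mdist x y < 3 * r n -> i x = i y.
  move=> Ex Ey xy; apply: iI; first by apply: Ex; rewrite ballEmdist.
  by apply: Ey; rewrite ballEmdist/= metric_sym.
(* Tents of height and radius [r n] over the points of [E n]; the added zero makes the supremum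
   nonnegative and the set inhabited. Two tents positive at the same point have tops closer than
   [2 * r n], hence the same index. *)
pose A n t := [set q : R | q = 0 \/ exists2 x, E n x & q = r n - mdist t x].
have Aub n t : ubound (A n t) (r n).
  by move=> q [->|[x _ ->]]; [exact: ltW|rewrite gerBl mdist_ge0].
have hub n t : has_ubound (A n t) by exists (r n); exact: Aub.
have A0 n t : A n t 0 by left.
pose phi n t := sup (A n t).
have phi_ge n t x : E n x -> r n - mdist t x <= phi n t.
  by move=> Ex; apply: ub_le_sup => //; right; exists x.
have phi_ge0 n t : 0 <= phi n t by exact: ub_le_sup.
have phi_gt0 n t : 0 < phi n t -> exists x, E n x /\ mdist t x < r n.
  move=> /sup_gt[|q [->|[x Ex ->]]]; first by exists 0.
    by rewrite ltxx.
  by rewrite subr_gt0 => tx; exists x.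
pose idx n t := i (xget t [set x | E n x /\ mdist t x < r n]).
have idxE n t x : E n x -> mdist t x < r n -> idx n t = i x.
  move=> Ex tx; rewrite /idx; case: xgetP => [y -> [Ey ty]|/(_ x)/=]; last by case.
  apply: (iE n) => //; apply: le_lt_trans (metric_triangle _ t _) _.
  rewrite metric_sym; apply: (lt_trans (ltrD ty tx)).
  by have := r0 n; lra.
exists phi, idx; split.
- move=> n; apply: continuous_mdist_bound => s t; apply: ge_sup; first by exists 0.
  move=> q [->|[x Ex ->]]; first by rewrite addr_ge0// mdist_ge0.
  have := phi_ge n t x Ex; have := metric_triangle t s x; rewrite (metric_sym t s); lra.
- move=> n t; rewrite phi_ge0/=; apply: (@le_trans _ _ (r n)).
    by apply: ge_sup; [exists 0|exact: Aub].
  by rewrite exprn_ile1 ?invr_ge0// invf_le1// ler1n.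
- move=> t; have : nbhs t (W (i t))^°.
    by apply: open_nbhs_nbhs; split; [exact: open_interior|exact: (iP t).1].
  move=> /nbhs_ballP[e/= e0 te].
  have [n rn] : exists n, 3 * r n < e.
    have e3 : 0 < e / 3 by rewrite divr_gt0.
    have := @cvg_geometric R 1 2^-1; rewrite gtr0_norm// invf_lt1// ltrDl ltr01 => /(_ isT).
    move=> /cvgr0Pnorm_lt/(_ _ e3)[n _ /(_ n)/=]; rewrite leqnn mul1r => /(_ isT) rn.
    by exists n; rewrite mulrC -ltr_pdivlMr//; apply: le_lt_trans rn; exact: ler_norm.
  exists n; apply: (@lt_le_trans _ _ (r n - mdist t t)); first by rewrite mdistxx subr0.
  by apply: phi_ge => x /(le_ball (ltW rn)); exact: te.
- move=> n t /phi_gt0[x [Ex tx]]; rewrite (idxE n t x)//; apply: interior_subset.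
  by apply: Ex; rewrite ballEmdist/= metric_sym (lt_trans tx)// ltr_pMl// ltr1n.
- move=> n t /phi_gt0[x [Ex tx]]; rewrite (idxE n t x)//.
  have d0 : 0 < r n - mdist t x by rewrite subr_gt0.
  near=> s; apply: idxE => //.
  have : ball t (r n - mdist t x) s by near: s; exact: nbhsx_ballx.
  rewrite ballEmdist/= => ts; have := metric_triangle s t x; rewrite (metric_sym s t); lra.
Unshelve. all: by end_near. Qed.

Lemma locally_finite_refinement (W : T -> set T) : (forall i, nbhs i (W i)) ->
  exists (psi : nat -> T -> R) (idx : nat -> T -> T),
  [/\ forall n, bdc (psi n), forall n t, 0 <= psi n t,
    forall t, exists N, (exists n, (n < N)%N /\ 0 < psi n t) /\
      \forall s \near t, forall n, (N <= n)%N -> psi n s = 0,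
    forall n t, 0 < psi n t -> W (idx n t) t &
    forall n t, 0 < psi n t -> \forall s \near t, idx n s = idx n t].
Proof.
move=> /discrete_refinement[phi [idx [cphi phi01 phi_gt0 idxW idx_cst]]].
have phi0 n t : 0 <= phi n t by have /andP[] := phi01 n t.
have phi1 n t : phi n t <= 1 by have /andP[] := phi01 n t.
have bphi n : bdc (phi n) by split => //; exists 1 => t; rewrite ger0_norm.
(* Once some earlier [phi m] is at least [1 / n] near a point, the subtracted term is at least one
   and [psi n] vanishes there. The first [phi m] positive at a point is unchanged there, so some
   [psi] is positive. *)
pose psi n t := Num.max 0 (phi n t - n%:R * \sum_(k < n) phi k t).
have psi_phi n t : 0 < psi n t -> 0 < phi n t.
  rewrite /psi lt_max ltxx/= => h; apply: (lt_le_trans h).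
  by rewrite gerBl mulr_ge0// sumr_ge0.
exists psi, idx; split.
- move=> n; split.
    have [cq _] := bdcB (bphi n) (bdcM (bdc_cst T n%:R)
      (bdc_sum (index_enum 'I_n) (fun k : 'I_n => bphi k))).
    have c0 : continuous ((fun=> 0) : T -> R^o) by exact: cst_continuous.
    by move=> t; exact: continuous_max (c0 t) (cq t).
  exists 1 => t; rewrite ger0_norm ?le_max ?lexx//= ge_max ler01/=.
  by rewrite lerBlDr -[leLHS]addr0 lerD// mulr_ge0// sumr_ge0.
- by move=> n t; rewrite le_max lexx.
- move=> t; have [m mP mmin] := ex_minnP (phi_gt0 t).
  have m2 : phi m t / 2 < phi m t by rewrite ltr_pdivrMr// ltr_pMr// ltr1n.
  have psim : 0 < psi m t.
    rewrite /psi lt_max ltxx/= big1 ?mulr0 ?subr0// => k _.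
    apply/eqP; rewrite eq_le phi0 andbT leNgt; apply/negP => /mmin.
    by rewrite leqNgt ltn_ord.
  (* Near [t], [phi m] stays above half of its value at [t], so [n * phi m] is at least one once [n]
     reaches [2 / phi m t]; [m.+1] makes [phi m] one of the subtracted terms. *)
  exists (maxn m.+1 (Num.truncn (2 / phi m t)).+1); split.
    by exists m; rewrite leq_max ltnSn.
  near=> s => n; rewrite geq_max => /andP[mn nn].
  have ms : phi m t / 2 < phi m s.
    by near: s; exact: (cvgr_gt _ (cphi m t)).
  apply/max_idPl; rewrite subr_le0; apply: (le_trans (phi1 n s)).
  apply: (@le_trans _ _ (n%:R * phi m s)); last first.
    rewrite ler_wpM2l// (bigD1 (Ordinal mn))//= lerDl sumr_ge0//.
  apply: (@le_trans _ _ (n%:R * (phi m t / 2))); last by rewrite ler_wpM2l// ltW.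
  rewrite -ler_pdivrMr ?divr_gt0// mul1r invf_div.
  by apply: le_trans (ltW (truncnS_gt _)) _; rewrite ler_nat.
- by move=> n t /psi_phi; exact: idxW.
- by move=> n t /psi_phi; exact: idx_cst.
Unshelve. all: by end_near. Qed.

End partition.

Lemma convex_probability (R : realType) (Z : ptopologicalType) (N : nat) (w : nat -> R)
    (S : nat -> probability (borel Z) R) :
  (forall n, 0 <= w n) -> \sum_(n < N) w n = 1 ->
  exists Q : probability (borel Z) R, forall F, bounded_borel F ->
    \int[Q]_z F z = \sum_(n < N) w n * \int[S n]_z F z.
Proof.
move=> w0 w1.
apply: (@functional_measure _ _ (fun F => \sum_(n < N) w n * \int[S n]_z F z)).
- move=> f g bf bg; rewrite -big_split/=; apply: eq_bigr => n _.
  by rewrite meanD// mulrDr.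
- move=> r f bf; rewrite mulr_sumr; apply: eq_bigr => n _.
  by rewrite meanZ// mulrCA.
- by move=> f bf f0; apply: sumr_ge0 => n _; rewrite mulr_ge0//; exact: Rintegral_ge0.
- by rewrite -[RHS]w1; apply: eq_bigr => n _; rewrite mean_cst mulr1.
- move=> f M bf fM f0; have E : \sum_(n < N) w n * 0 = 0 by rewrite big1// => n _; rewrite mulr0.
  rewrite -[X in _ --> X]E.
  by apply: cvg_sum => n; apply: cvgMr; exact: (mean_bounded_cvg0 _ bf fM f0).
Qed.

Section gluing.
Context {R : realType} {T : metricType R} {Z : ptopologicalType}.
Variables (S : T -> T -> probability (borel Z) R) (W : T -> set T).
Hypothesis S_cont : forall i F, bdc F -> continuous (fun t => \int[S i t]_z F z).
Hypothesis nW : forall i, nbhs i (W i).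

(** A term positive at [t0] follows a single selection nearby. For a term vanishing at [t0] the base
    point may jump, but the weight tends to zero and the means of [F] are bounded. *)
Lemma glue_selections : exists Q : T -> probability (borel Z) R,
  (forall t, exists (N : nat) (w : nat -> R) (k : nat -> T),
    [/\ forall n, 0 <= w n, \sum_(n < N) w n = 1, forall n, 0 < w n -> W (k n) t &
      forall F, bounded_borel F -> \int[Q t]_z F z = \sum_(n < N) w n * \int[S (k n) t]_z F z]) /\
  forall F, bdc F -> continuous (fun t => \int[Q t]_z F z).
Proof.
have [psi [idx [bpsi psi0 lf idxW idx_cst]]] := @locally_finite_refinement R T W nW.
have /choice[N NP] := lf.
pose tot t := \sum_(n < N t) psi n t.
have tot_gt0 t : 0 < tot t.
  have [[n [nN psin]] _] := NP t.
  rewrite /tot (bigD1 (Ordinal nN))//= ltr_pwDl// sumr_ge0//.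
pose w t n := psi n t / tot t.
have w0 t n : 0 <= w t n by rewrite divr_ge0// ltW.
have w1 t : \sum_(n < N t) w t n = 1 by rewrite /w -mulr_suml -/(tot t) divff// gt_eqF.
have /choice[Q QP] t := @convex_probability R Z (N t) (w t) (fun n => S (idx n t) t) (w0 t) (w1 t).
exists Q; split.
  move=> t; exists (N t), (w t), (fun n => idx n t); split => // [n|F bF]; last exact: QP.
  by rewrite /w pmulr_lgt0 ?invr_gt0//; exact: idxW.
move=> F bF t0; have bbF := bdc_borel bF.
(* [N t] may differ from [N t0]; both sums equal the sum up to the larger bound, as the additional
   terms vanish. *)
have widen (f : nat -> T -> R) : \forall t \near t0,
    \sum_(n < N t) psi n t * f n t = \sum_(n < N t0) psi n t * f n t.
  have [_ N0] := NP t0; apply: filterS N0 => t N0; have [_ /nbhs_singleton Nt] := NP t.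
  pose m := maxn (N t) (N t0).
  have E k : (k <= m)%N -> (forall n, (k <= n)%N -> psi n t = 0) ->
      \sum_(n < k) psi n t * f n t = \sum_(n < m) psi n t * f n t.
    move=> km psik; rewrite -!(big_mkord xpredT (fun n => psi n t * f n t)).
    rewrite (big_cat_nat (leq0n k) km)/= [X in _ = _ + X]big_nat_cond.
    rewrite [X in _ = _ + X]big1 ?addr0// => n.
    by rewrite andbT => /andP[kn _]; rewrite psik// mul0r.
  by rewrite (E (N t)) ?leq_maxl// (E (N t0)) ?leq_maxr.
have QE : \forall t \near t0, (\sum_(n < N t0) psi n t * \int[S (idx n t) t]_z F z) /
    (\sum_(n < N t0) psi n t * 1) = \int[Q t]_z F z.
  apply: filterS2 (widen (fun n t => \int[S (idx n t) t]_z F z)) (widen (fun _ _ => 1)) => t <- <-.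
  rewrite QP// mulr_suml; apply: eq_bigr => n _.
  by rewrite mulrAC; congr (_ / _ * _); apply: eq_bigr => k _; rewrite mulr1.
apply: (cvg_trans (near_eq_cvg QE)); rewrite -(nbhs_singleton QE).
apply: cvgM; last first.
  apply: cvgV.
    rewrite gt_eqF// (eq_bigr (fun n : 'I_(N t0) => psi n t0)) ?tot_gt0// => n _.
    by rewrite mulr1.
  apply: cvg_sum => n; apply: cvgM; [exact: (bpsi n).1|exact: cvg_cst].
apply: cvg_sum => n; have [psin|psin] := ltP 0 (psi n t0).
  apply: cvgM; first exact: (bpsi n).1.
  have E : \forall t \near t0, \int[S (idx n t0) t]_z F z = \int[S (idx n t) t]_z F z.
    by apply: filterS (idx_cst n t0 psin) => t ->.
  by apply: (cvg_trans (near_eq_cvg E)); exact: S_cont (idx n t0) F bF t0.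
have -> : psi n t0 = 0 by apply/eqP; rewrite eq_le psin psi0.
rewrite mul0r; have [M FM] := bF.2.
apply/cvgr0Pnorm_le => e e0.
have M0 : 0 <= M by apply: le_trans (FM point).
have d0 : 0 < e / (M + 1) by rewrite divr_gt0// ltr_wpDl.
have psin0 : psi n t0 = 0 by apply/eqP; rewrite eq_le psin psi0.
have /cvgr0Pnorm_le/(_ _ d0) : psi n t @[t --> t0] --> 0 by rewrite -psin0; exact: (bpsi n).1.
apply: filterS => t psit; rewrite normrM; apply: (@le_trans _ _ (e / (M + 1) * (M + 1))).
  apply: ler_pM => //; apply: (@le_trans _ _ M); last by rewrite lerDl.
  exact: norm_mean_bound.
by rewrite divfK// gt_eqF// ltr_wpDl.
Qed.

End gluing.

Theorem theorem3p7 (R : realType) (X Y : completeMetricType R)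
    (T : metricType R)
    (mu : T -> probability (borel X) R) (nu : T -> probability (borel Y) R)
    (mu_radon : forall t, radon_probability (mu t))
    (nu_radon : forall t, radon_probability (nu t))
    (mu_cont : continuous (mu : T -> weak_probability R X))
    (nu_cont : continuous (nu : T -> weak_probability R Y))
    (h : T -> X -> Y -> R)
    (h_cont : continuous (fun p : T * X * Y => h p.1.1 p.1.2 p.2))
    (h_ge0 : forall t x y, 0 <= h t x y)
    (a : T -> borel X -> R) (b : T -> borel Y -> R)
    (a_ge0 : forall t x, 0 <= a t x) (b_ge0 : forall t y, 0 <= b t y)
    (a_borel : forall t, measurable_fun setT (a t))
    (b_borel : forall t, measurable_fun setT (b t))
    (a_L1 : forall t, (mu t).-integrable setT (EFin \o a t))
    (b_L1 : forall t, (nu t).-integrable setT (EFin \o b t))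
    (h_le : forall t x y, h t x y <= a t x + b t y)
    (ab_unif :
      (ereal_sup [set (\int[mu t]_(x in [set x | (r <= a t x)%R]) (a t x)%:E +
                       \int[nu t]_(y in [set y | (r <= b t y)%R]) (b t y)%:E)%E
                 | t in [set: T]]) @[r --> +oo%R] --> (0%E : \bar R)) :
  (exists sigma : R -> T -> probability (borel (X * Y)%type) R,
    forall eps : R, 0 < eps ->
      (forall t, eps_optimal_plan eps (h t) (mu t) (nu t) (sigma eps t)) /\
      continuous (sigma eps : T -> weak_probability R (X * Y)%type)) /\
  (forall sigma : T -> probability (borel (X * Y)%type) R,
    (forall t, unique_optimal_plan (h t) (mu t) (nu t) (sigma t)) ->
    continuous (sigma : T -> weak_probability R (X * Y)%type)).
Proof.
have hX : hausdorff_space X := @metric_hausdorff R X.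
have hY : hausdorff_space Y := @metric_hausdorff R Y.
have mu_wcr : @weakly_continuous_radon R T X mu.
  by split=> // f bf t; exact: ((continuous_weakP _ _).1 (mu_cont t) f bf).
have nu_wcr : @weakly_continuous_radon R T Y nu.
  by split=> // f bf t; exact: ((continuous_weakP _ _).1 (nu_cont t) f bf).
have weak (sigma : T -> probability (borel (X * Y)%type) R) :
    (forall F, bdc F -> continuous (fun t => \int[sigma t]_z F z)) ->
    continuous (sigma : T -> weak_probability R (X * Y)%type).
  by move=> sc t; apply/continuous_weakP => f bf; exact: sc.
split; last first.
  move=> sigma so; apply: weak => F bF.
  exact: (optimal_plan_continuous hX hY mu_wcr nu_wcr h_cont h_ge0 a_ge0 b_ge0 a_borel
    b_borel h_le ab_unif so bF).
have /choice[sigma sigmaP] (eps : R) : exists sigma : T -> probability (borel (X * Y)%type) R,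
    0 < eps -> (forall t, eps_optimal_plan eps (h t) (mu t) (nu t) (sigma t)) /\
      continuous (sigma : T -> weak_probability R (X * Y)%type).
  (* For [eps] not positive nothing is claimed, and arbitrary plans serve as the default value. *)
  have [e0|e0] := ltP 0 eps; last first.
    have /choice[sigma _] t := @plans_nonempty R X Y T mu nu t.
    by exists sigma.
  have /choice[S SP] t0 := local_eps_selection hX hY mu_wcr nu_wcr h_cont h_ge0 a_ge0 b_ge0
    a_borel b_borel h_le ab_unif t0 e0.
  (* A positive weight at [t] places [t] in this set, so the plans averaged with positive weight are
     all [eps]-optimal at [t]. *)
  pose W t0 := [set t | eps_optimal_plan eps (h t) (mu t) (nu t) (S t0 t)].
  have [||Q [Qw Qc]] := @glue_selections R T (X * Y)%type S W.
  - by move=> t0; case: (SP t0).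
  - by move=> t0; case: (SP t0).
  exists Q => _; split; last exact: weak.
  move=> t; have [N [w [k [w0 w1 wk QE]]]] := Qw t.
  exact: (eps_optimal_convex h_cont h_ge0 a_ge0 b_ge0 a_borel b_borel h_le ab_unif w0 w1 wk QE).
by exists sigma.
Qed.
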